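(* Let $p\in[1,\infty)$, $1/p+1/q=1$, $\alpha\in(0,1]$, and let $f\in L^p(\mathbb{R}^n)$. The following conditions are equivalent: (i) $f\in B^\alpha_p(\mathbb{R}^n)$; (ii) $V^{p,\alpha}(f)<\infty$; (iii) $V_0^{p,\alpha}(f)<\infty$. Moreover, $$2^{\alpha-1}\|f\|_{p,\alpha}\le V_0^{p,\alpha}(f)\le V^{p,\alpha}(f)\le C(n,\alpha)\|f\|_{p,\alpha},$$ where $$C(n,\alpha)=(2\pi)^{-n/2}\int_{\mathbb{R}^n}|z|^\alpha e^{-\frac{|z|^2}{2}}\,dz+(2\pi)^{-n/2}\int_{\mathbb{R}^n}|z|^{1+\alpha}e^{-\frac{|z|^2}{2}}\,dz\le\sqrt n+n.$$
   Context: $|\cdot|$ is the Euclidean norm on $\mathbb{R}^n$; $\|\cdot\|_p$ is the $L^p$-norm with respect to Lebesgue measure on $\mathbb{R}^n$ and $\|\cdot\|_\infty$ the sup-norm; if $p=1$ then $q=\infty$. For a vector field $\Phi$, $\|\Phi\|_q$ is the $L^q$-norm of $|\Phi|$. Put $f_h(x):=f(x-h)$ and $\|f\|_{p,\alpha}:=\sup_{h\ne0}|h|^{-\alpha}\|f_h-f\|_p\in[0,+\infty]$. The class $B^\alpha_p(\mathbb{R}^n)$ consists of all $f\in L^p(\mathbb{R}^n)$ for which there is $C$ with $\|f_h-f\|_p\le C|h|^\alpha$ for all $h\in\mathbb{R}^n$ (this definition is used also for $\alpha=1$). For $f\in L^p(\mathbb{R}^n)$: - $V^{p,\alpha}(f)$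 is the infimum of all $C\ge0$ such that $\int_{\mathbb{R}^n}\mathrm{div}\Phi(x)f(x)\,dx\le C\|\Phi\|_q^\alpha\|\mathrm{div}\Phi\|_q^{1-\alpha}$ for all $\Phi\in C_0^\infty(\mathbb{R}^n,\mathbb{R}^n)$ (smooth compactly supported vector fields); - $V_0^{p,\alpha}(f)$ is the infimum of all $C\ge0$ such that $\int_{\mathbb{R}^n}\partial_e\varphi(x)f(x)\,dx\le C\|\varphi\|_q^\alpha\|\partial_e\varphi\|_q^{1-\alpha}$ for every $\varphi\in C_0^\infty(\mathbb{R}^n)$ and every unit vector $e\in\mathbb{R}^n$, where $\partial_e$ is the derivative along $e$. The infimum of the empty set is $+\infty$, and $0^0=1$. *)

(* Defs.v *)
From HB Require Import structures.
From mathcomp Require Import all_boot all_order all_algebra.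
From mathcomp Require Import all_classical all_reals all_analysis.

Set Implicit Arguments.
Unset Strict Implicit.
Unset Printing Implicit Defensive.
Import Order.TTheory GRing.Theory Num.Theory.
Import numFieldNormedType.Exports.
Local Open Scope classical_set_scope.
Local Open Scope ring_scope.

(* R^n is 'rV[R]_n.  Its sigma-algebra is the one generated by the
   coordinates, that is, the product (Borel) sigma-algebra; the construction
   follows the library's one for n.-tuple T. *)

Definition rV_display : measure_display. Proof. exact: default_measure_display. Qed.

Section measurable_rV.
Context {R : realType}.
Variable n : nat.

Definition rV_coord (i : 'I_n) (x : 'rV[R]_n) : measurableTypeR R := x ord0 i.

Let rV_set0 : g_sigma_preimage rV_coord set0.
Proof. exact: sigma_algebra0. Qed.

Let rV_setC A : g_sigma_preimage rV_coord A -> g_sigma_preimage rV_coord (~` A).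
Proof. exact: sigma_algebraC. Qed.

Let rV_bigcup (F : (set 'rV[R]_n)^nat) :
  (forall i, g_sigma_preimage rV_coord (F i)) ->
  g_sigma_preimage rV_coord (\bigcup_i (F i)).
Proof. exact: sigma_algebra_bigcup. Qed.

HB.instance Definition _ := @isMeasurable.Build rV_display
  'rV[R]_n (g_sigma_preimage rV_coord) rV_set0 rV_setC rV_bigcup.

End measurable_rV.

Section measurability.
Context {R : realType}.

Lemma measurable_rV_coord n (i : 'I_n) :
  measurable_fun [set: 'rV[R]_n] (@rV_coord R n i).
Proof.
move=> _ Y mY; rewrite setTI; apply: sub_sigma_algebra => /=.
rewrite -bigcup_seq/=; exists i => /=; first by rewrite mem_index_enum.
by exists Y => //; rewrite setTI.
Qed.

Lemma measurable_fun_rVP d (T : measurableType d) n (f : T -> 'rV[R]_n) :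
  (forall i, measurable_fun [set: T] (@rV_coord R n i \o f)) ->
  measurable_fun [set: T] f.
Proof.
move=> mf _ A mA; rewrite setTI.
suff : g_sigma_preimage (@rV_coord R n) `<=` [set B | measurable (f @^-1` B)].
  by apply.
apply: smallest_sub.
  split => /=.
  - by rewrite preimage_set0.
  - by move=> B mB; rewrite setTD -preimage_setC; exact: measurableC.
  - by move=> F mF; rewrite preimage_bigcup; exact: bigcup_measurable.
rewrite -bigcup_seq => B [i _ [C mC <-]] /=; rewrite setTI -comp_preimage.
by rewrite -[X in measurable X]setTI; exact: mf.
Qed.

Definition rV_cons n (p : measurableTypeR R * 'rV[R]_n) : 'rV[R]_n.+1 :=
  row_mx (p.1 : R)%:M p.2.

Definition rV_uncons n (x : 'rV[R]_n.+1) : measurableTypeR R * 'rV[R]_n :=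
  (x ord0 ord0, \row_j x ord0 (lift ord0 j)).

Lemma rV_cons0 n (p : measurableTypeR R * 'rV[R]_n) :
  rV_cons p ord0 ord0 = p.1.
Proof.
rewrite /rV_cons (_ : ord0 = lshift n (ord0 : 'I_1)); last exact/val_inj.
by rewrite (row_mxEl (p.1 : R)%:M) mxE mulr1n.
Qed.

Lemma rV_consS n (p : measurableTypeR R * 'rV[R]_n) j :
  rV_cons p ord0 (lift ord0 j) = p.2 ord0 j.
Proof.
rewrite /rV_cons (_ : lift ord0 j = rshift 1 j); last exact/val_inj.
by rewrite (row_mxEr (p.1 : R)%:M).
Qed.

Lemma rV_consK n : cancel (@rV_cons n) (@rV_uncons n).
Proof.
move=> [a x]; rewrite /rV_uncons rV_cons0/=; congr pair.
by apply/rowP => j; rewrite mxE rV_consS.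
Qed.

Lemma measurable_rV_cons n : measurable_fun setT (@rV_cons n).
Proof.
apply: measurable_fun_rVP => i.
have [->|[j ->]] : i = ord0 \/ exists j, i = lift ord0 j.
  by case: (unliftP ord0 i) => [j ->|->]; [right; exists j|left].
- rewrite (_ : _ \o _ = fst); first exact: measurable_fst.
  by apply/funext => p; rewrite /= /rV_coord rV_cons0.
- rewrite (_ : _ \o _ = @rV_coord R n j \o snd).
    by apply: measurableT_comp; [exact: measurable_rV_coord|exact: measurable_snd].
  by apply/funext => p; rewrite /= /rV_coord rV_consS.
Qed.

Lemma measurable_rV_uncons n : measurable_fun setT (@rV_uncons n).
Proof.
apply/measurable_fun_pairP; split.
  exact: (@measurable_rV_coord n.+1 ord0).
apply: measurable_fun_rVP => i.
rewrite (_ : _ \o _ = @rV_coord R n.+1 (lift ord0 i)).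
  exact: measurable_rV_coord.
by apply/funext => x; rewrite /= /rV_coord mxE.
Qed.

End measurability.

(* Lebesgue measure on R^n.+1 is the image of the product of the Lebesgue
   measures on R and R^n under (t, x) |-> (t, x_0, ..., x_(n-1)); on R^0 it is
   the Dirac mass. *)
Section lebesgue_rV.
Context {R : realType}.

Section step.
Context {n : nat}.
Variable mu : {sigma_finite_measure set 'rV[R]_n -> \bar R}.

Definition lebesgue_rV_step : set 'rV[R]_n.+1 -> \bar R :=
  pushforward (@lebesgue_measure R \x mu)%E (@rV_cons R n).

Let step0 : lebesgue_rV_step set0 = 0%E.
Proof. by rewrite /lebesgue_rV_step /pushforward preimage_set0 measure0. Qed.

Let step_ge0 A : (0 <= lebesgue_rV_step A)%E.
Proof. by rewrite /lebesgue_rV_step /pushforward measure_ge0. Qed.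

Let step_sigma_additive : semi_sigma_additive lebesgue_rV_step.
Proof.
have mp (A : set 'rV[R]_n.+1) : measurable A -> measurable (@rV_cons R n @^-1` A).
  by move=> mA; rewrite -[X in measurable X]setTI; exact: measurable_rV_cons.
move=> F mF tF mUF; rewrite /lebesgue_rV_step /pushforward preimage_bigcup.
apply: measure_semi_sigma_additive.
- by move=> k; exact: mp.
- apply/trivIsetP => /= i j _ _ ij; rewrite -preimage_setI.
  by move/trivIsetP : tF => /(_ _ _ _ _ ij) ->//; rewrite preimage_set0.
- by rewrite -preimage_bigcup; exact: mp.
Qed.

HB.instance Definition _ := isMeasure.Build _ _ _ lebesgue_rV_step
  step0 step_ge0 step_sigma_additive.

Let step_sigma_finite : sigma_finite [set: 'rV[R]_n.+1] lebesgue_rV_step.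
Proof.
have /sigma_finiteP[F [TF ndF Foo]] := sigma_finiteT (@lebesgue_measure R).
have /sigma_finiteP[G [TG ndG Goo]] := sigma_finiteT mu.
exists (fun k => @rV_uncons R n @^-1` (F k `*` G k)).
  apply/esym/seteqP; split=> // x _.
  have [i _ Fi] : (\bigcup_i F i) (@rV_uncons R n x).1 by rewrite -TF.
  have [j _ Gj] : (\bigcup_i G i) (@rV_uncons R n x).2 by rewrite -TG.
  exists (maxn i j) => //; split.
  - by move: Fi; exact/subsetPset/ndF/leq_maxl.
  - by move: Gj; exact/subsetPset/ndG/leq_maxr.
move=> k; have [mF Fk] := Foo k; have [mG Gk] := Goo k; split.
  rewrite -[X in measurable X]setTI.
  by apply: measurable_rV_uncons => //; exact: measurableX.
rewrite /lebesgue_rV_step /pushforward -comp_preimage.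
rewrite (_ : _ \o _ = id) ?preimage_id; last first.
  by apply/funext => p; exact: rV_consK.
by rewrite product_measure1E// lte_mul_pinfty// ge0_fin_numE.
Qed.

HB.instance Definition _ := Measure_isSigmaFinite.Build _ _ _ lebesgue_rV_step
  step_sigma_finite.

End step.

Fixpoint lebesgue_rV n : {sigma_finite_measure set 'rV[R]_n -> \bar R} :=
  if n is n'.+1 then lebesgue_rV_step (lebesgue_rV n')
  else \d_(0 : 'rV[R]_0).

Lemma lebesgue_rV_box n (A : 'I_n -> set (measurableTypeR R)) :
  (forall i, measurable (A i)) ->
  lebesgue_rV n [set x | forall i, A i (x ord0 i)] =
  (\prod_(i < n) lebesgue_measure (A i))%E.
Proof.
elim: n => [|n IH] in A *.
  move=> _; rewrite big_ord0 /= diracE mem_set//.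
  by move=> i; case: i.
move=> mA; rewrite big_ord_recl -IH//=.
set B := (X in (_ = _ * lebesgue_rV n X)%E).
rewrite /lebesgue_rV_step /pushforward.
rewrite (_ : _ @^-1` _ = A ord0 `*` B); last first.
  apply/seteqP; split => [p pA|p [p1 p2] i] /=.
    split; first by rewrite -(rV_cons0 p); exact: pA.
    by move=> j /=; rewrite -rV_consS; exact: pA.
  case: (unliftP ord0 i) => [j ->|->]; last by rewrite rV_cons0.
  by rewrite rV_consS; exact: p2.
rewrite product_measure1E//.
rewrite (_ : B = \bigcap_(i in [set: 'I_n]) (@rV_coord R n i @^-1` A (lift ord0 i))).
  apply: fin_bigcap_measurable => // i _.
  by rewrite -[X in measurable X]setTI; exact: measurable_rV_coord.
by apply/seteqP; split => [x Bx i _|x Bx i]; exact: Bx.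
Qed.

End lebesgue_rV.

Section definitions.
Context {R : realType} {n : nat}.
Local Notation V := 'rV[R]_n.
Local Notation mu := (lebesgue_rV (R := R) n).

(* The norm `|x| of the library on 'rV[R]_n is the maximum norm. *)
Definition enorm (x : V) : R := Num.sqrt (\sum_(i < n) x ord0 i ^+ 2).

(* For q = +oo this is the supremum (not the essential supremum); both agree
   on continuous functions, the only ones to which it is applied. *)
Definition qnorm (q : \bar R) (g : V -> R) : \bar R :=
  (if q == +oo then ereal_sup [set `|g x|%:E | x in [set: V]]
   else 'N[mu]_q [EFin \o g])%E.

Definition basis_vec (i : 'I_n) : V := delta_mx ord0 i.

Definition iter_partial (s : seq 'I_n) (phi : V -> R) : V -> R :=
  foldr (fun i g => 'D_(basis_vec i) g) phi s.

Definition smooth (phi : V -> R) : Prop :=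
  forall s : seq 'I_n,
    (forall i x, derivable (iter_partial s phi) x (basis_vec i)) /\
    continuous (iter_partial s phi).

Definition test_function (phi : V -> R) : Prop :=
  smooth phi /\ compact (closure [set x | phi x != 0]).

Definition test_field (Phi : V -> V) : Prop :=
  (forall i, smooth (fun x => Phi x ord0 i)) /\
  compact (closure [set x | Phi x != 0]).

Definition divergence (Phi : V -> V) (x : V) : R :=
  \sum_(i < n) 'D_(basis_vec i) (fun y => Phi y ord0 i) x.

Definition translate (h : V) (f : V -> R) : V -> R := fun x => f (x - h).

Definition diff_norm (p : R) (f : V -> R) (h : V) : \bar R :=
  'N[mu]_p%:E [EFin \o (translate h f \- f)].

Definition holder_seminorm (p alpha : R) (f : V -> R) : \bar R :=
  ereal_sup [set ((enorm h `^ (- alpha))%:E * diff_norm p f h)%E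
            | h in [set h | h != 0]].

Definition besov (p alpha : R) (f : V -> R) : Prop :=
  f \in Lfun mu p%:E /\
  exists C : R, forall h : V, (diff_norm p f h <= (C * enorm h `^ alpha)%:E)%E.

(* The library's powers satisfy 0 `^ 0 = 1, and ereal_inf set0 = +oo. *)
Definition Vvar (p alpha : R) (f : V -> R) : \bar R :=
  let q := hoelder_conjugate p%:E in
  ereal_inf [set C%:E | C in [set C : R | 0 <= C /\
    forall Phi, test_field Phi ->
      (\int[mu]_x (divergence Phi x * f x)%:E <=
       C%:E * qnorm q (enorm \o Phi) `^ alpha
            * qnorm q (divergence Phi) `^ (1 - alpha))%E]].

Definition Vvar0 (p alpha : R) (f : V -> R) : \bar R :=
  let q := hoelder_conjugate p%:E in
  ereal_inf [set C%:E | C in [set C : R | 0 <= C /\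
    forall phi e, test_function phi -> enorm e = 1 ->
      (\int[mu]_x ('D_e phi x * f x)%:E <=
       C%:E * qnorm q phi `^ alpha
            * qnorm q ('D_e phi) `^ (1 - alpha))%E]].

End definitions.

Definition gauss_const (R : realType) (n : nat) (alpha : R) : \bar R :=
  (((2 * pi) `^ (- (n%:R / 2)))%:E *
     \int[lebesgue_rV n]_z (enorm z `^ alpha * expR (- (enorm z ^+ 2 / 2)))%:E
   + ((2 * pi) `^ (- (n%:R / 2)))%:E *
     \int[lebesgue_rV n]_z
        (enorm z `^ (1 + alpha) * expR (- (enorm z ^+ 2 / 2)))%:E)%E.

(* Main.v *)
Require Import Defs.
From HB Require Import structures.
From mathcomp Require Import all_boot all_order all_algebra.
From mathcomp Require Import all_classical all_reals all_analysis.
From mathcomp Require Import measurable_realfun.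
From mathcomp Require Import ring lra.

Set Implicit Arguments.
Unset Strict Implicit.
Unset Printing Implicit Defensive.
Import Order.TTheory GRing.Theory Num.Theory.
Import numFieldNormedType.Exports.
Local Open Scope classical_set_scope.
Local Open Scope ring_scope.

(* Upper bound.  Let g be the standard Gaussian density.  For fixed x and t > 0,
   the function div Phi(x+tz) g(z) - t^-1 <Phi(x+tz), z> g(z) of z is a
   divergence, so its integral is 0.  Subtracting f(x) times it and translating
   in x gives
     int f div Phi = int g(z) int (f(x) - f(x-tz)) (div Phi(x) - t^-1 <Phi(x), z>) dx dz,
   and Hoelder's inequality bounds this by
     ||f||_{p,alpha} (t^alpha m_alpha ||div Phi||_q + t^(alpha-1) m_(1+alpha) ||Phi||_q)
   with m_b the Gaussian moments; take t = ||Phi||_q / ||div Phi||_q.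

   Lower bound.  For a test function psi and h <> 0, let phi(x) be the integral of
   psi(x + s h/|h|) over 0 <= s <= |h|.  Its derivative along h/|h| is
   psi(x+h) - psi(x), of norm at most 2 ||psi||_q, and ||phi||_q <= |h| ||psi||_q.
   Hence int psi (f_h - f) <= V_0 |h|^alpha 2^(1-alpha) ||psi||_q, and duality
   bounds ||f_h - f||_p.  Duality rests on the density of test functions in
   weighted L^1 spaces. *)

(** * Invariance of Lebesgue measure on R^n *)

(** The Gaussian is a convenient averaging kernel because its gradient is -z g(z): integration by
    parts costs only the factor <Phi, z> / t, whose moments are finite. The factor 2^(1-alpha) of
    the lower bound comes solely from ||psi(. + h) - psi||_q <= 2 ||psi||_q. There the primitive phi
    is replaced by Riemann sums, whose derivative differs from psi(. + h) - psi by O(1/N), uniformly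
    and inside a fixed ball, hence also in q-norm. In the duality the multiplier that detects ||f_h
    - f||_p is only measurable, while the hypothesis speaks of test functions. For p = 1 the q-norm
    is a supremum, in which continuous functions do not approximate measurable ones; the
    approximants instead keep the bound |psi| <= 1 and converge in L^1 for the weight 1 + |f_h - f|
    on a fixed ball. That one convergence controls the pairing and, for p > 1, the q-norm as well.
    Finally, [smooth] mentions only derivatives along basis vectors, so linearity of the derivative
    in its direction is a fact to be proved. *)

Section line_invariance.
Context {R : realType}.
Implicit Type f : R -> \bar R.

(** Lebesgue measure is determined by its values on half-open intervals, so the image measure under
    [tau] need only be compared there; the left-hand integral is the integral against that image
    measure. *)
Lemma ge0_integral_line_invariant (tau : measurableTypeR R -> measurableTypeR R)
    (mtau : measurable_fun [set: measurableTypeR R] tau) :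
  (forall X : set (measurableTypeR R), ocitv X ->
     lebesgue_measure X = lebesgue_measure (tau @^-1` X)) ->
  forall f : measurableTypeR R -> \bar R, measurable_fun setT f ->
  (forall t, (0 <= f t)%E) ->
  (\int[lebesgue_measure]_t f (tau t) = \int[lebesgue_measure]_t f t)%E.
Proof.
move=> tauP f mf f0.
have := ge0_integral_pushforward mtau lebesgue_measure measurableT mf (fun x _ => f0 x).
rewrite preimage_setT => <-.
pose nu := measure_function_pushforward__canonical__measure_function_Measure
  (@lebesgue_measure R) mtau.
apply: (eq_measure_integral (@lebesgue_measure R) (m1 := nu)) => A mA _.
exact/esym/(@lebesgue_measure_unique _ nu).
Qed.

Lemma ge0_integral_line_shift (a : R) f :
  measurable_fun [set: R] f -> (forall t, (0 <= f t)%E) ->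
  (\int[lebesgue_measure]_t f (t + a)%R = \int[lebesgue_measure]_t f t)%E.
Proof.
apply: (@ge0_integral_line_invariant (fun t => t + a)).
  exact: measurable_funD.
move=> _ [[x y] _ <-].
rewrite (_ : _ @^-1` _ = `]x - a, y - a]%classic); last first.
  by apply/seteqP; split=> t /=; rewrite !in_itv/= ltrBlDr lerBrDr.
rewrite !lebesgue_measure_itv/= !lte_fin ltrD2r; case: ifP => // _.
by rewrite -!EFinD; congr EFin; ring.
Qed.

Lemma ge0_integral_line_opp f :
  measurable_fun [set: R] f -> (forall t, (0 <= f t)%E) ->
  (\int[lebesgue_measure]_t f (- t)%R = \int[lebesgue_measure]_t f t)%E.
Proof.
apply: (@ge0_integral_line_invariant -%R).
  exact: measurable_funN.
move=> X oX; rewrite -[LHS]lebesgue_measureN//.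
by case: oX => -[x y] _ <-; exact: measurable_itv.
Qed.

End line_invariance.

Section lebesgue_rV_integral.
Context {R : realType}.

Lemma ge0_integral_rV_step n (F : 'rV[R]_n.+1 -> \bar R) :
  measurable_fun setT F -> (forall x, (0 <= F x)%E) ->
  (\int[lebesgue_rV n.+1]_x F x =
   \int[lebesgue_measure]_t \int[lebesgue_rV n]_x F (rV_cons (t, x)))%E.
Proof.
move=> mF F0.
have mFc : measurable_fun setT (F \o @rV_cons R n).
  by apply: measurableT_comp => //; exact: measurable_rV_cons.
have := ge0_integral_pushforward (@measurable_rV_cons R n)
  (@lebesgue_measure R \x lebesgue_rV n)%E measurableT mF (fun x _ => F0 x).
rewrite preimage_setT => ->.
by rewrite (fubini_tonelli1 (F \o @rV_cons R n)) //= => x; exact: F0.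
Qed.

Lemma measurable_rV_consr n (t : R) :
  measurable_fun setT (fun x : 'rV[R]_n => rV_cons (t, x)).
Proof.
by apply: (measurableT_comp (@measurable_rV_cons R n)); exact: measurable_pair1.
Qed.

(** The measure is built one coordinate at a time, so by Tonelli and induction on [n] invariance on
    the line passes to maps acting on each coordinate separately. The map may depend on [i] because
    a translation moves each coordinate by its own amount. *)
Lemma ge0_integral_rV_invariant n (tau : 'I_n -> R -> R) :
  (forall i, measurable_fun setT (tau i)) ->
  (forall i f, measurable_fun [set: R] f -> (forall t, (0 <= f t)%E) ->
    (\int[lebesgue_measure]_t f (tau i t) = \int[lebesgue_measure]_t f t)%E) ->
  forall F : 'rV[R]_n -> \bar R,
  measurable_fun setT F -> (forall x, (0 <= F x)%E) ->
  (\int[lebesgue_rV n]_x F (\row_i tau i (x ord0 i)) =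
   \int[lebesgue_rV n]_x F x)%E.
Proof.
elim: n tau => [|n IH] tau mtau tauP F mF F0.
  by apply: eq_integral => x _; congr F; apply/rowP => -[].
have mT : measurable_fun setT (fun x : 'rV[R]_n.+1 => \row_i tau i (x ord0 i)).
  apply: measurable_fun_rVP => i.
  rewrite (_ : _ \o _ = tau i \o rV_coord i).
    exact: (measurableT_comp (mtau i) (@measurable_rV_coord R _ i)).
  by apply/funext => x; rewrite /= /rV_coord mxE.
rewrite ge0_integral_rV_step//; last exact: (measurableT_comp mF mT).
rewrite ge0_integral_rV_step//.
rewrite -(tauP ord0 (fun t => \int[lebesgue_rV n]_x F (rV_cons (t, x)))%E); first last.
- by move=> t; exact: integral_ge0.
- apply: (measurable_fun_fubini_tonelli_F (F \o @rV_cons R n)) => //.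
    by apply: measurableT_comp => //; exact: measurable_rV_cons.
  by move=> z; exact: F0.
apply: eq_integral => t _.
rewrite -(IH (fun i => tau (lift ord0 i)) _ _ (fun x => F (rV_cons (tau ord0 t, x))))//.
- apply: eq_integral => x _; congr F; apply/rowP => i; rewrite mxE.
  case: (unliftP ord0 i) => [j ->|->]; last by rewrite !rV_cons0.
  by rewrite !rV_consS/= mxE.
- by move=> i; exact: tauP.
- exact: (measurableT_comp mF (@measurable_rV_consr n _)).
Qed.

Lemma integral_rV_invariant n (T : 'rV[R]_n -> 'rV[R]_n) :
  measurable_fun setT T ->
  (forall F : 'rV[R]_n -> \bar R, measurable_fun setT F -> (forall x, (0 <= F x)%E) ->
  (\int[lebesgue_rV n]_x F (T x) = \int[lebesgue_rV n]_x F x)%E) ->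
  forall F : 'rV[R]_n -> \bar R, measurable_fun setT F ->
  (\int[lebesgue_rV n]_x F (T x) = \int[lebesgue_rV n]_x F x)%E.
Proof.
move=> mT TP F mF; rewrite [LHS]integralE [RHS]integralE; congr (_ - _)%E.
- rewrite -(TP F^\+%E (measurable_funepos mF) (fun=> funepos_ge0 _ _)).
  by apply: eq_integral => x _; rewrite !funeposE.
- rewrite -(TP F^\-%E (measurable_funeneg mF) (fun=> funeneg_ge0 _ _)).
  by apply: eq_integral => x _; rewrite !funenegE.
Qed.

Lemma measurable_rV_shift n (v : 'rV[R]_n) :
  measurable_fun setT (fun x : 'rV[R]_n => x + v).
Proof.
apply: measurable_fun_rVP => i.
rewrite (_ : _ \o _ = (fun t => t + v ord0 i) \o rV_coord i).
  apply: measurableT_comp; last exact: measurable_rV_coord.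
  exact: measurable_funD.
by apply/funext => x; rewrite /= /rV_coord mxE.
Qed.

Lemma measurable_rV_opp n : measurable_fun setT (fun x : 'rV[R]_n => - x).
Proof.
apply: measurable_fun_rVP => i.
rewrite (_ : _ \o _ = (fun t => - t) \o rV_coord i).
  apply: measurableT_comp; last exact: measurable_rV_coord.
  exact: measurable_funN.
by apply/funext => x; rewrite /= /rV_coord mxE.
Qed.

Lemma integral_rV_shift n (v : 'rV[R]_n) (F : 'rV[R]_n -> \bar R) :
  measurable_fun setT F ->
  (\int[lebesgue_rV n]_x F (x + v)%R = \int[lebesgue_rV n]_x F x)%E.
Proof.
apply: integral_rV_invariant; first exact: measurable_rV_shift.
move=> {}F mF F0.
rewrite -[RHS](ge0_integral_rV_invariant (tau := fun i t => t + v ord0 i)) //.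
- by apply: eq_integral => x _; congr F; apply/rowP => i; rewrite !mxE.
- by move=> i; exact: measurable_funD.
- by move=> i f mf f0; exact: ge0_integral_line_shift.
Qed.

Lemma integral_rV_opp n (F : 'rV[R]_n -> \bar R) :
  measurable_fun setT F ->
  (\int[lebesgue_rV n]_x F (- x)%R = \int[lebesgue_rV n]_x F x)%E.
Proof.
apply: integral_rV_invariant; first exact: measurable_rV_opp.
move=> {}F mF F0.
rewrite -[RHS](ge0_integral_rV_invariant (tau := fun i t => - t)) //.
- by apply: eq_integral => x _; congr F; apply/rowP => i; rewrite !mxE.
- by move=> i; exact: measurable_funN.
- by move=> i f mf f0; exact: ge0_integral_line_opp.
Qed.

End lebesgue_rV_integral.

(** * Borel sets and compact supports in R^n *)

Section borel_rV.
Context {R : realType}.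

Lemma normr_rV_leP n (x : 'rV[R]_n) (M : R) : 0 <= M ->
  reflect (forall i, `|x ord0 i| <= M) (`|x| <= M).
Proof.
move=> M0; rewrite /Num.norm/= mx_normrE; apply: (iffP idP).
- move/bigmax_leP => [_ xM] i.
  exact: (xM (ord0, i)).
- by move=> xM; apply/bigmax_leP; split => // -[i j] _ /=; rewrite ord1; exact: xM.
Qed.

Lemma normr_coord_le n (x : 'rV[R]_n) i : `|x ord0 i| <= `|x|.
Proof. exact: (normr_rV_leP x (normr_ge0 x) (lexx _)). Qed.

Lemma ball_rV_coord n (x y : 'rV[R]_n) e : 0 < e ->
  ball x e y <-> forall i, `|x ord0 i - y ord0 i| < e.
Proof.
move=> e0; split => [[_ xy] i|xy]; first exact: xy.
by split => // i j; rewrite ord1; exact: xy.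
Qed.

(** The sigma-algebra is generated by the coordinates, whereas the topology comes from the maximum
    norm. An open set is the union of the cubes with rational centre and radius 1/(k+1) that it
    contains, and there are countably many of them. *)
Lemma open_measurable_rV n (U : set 'rV[R]_n) : open U -> measurable U.
Proof.
move=> oU.
pose box (p : 'rV[rat]_n * nat) : set 'rV[R]_n :=
  [set x | forall i, `|ratr (p.1 ord0 i) - x ord0 i| < p.2.+1%:R^-1].
have mbox p : measurable (box p).
  rewrite (_ : box p = \bigcap_(i in [set: 'I_n])
      (rV_coord i @^-1` [set t : R | `|ratr (p.1 ord0 i) - t| < p.2.+1%:R^-1])).
    apply: fin_bigcap_measurable => // i _.
    rewrite -[X in measurable X]setTI; apply: measurable_rV_coord => //.
    apply: open_measurable.
    rewrite (_ : [set t | _] = ball (ratr (p.1 ord0 i) : R) p.2.+1%:R^-1)//.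
    exact: ball_open.
  by apply/seteqP; split => [x Bx i _|x Bx i]; exact: Bx.
rewrite (_ : U = \bigcup_p (if `[< box p `<=` U >] then box p else set0)).
  apply: countable_bigcupT_measurable => [|p]; first exact: countableP.
  by case: ifP => // _; exact: measurable0.
apply/seteqP; split => [x Ux|x [p _]]; last by case: asboolP => // + xp; exact.
have /nbhs_ballP[e/= e0 xeU] := open_nbhs_nbhs (conj oU Ux).
(* The centre of the cube will lie within 1/(k+1) of [x], so a point of the cube is within 2/(k+1)
   of [x]; this must be less than [e]. *)
have [k] : exists k : nat, (2 / e < k.+1%:R).
  have /archi_boundP := divr_ge0 (ler0n R 2) (ltW e0).
  set m := Num.bound _ => h; exists m.
  by rewrite (lt_le_trans h)// ler_nat.
rewrite ltr_pdivrMr// mulrC -ltr_pdivrMr// => ke.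
have k0 : 0 < k.+1%:R^-1 :> R by rewrite invr_gt0.
have /choice[q xq] : forall i, exists q : rat,
    ratr q \in `](x ord0 i - k.+1%:R^-1), (x ord0 i + k.+1%:R^-1)[.
  move=> i; have [] := @rat_in_itvoo R (x ord0 i - k.+1%:R^-1) (x ord0 i + k.+1%:R^-1).
    by rewrite ltrBlDr -addrA ltrDl addr_gt0.
  by move=> q qx; exists q.
exists (\row_i q i, k) => //; case: asboolP => [_|[]] /=.
  by move=> i; rewrite mxE ltr_distl; have := xq i; rewrite in_itv.
move=> y By; apply: xeU; apply/ball_rV_coord => // i.
have := By i; have := xq i; rewrite /= mxE in_itv/= !ltr_distl.
have : k.+1%:R^-1 + k.+1%:R^-1 < e by move: ke; set r := k.+1%:R^-1; lra.
move:  (k.+1%:R^-1 : R) (ratr (q i) : R) => r s +  /andP[? ?] /andP[? ?]; move=> ?; apply/andP; split; lra.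
Qed.

Lemma continuous_measurable_rV n (f : 'rV[R]_n -> R) :
  continuous f -> measurable_fun [set: 'rV[R]_n] f.
Proof.
move=> /continuousP cf; apply: (measurability _ (RGenOpens.measurableE R)).
move=> _ [_ [a [b ->] <-]]; rewrite setTI; apply: open_measurable_rV.
exact/cf/interval_open.
Qed.

(** Stated with the maximum norm, whose balls are boxes of explicit measure; [bounded_supportP]
    identifies it with compact support. *)
Definition bounded_support n (phi : 'rV[R]_n -> R) :=
  exists M : R, forall x, M < `|x| -> phi x = 0.

Lemma closed_ball_rV_compact n (M : R) : compact [set x : 'rV[R]_n | `|x| <= M].
Proof.
apply: bounded_closed_compact.
  exists M; split; [exact: num_real|move=> N MN x xM; exact: le_trans xM (ltW MN)].
rewrite (_ : [set x | _] = Num.norm @^-1` [set t : R | t <= M]) //.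
by apply: closed_comp => [x _|]; [exact: norm_continuous|exact: closed_le].
Qed.

Lemma bounded_supportP n (phi : 'rV[R]_n -> R) :
  compact (closure [set x | phi x != 0]) <-> bounded_support phi.
Proof.
split=> [/compact_bounded[M [_ HM]]|[M HM]].
  exists (M + 1) => x Mx; apply/eqP; apply: contraTT (Mx) => phix.
  by rewrite -leNgt (HM (M + 1)) ?ltrDl//; exact: subset_closure.
apply: (subclosed_compact _ (@closed_ball_rV_compact n M)).
  exact: closed_closure.
rewrite [X in _ `<=` X](closure_id _).1; last first.
  by apply: compact_closed; [exact: norm_hausdorff|exact: closed_ball_rV_compact].
apply: closureS.
move=> x /= phix; rewrite leNgt; apply/negP => /HM phi0.
by rewrite phi0 eqxx in phix.
Qed.

Lemma continuous_bounded n (phi : 'rV[R]_n -> R) : continuous phi ->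
  bounded_support phi -> exists2 B : R, 0 < B & forall x, `|phi x| <= B.
Proof.
move=> cphi [M HM].
have : compact (phi @` [set x | `|x| <= M]).
  apply: continuous_compact; last exact: closed_ball_rV_compact.
  exact: continuous_subspaceT.
move=> /compact_bounded[B [_ HB]].
exists (Num.max B 0 + 1); first by rewrite ltr_wpDl// le_max lexx orbT.
move=> x; have [xM|/HM->] := leP `|x| M; last first.
  by rewrite normr0 addr_ge0// le_max lexx orbT.
by apply: (HB (Num.max B 0 + 1)); [rewrite ltr_pwDr// le_max lexx|exists x].
Qed.

Local Notation mu := (lebesgue_rV (R := R)).

Lemma measurable_closed_ball_rV n (M : R) : measurable [set x : 'rV[R]_n | `|x| <= M].
Proof.
rewrite -[X in measurable X]setTI.
rewrite (_ : [set x | _] = Num.norm @^-1` `]-oo, M]%classic).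
  by apply: continuous_measurable_rV; [exact: norm_continuous| |].
by apply/seteqP; split => x; rewrite /= in_itv.
Qed.

Lemma closed_ball_rV_fin n (M : R) : (mu n [set x : 'rV[R]_n | (`|x| <= M)%R] < +oo)%E.
Proof.
have [M0|M0] := ltP M 0.
  rewrite (_ : [set x | _] = set0) ?measure0//.
  by apply/seteqP; split => x //=; rewrite leNgt (lt_le_trans M0).
have -> : [set x : 'rV[R]_n | `|x| <= M] =
    [set x : 'rV[R]_n | forall i, (`[- M, M]%classic : set R) (x ord0 i)].
  apply/seteqP; split => x /=.
    by move/(normr_rV_leP _ M0) => xM i; rewrite in_itv/= -ler_norml.
  by move=> xM; apply/(normr_rV_leP _ M0) => i; have := xM i; rewrite in_itv/= -ler_norml.
rewrite (@lebesgue_rV_box R n (fun=> `[- M, M]%classic)); last by move=> i; exact: measurable_itv.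
rewrite (eq_bigr (fun=> (M - - M)%:E)); last first.
  move=> i _; rewrite lebesgue_measure_itv/= lte_fin -EFinB.
  case: ifP => // /negbT; rewrite -leNgt => ?.
  have -> : M = 0 by lra.
  by rewrite oppr0 subrr.
suff : (\prod_(i < n) (M - - M)%:E)%E \is a fin_num by move=> /fin_numPlt/andP[].
by elim/big_ind : _ => // x y; exact: fin_numM.
Qed.

Lemma integrable_bounded_support n (phi : 'rV[R]_n -> R) (B M : R) :
  measurable_fun setT phi -> (forall x, `|phi x| <= B) ->
  (forall x, M < `|x| -> phi x = 0) ->
  (mu n).-integrable setT (EFin \o phi).
Proof.
move=> mphi HB HM.
have mK := measurable_closed_ball_rV (n := n) M.
pose K := [set x : 'rV[R]_n | `|x| <= M].
apply: (le_integrable measurableT (g := fun x : 'rV[R]_n => (B * \1_K x)%:E)) => //.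
- exact/measurable_EFinP.
- move=> x _ /=; rewrite lee_fin indicE.
  have [/HM->|xM] := ltP M `|x|; first by rewrite normr0.
  by rewrite mem_set//= mulr1 (le_trans (HB x))// ler_norm.
- under eq_fun do rewrite EFinM.
  apply: integrableZl => //; apply/integrableP; split.
    by apply/measurable_EFinP; exact: measurable_indic.
  under eq_integral do rewrite gee0_abs ?lee_fin//.
  by rewrite integral_indic// setIT closed_ball_rV_fin.
Qed.

End borel_rV.

(** * Directional derivatives and smooth functions *)

Section directional_derivative.
Context {R : realType} {V : normedModType R}.
Implicit Types (f g : V -> R) (x u v : V).

Lemma is_deriveP f x v (l : R) :
  is_derive x v f l <-> h^-1 * (f (h *: v + x) - f x) @[h --> 0^'] --> l.
Proof.
split=> [[dfx <-]|fl]; first exact: dfx.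
apply: DeriveDef; first by apply/cvg_ex; exists l.
exact: cvg_lim fl.
Qed.

(** Restricting to a line turns a directional derivative into an ordinary one, so that the chain
    rule and the mean value theorem of one variable apply. *)
Lemma is_derive_lineP f x v (s l : R) :
  is_derive (s *: v + x) v f l <-> is_derive s (1 : R) (fun t => f (t *: v + x)) l.
Proof.
rewrite is_deriveP; split=> [fl|[dfx <-]].
  suff H : (fun h : R => h^-1 *: (((fun t => f (t *: v + x)) \o shift s) (h *: 1) -
      f (s *: v + x))) @ 0^' --> l.
    by apply: DeriveDef; [apply/cvg_ex; exists l|exact: cvg_lim H].
  apply: cvg_trans fl; apply: near_eq_cvg; near=> h.
  by rewrite /= [h *: 1]mulr1 scalerDl addrA.
apply: cvg_trans dfx; apply: near_eq_cvg; near=> h.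
by rewrite /= [h *: 1]mulr1 scalerDl addrA.
Unshelve. all: by end_near. Qed.

Lemma is_derive_line0P f x v (l : R) :
  is_derive x v f l <-> is_derive (0 : R) (1 : R) (fun t => f (t *: v + x)) l.
Proof. by rewrite -is_derive_lineP scale0r add0r. Qed.

Lemma is_derive_comp f (h : R -> R) x v (l m : R) :
  is_derive (f x) (1 : R) h m -> is_derive x v f l -> is_derive x v (h \o f) (m * l).
Proof.
move=> hm /is_derive_line0P fl; apply/is_derive_line0P.
apply: (@is_derive1_comp _ h (fun t => f (t *: v + x))).
by rewrite scale0r add0r.
Qed.

Lemma is_derive_scale_dir f x v (c l : R) :
  is_derive x v f l -> is_derive x (c *: v) f (l * c).
Proof.
move=> /is_derive_line0P fl; apply/is_derive_line0P.
rewrite (_ : (fun t => _) = (fun t => f (t *: v + x)) \o ( *%R c)); last first.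
  by apply/funext => t /=; rewrite scalerA mulrC.
apply: is_derive1_comp; first by rewrite mulr0.
rewrite (_ : *%R c = c \*: (id : R -> R)); last by apply/funext => t.
by apply: is_derive_eq; rewrite [c *: 1]mulr1.
Qed.

Lemma derive_MVT f x v : (forall y, derivable f y v) ->
  exists2 c : R, 0 <= c <= 1 & f (v + x) - f x = 'D_v f (c *: v + x).
Proof.
move=> df.
have dg (s : R) : is_derive s (1 : R) (fun t => f (t *: v + x)) ('D_v f (s *: v + x)).
  by apply/is_derive_lineP/derivableP.
have [|c c01] := @MVT_segment R (fun t => f (t *: v + x)) _ 0 1 ler01 (fun s _ => dg s).
  apply: continuous_subspaceT => s.
  by apply/differentiable_continuous/derivable1_diffP; case: (dg s).
rewrite scale1r scale0r add0r subr0 mulr1 => ->.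
by exists c.
Qed.

(** Additivity in the direction without differentiability of [f]. The increment along [u + v] is a
    step along [u] from [x] followed by a step along [v]; by the mean value theorem the second step
    is [h] times the derivative along [v] at a point that tends to [x], where this derivative is
    continuous. *)
Lemma is_derive_dirD f x u v (l : R) : is_derive x u f l ->
  (forall y, derivable f y v) -> {for x, continuous ('D_v f)} ->
  is_derive x (u + v) f (l + 'D_v f x).
Proof.
move=> /is_deriveP fl df cf; apply/is_deriveP.
have /choice[c cP] : forall h : R, exists c : R, 0 <= c <= 1 /\
    f (h *: v + (h *: u + x)) - f (h *: u + x) =
    h * 'D_v f (c *: (h *: v) + (h *: u + x)).
  move=> h; have dfh y : is_derive y (h *: v) f ('D_v f y * h).
    by apply/is_derive_scale_dir/derivableP.
  have [|c c01 E] := @derive_MVT f (h *: u + x) (h *: v).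
    by move=> y; case: (dfh y).
  by exists c; split => //; rewrite E derive_val mulrC.
(* The mean value point of the second step; it is within [|h| * (|v| + |u|)] of [x] because [c h]
   lies in [0, 1]. *)
pose y h : V := c h *: (h *: v) + (h *: u + x).
have yx : y h @[h --> 0^'] --> x.
  apply/cvgrPdist_le => e e0.
  have d0 : 0 < e / (`|v| + `|u| + 1) by rewrite divr_gt0// ltr_wpDl// addr_ge0.
  near=> h; rewrite /y addrA opprD addrCA subrr addr0 normrN (le_trans (ler_normD _ _))// !normrZ.
  have hd : `|h| <= e / (`|v| + `|u| + 1).
    by near: h; exact: dnbhs0_le.
  have [/andP[c0 c1] _] := cP h.
  rewrite (ger0_norm c0) (@le_trans _ _ (`|h| * (`|v| + `|u| + 1)))//.
    rewrite mulrDr mulr1 mulrDr -addrA lerD//.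
      by rewrite -[leRHS]mul1r ler_wpM2r// mulr_ge0.
    by rewrite lerDl.
  by rewrite -ler_pdivlMr// ltr_wpDl// addr_ge0.
have : h^-1 * (f (h *: u + x) - f x) + 'D_v f (y h) @[h --> 0^'] --> l + 'D_v f x.
  by apply: cvgD => //; exact: (cvg_comp _ _ yx cf).
apply: cvg_trans; apply: near_eq_cvg; near=> h.
have h0 : h != 0 by near: h; exact: nbhs_dnbhs_neq.
have [_ E] := cP h.
have -> : f (h *: (u + v) + x) - f x =
    f (h *: u + x) - f x + h * 'D_v f (y h).
  rewrite -E; have -> : h *: (u + v) + x = h *: v + (h *: u + x).
    by rewrite scalerDr addrCA addrA.
  by ring.
by field.
Unshelve. all: by end_near. Qed.

End directional_derivative.

(** * Smooth functions: closure properties and arbitrary directions *)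

Section smooth_functions.
Context {R : realType} {n : nat}.
Local Notation V := 'rV[R]_n.
Implicit Types (phi psi : V -> R) (x v : V).
Local Notation ev := (@basis_vec R n).

Lemma smooth_continuous phi : smooth phi -> continuous phi.
Proof. by move=> /(_ [::])[]. Qed.

Lemma smooth_derivable phi i x : smooth phi -> derivable phi x (ev i).
Proof. by move=> /(_ [::])[]. Qed.

Lemma smooth_partial phi i : smooth phi -> smooth ('D_(ev i) phi).
Proof.
move=> sphi s; have := sphi (rcons s i).
by rewrite /iter_partial foldr_rcons.
Qed.

(* Closure under partial derivatives is a coinductive characterization: it
   spares any induction on the list of iterated derivatives. *)
Lemma smooth_coind (P : (V -> R) -> Prop) :
  (forall g, P g -> continuous g /\
     forall i, (forall x, derivable g x (ev i)) /\ P ('D_(ev i) g)) ->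
  forall g, P g -> smooth g.
Proof.
move=> HP g Pg s; suff {s} Ps s : P (iter_partial s g).
  by have [? H] := HP _ (Ps s); split => // i x; have [] := H i.
by elim: s => [//|i s IH] /=; have [_ /(_ i)[]] := HP _ IH.
Qed.

Lemma smooth_cst (c : R) : smooth (cst c : V -> R).
Proof.
apply: (smooth_coind (P := fun g => exists c, g = cst c)); last by exists c.
move=> _ [{}c ->]; split; first by move=> x; exact: cst_continuous.
move=> i; split=> [x|]; first exact: derivable_cst.
by exists 0; apply/funext => x; rewrite derive_cst.
Qed.

Lemma smooth_linear (a b : R) phi psi : smooth phi -> smooth psi ->
  smooth (fun x => a * phi x + b * psi x).
Proof.
move=> sphi spsi; apply: (smooth_coind (P := fun g => exists f1 f2,
  [/\ smooth f1, smooth f2 & g = fun x => a * f1 x + b * f2 x])); last first.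
  by exists phi, psi.
move=> _ [f1 [f2 [s1 s2 ->]]].
rewrite (_ : (fun x => a * f1 x + b * f2 x) = a \*: f1 + b \*: f2) //.
split.
  move=> x; apply: continuousD; apply: continuousM.
  - exact: cst_continuous.
  - exact: smooth_continuous.
  - exact: cst_continuous.
  - exact: smooth_continuous.
move=> i.
have d1 x : is_derive x (ev i) f1 ('D_(ev i) f1 x).
  by apply/derivableP/smooth_derivable.
have d2 x : is_derive x (ev i) f2 ('D_(ev i) f2 x).
  by apply/derivableP/smooth_derivable.
split=> [//|].
exists ('D_(ev i) f1), ('D_(ev i) f2); split; [exact: smooth_partial..|].
by apply/funext => x; rewrite derive_val.
Qed.

Lemma smoothZ (a : R) phi : smooth phi -> smooth (fun x => a * phi x).
Proof.
move=> sphi; rewrite (_ : (fun _ => _) = fun x => a * phi x + 0 * phi x).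
  exact: smooth_linear.
by apply/funext => x; rewrite mul0r addr0.
Qed.

Lemma smoothD phi psi : smooth phi -> smooth psi -> smooth (fun x => phi x + psi x).
Proof.
move=> sphi spsi; rewrite (_ : (fun _ => _) = fun x => 1 * phi x + 1 * psi x).
  exact: smooth_linear.
by apply/funext => x; rewrite !mul1r.
Qed.

Lemma smooth_sum (I : Type) (r : seq I) (F : I -> V -> R) :
  (forall i, smooth (F i)) -> smooth (fun x => \sum_(i <- r) F i x).
Proof.
move=> sF; elim: r => [|i r IH].
  by under eq_fun do rewrite big_nil; exact: smooth_cst.
by under eq_fun do rewrite big_cons; exact: smoothD.
Qed.

(** The Leibniz rule sends a product to a sum of two products, so products alone are not stable
    under partial derivatives. Finite sums of products are, which makes this the predicate to feed
    to [smooth_coind]. *)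
Inductive product_span : (V -> R) -> Prop :=
| product_span_mul phi psi : smooth phi -> smooth psi -> product_span (phi * psi)
| product_span_add phi psi :
    product_span phi -> product_span psi -> product_span (phi + psi).

Lemma product_span_derivable phi i x : product_span phi -> derivable phi x (ev i).
Proof.
elim=> [f g sf sg|f g _ df _ dg]; last exact: derivableD.
by apply: derivableM; exact: smooth_derivable.
Qed.

Lemma smoothM phi psi : smooth phi -> smooth psi -> smooth (fun x => phi x * psi x).
Proof.
move=> sphi spsi; apply: (smooth_coind (P := product_span)); last first.
  exact: product_span_mul.
move=> g Pg; split.
  elim: Pg => [f1 f2 s1 s2|f1 f2 _ c1 _ c2] x.
    by apply: continuousM; exact: smooth_continuous.
  by apply: continuousD; [exact: c1|exact: c2].
move=> i; split => [x|]; first exact: product_span_derivable.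
elim: Pg => [f1 f2 s1 s2|f1 f2 P1 c1 P2 c2].
  rewrite (_ : 'D_ _ _ = f1 * 'D_(ev i) f2 + f2 * 'D_(ev i) f1).
    by apply: product_span_add; apply: product_span_mul => //; exact: smooth_partial.
  by apply/funext => x; rewrite deriveM//; exact: smooth_derivable.
rewrite (_ : 'D_ _ _ = 'D_(ev i) f1 + 'D_(ev i) f2); first exact: product_span_add.
by apply/funext => x; rewrite deriveD//; exact: product_span_derivable.
Qed.

Lemma smooth_prod (I : Type) (r : seq I) (F : I -> V -> R) :
  (forall i, smooth (F i)) -> smooth (fun x => \prod_(i <- r) F i x).
Proof.
move=> sF; elim: r => [|i r IH].
  by under eq_fun do rewrite big_nil; exact: smooth_cst.
by under eq_fun do rewrite big_cons; exact: smoothM.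
Qed.

Lemma derive_shift_fun phi v w x : 'D_w (fun y => phi (y + v)) x = 'D_w phi (x + v).
Proof.
rewrite /derive; set F := fun h => h^-1 *: _; set G := fun h => h^-1 *: _.
suff -> : F = G by [].
by apply/funext => h; rewrite /F /G /= addrA.
Qed.

Lemma derivable_shift_fun phi v w x :
  derivable phi (x + v) w -> derivable (fun y => phi (y + v)) x w.
Proof.
move=> /cvg_ex[l /= H]; apply/cvg_ex; exists l; apply: cvg_trans H.
by apply: near_eq_cvg; near=> h => /=; rewrite addrA.
Unshelve. all: by end_near. Qed.

Lemma smooth_shift phi v : smooth phi -> smooth (fun x => phi (x + v)).
Proof.
move=> sphi; apply: (smooth_coind (P := fun g => exists2 f,
  smooth f & g = fun x => f (x + v))); last by exists phi.
move=> _ [f sf ->]; split.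
  move=> x; apply: (@continuous_comp _ _ _ (fun x => x + v) f).
    by apply: continuousD; [exact: cvg_id|exact: cst_continuous].
  exact: smooth_continuous.
move=> i; split => [x|].
  by apply: derivable_shift_fun; exact: smooth_derivable.
exists ('D_(ev i) f); first exact: smooth_partial.
by apply/funext => x; rewrite derive_shift_fun.
Qed.

Lemma row_basis_sum v : v = \sum_(i < n) v ord0 i *: ev i.
Proof. exact: row_sum_delta. Qed.

(** The direction is rebuilt one coordinate at a time with [is_derive_dirD]. This ties the
    derivative along an arbitrary unit vector in [Vvar0] to the partial derivatives in [smooth] and
    [divergence]. *)
Lemma smooth_is_derive phi x v : smooth phi ->
  is_derive x v phi (\sum_(i < n) v ord0 i * 'D_(ev i) phi x).
Proof.
move=> sphi; rewrite {1}(row_basis_sum v).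
elim: (index_enum _) => [|i r IH].
  by rewrite !big_nil; exact: is_derive0.
have d y : is_derive y (v ord0 i *: ev i) phi ('D_(ev i) phi y * v ord0 i).
  by apply/is_derive_scale_dir/derivableP/smooth_derivable.
have cd : continuous ('D_(v ord0 i *: ev i) phi).
  rewrite (_ : 'D_ _ _ = fun y => 'D_(ev i) phi y * v ord0 i); last first.
    by apply/funext => y; rewrite derive_val.
  move=> y; apply: (@continuousM _ _ ('D_(ev i) phi) (cst (v ord0 i))).
    by apply: smooth_continuous; exact: smooth_partial.
  exact: cst_continuous.
have := @is_derive_dirD _ _ phi x _ (v ord0 i *: ev i) _ IH
  (fun y => @ex_derive _ _ _ _ _ _ _ (d y)) (cd x).
rewrite !big_cons addrC => H; apply: is_derive_eq H _.
by rewrite derive_val addrC mulrC.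
Qed.

Lemma smooth_derivable_dir phi x v : smooth phi -> derivable phi x v.
Proof. by move=> sphi; case: (smooth_is_derive x v sphi). Qed.

Lemma smooth_deriveE phi v : smooth phi ->
  'D_v phi = fun x => \sum_(i < n) v ord0 i * 'D_(ev i) phi x.
Proof.
by move=> sphi; apply/funext => x; have := smooth_is_derive x v sphi; case.
Qed.

Lemma smooth_dir phi v : smooth phi -> smooth ('D_v phi).
Proof.
move=> sphi; rewrite smooth_deriveE//; apply: smooth_sum => i.
exact/smoothZ/smooth_partial.
Qed.

Lemma smooth_measurable phi : smooth phi -> measurable_fun setT phi.
Proof. by move=> /smooth_continuous; exact: continuous_measurable_rV. Qed.

Lemma bounded_support_derive phi v (M : R) : (forall x, M < `|x| -> phi x = 0) ->
  forall x, M < `|x| -> 'D_v phi x = 0.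
Proof.
move=> HM x Mx; rewrite -(derive_cst (0 : R) x v).
apply: near_eq_derive; near=> y; apply: HM; near: y.
apply: (cvgr_gt `|x|) => //; exact: (@norm_continuous R V x).
Unshelve. all: by end_near. Qed.

Lemma test_functionP phi :
  test_function phi <-> smooth phi /\ bounded_support phi.
Proof. by rewrite /test_function; split => -[? /bounded_supportP]. Qed.

Lemma test_fieldP (Phi : V -> V) : test_field Phi <->
  (forall i, smooth (fun x => Phi x ord0 i)) /\
  exists M : R, forall x, M < `|x| -> Phi x = 0.
Proof.
rewrite /test_field; split => -[sP HP]; split => //.
  (* [bounded_supportP] concerns scalar functions; the indicator of [Phi x != 0] is a scalar
     function with the same support as [Phi]. *)
  have [M HM] : bounded_support (fun x => (Phi x != 0)%:R : R).
    apply/bounded_supportP; rewrite (_ : [set x | _] = [set x | Phi x != 0])//.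
    by apply/seteqP; split => x /=; case: (Phi x == 0); rewrite ?eqxx ?oner_eq0.
  exists M => x /HM; case: eqP => //= _ /eqP; by rewrite oner_eq0.
have [M HM] := HP.
rewrite (_ : [set x | _] = [set x | ((Phi x != 0)%:R : R) != 0]).
  apply/bounded_supportP; exists M => x /HM ->; by rewrite eqxx.
by apply/seteqP; split => x /=; case: (Phi x == 0); rewrite ?eqxx ?oner_eq0.
Qed.

End smooth_functions.

(** * Gaussian integrals *)

Section gaussian.
Context {R : realType}.

Definition gauss n (z : 'rV[R]_n) : R := expR (- (enorm z ^+ 2 / 2)).

Lemma enorm_sqr n (z : 'rV[R]_n) : enorm z ^+ 2 = \sum_(i < n) z ord0 i ^+ 2.
Proof. by rewrite sqr_sqrtr// sumr_ge0// => i _; exact: sqr_ge0. Qed.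

Lemma enorm_ge0 n (z : 'rV[R]_n) : 0 <= enorm z.
Proof. exact: sqrtr_ge0. Qed.

Lemma continuous_enorm_sqr n : continuous (fun z : 'rV[R]_n => enorm z ^+ 2).
Proof.
rewrite (_ : (fun z => _) = fun z : 'rV[R]_n => \sum_(i < n) z ord0 i ^+ 2); last first.
  by apply/funext => z; rewrite enorm_sqr.
elim: (index_enum _) => [|i r IH].
  rewrite (_ : (fun z => _) = cst 0); first exact: cst_continuous.
  by apply/funext => z; rewrite big_nil.
rewrite (_ : (fun z => _) = (fun z : 'rV[R]_n => z ord0 i ^+ 2) +
    (fun z : 'rV[R]_n => \sum_(i <- r) z ord0 i ^+ 2)).
  move=> z; apply: continuousD; last exact: IH.
  by apply: continuousM; exact: coord_continuous.
by apply/funext => z; rewrite big_cons.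
Qed.

Lemma continuous_gauss n : continuous (@gauss n).
Proof.
move=> z; apply: (@continuous_comp _ _ _ (fun z : 'rV[R]_n => - (enorm z ^+ 2 / 2)) expR).
  apply: continuousN; apply: (@continuousM _ _ (fun z => enorm z ^+ 2) (cst 2^-1)).
    exact: continuous_enorm_sqr.
  exact: cst_continuous.
exact: continuous_expR.
Qed.

Lemma measurable_gauss n : measurable_fun setT (@gauss n).
Proof. exact: (continuous_measurable_rV (@continuous_gauss n)). Qed.

Lemma measurable_enorm_sqr n : measurable_fun setT (fun z : 'rV[R]_n => enorm z ^+ 2).
Proof. exact: (continuous_measurable_rV (@continuous_enorm_sqr n)). Qed.

Lemma measurable_enorm n : measurable_fun setT (@enorm R n).
Proof.
rewrite (_ : @enorm R n = (fun t => t `^ (2^-1)) \o (fun z => enorm z ^+ 2)).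
  apply: measurableT_comp; first exact: measurable_powR.
  exact: measurable_enorm_sqr.
by apply/funext => z /=; rewrite powR12_sqrt ?sqr_ge0// sqrtr_sqr ger0_norm// enorm_ge0.
Qed.

Lemma gauss_gt0 n (z : 'rV[R]_n) : 0 < gauss z. Proof. exact: expR_gt0. Qed.

Lemma gauss_ge0 n (z : 'rV[R]_n) : 0 <= gauss z. Proof. exact: expR_ge0. Qed.

Lemma gaussN n (z : 'rV[R]_n) : gauss (- z) = gauss z.
Proof.
rewrite /gauss !enorm_sqr (eq_bigr (fun i => z ord0 i ^+ 2))// => i _.
by rewrite mxE sqrrN.
Qed.

Lemma is_derive_gauss n (z v : 'rV[R]_n) :
  is_derive z v (@gauss n) (- (\sum_(i < n) z ord0 i * v ord0 i) * gauss z).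
Proof.
suff H : is_derive z v (fun z : 'rV[R]_n => - (enorm z ^+ 2 / 2))
    (- (\sum_(i < n) z ord0 i * v ord0 i)).
  have e : is_derive (- (enorm z ^+ 2 / 2)) (1 : R) expR (gauss z).
    exact: is_derive_expR.
  have G := @is_derive_comp _ _ (fun z : 'rV[R]_n => - (enorm z ^+ 2 / 2)) _ z v _ _ e H.
  by rewrite mulrC; exact: G.
have dc (i : 'I_n) : is_derive z v (fun z : 'rV[R]_n => z ord0 i) (v ord0 i).
  apply/is_derive_line0P.
  rewrite (_ : (fun _ => _) = (v ord0 i \*: (id : R -> R) + cst (z ord0 i))); last first.
    by apply/funext => t; rewrite /= !mxE mulrC.
  by apply: is_derive_eq; rewrite addr0 [_ *: 1]mulr1.
rewrite (_ : (fun _ => _) =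
    - (2^-1 \*: \sum_(i < n) (fun z : 'rV[R]_n => z ord0 i) * (fun z : 'rV[R]_n => z ord0 i))); last first.
  apply/funext => y; rewrite enorm_sqr /= mulrC; apply: congr1; apply: congr1.
  by rewrite fct_sumE; apply: eq_bigr => i _; rewrite expr2.
apply: is_derive_eq; rewrite /= scaler_sumr; congr (- _); apply: eq_bigr => i _.
have half (x y : R) : 2^-1 * (x * y + x * y) = x * y by field.
exact: half.
Qed.

Lemma enorm_sqr_cons n (t : R) (x : 'rV[R]_n) :
  enorm (rV_cons (t, x)) ^+ 2 = t ^+ 2 + enorm x ^+ 2.
Proof.
rewrite !enorm_sqr big_ord_recl rV_cons0; congr (_ + _).
by apply: eq_bigr => i _; rewrite rV_consS.
Qed.

Lemma gauss_cons n (t : R) (x : 'rV[R]_n) :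
  gauss (rV_cons (t, x)) = expR (- (t ^+ 2 / 2)) * gauss x.
Proof. by rewrite /gauss enorm_sqr_cons -expRD; congr expR; ring. Qed.

Local Notation lambda := (@lebesgue_measure R).
Let a : R := Num.sqrt (2 * pi).

Let a_gt0 : 0 < a.
Proof. by rewrite sqrtr_gt0 mulr_gt0// pi_gt0. Qed.

(** The unit mass of the normal density with standard deviation [s]. A general [s] is kept because
    the second moment is obtained below by varying it. *)
Lemma integral_gauss_line (s : R) : 0 < s ->
  (\int[lambda]_t (expR (- (t ^+ 2 / (s ^+ 2 * 2))))%:E = (s * a)%:E)%E.
Proof.
move=> s0; have := integral_normal_pdf (0 : R) s.
have sN0 : s != 0 by rewrite gt_eqF.
under eq_integral do rewrite normal_pdfE// EFinM.
rewrite ge0_integralZl//; first last.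
- by rewrite lee_fin normal_peak_ge0.
- by move=> t _; rewrite lee_fin normal_fun_ge0.
- by apply/measurable_EFinP; exact: measurable_normal_fun.
have -> : normal_peak s = (s * a)^-1.
  rewrite /normal_peak -mulr_natl mulrCA sqrtrM ?sqr_ge0//.
  by rewrite sqrtr_sqr gtr0_norm.
under eq_integral do rewrite /normal_fun subr0 -mulr_natr mulNr.
set I := (\int[_]_t _)%E => E.
have sa : (0 < s * a) by rewrite mulr_gt0.
by rewrite -[LHS]mul1e -(@divff _ (s * a)) ?gt_eqF// EFinM -muleA E mule1.
Qed.

Lemma measurable_gauss_line (s : R) :
  measurable_fun [set: R] (fun t : R => expR (- (t ^+ 2 / s))).
Proof.
apply: measurableT_comp => //; apply: measurable_funN.
by apply: measurable_funM => //; exact: measurable_funX.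
Qed.

(** Differentiation in the standard deviation, done by an inequality. From exp(y) >= 1 + y, the
    Gaussian of deviation s > 1 dominates exp(-t^2/2) (1 + (1 - s^-2) t^2/2). Integrating gives a +
    (1 - s^-2) I / 2 <= s a, that is I <= 2 s^2 a / (s + 1), and s tends to 1. *)
Lemma integral_sqr_gauss_line :
  (\int[lambda]_t (t ^+ 2 * expR (- (t ^+ 2 / 2)))%:E <= a%:E)%E.
Proof.
have m2 : measurable_fun [set: R] (fun t : R => t ^+ 2 * expR (- (t ^+ 2 / 2))).
  by apply: measurable_funM; [exact: measurable_funX|exact: measurable_gauss_line].
have ge t : (0 <= (t ^+ 2 * expR (- (t ^+ 2 / 2)))%:E :> \bar R)%E.
  by rewrite lee_fin mulr_ge0 ?sqr_ge0 ?expR_ge0.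
set I := (\int[_]_t _)%E.
have H (s : R) : 1 < s ->
    (a%:E + ((1 - (s ^+ 2)^-1) / 2)%:E * I <= (s * a)%:E)%E.
  move=> s1; have s0 : 0 < s by rewrite (lt_trans _ s1).
  have c0 : 0 <= (1 - (s ^+ 2)^-1) / 2.
    rewrite divr_ge0// subr_ge0 invf_le1 ?exprn_gt0// exprn_ege1// ltW//.
  have := integral_gauss_line ltr01; rewrite mul1r => <-.
  rewrite -ge0_integralZl//; last exact/measurable_EFinP.
  rewrite -ge0_integralD//; first last.
  - by apply/measurable_EFinP; apply: measurable_funM.
  - by move=> t _; rewrite -EFinM lee_fin mulr_ge0// mulr_ge0 ?sqr_ge0 ?expR_ge0.
  - by apply/measurable_EFinP; exact: measurable_gauss_line.
  rewrite -(integral_gauss_line s0); apply: ge0_le_integral => //.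
  - by move=> t _; rewrite -EFinM -EFinD lee_fin addr_ge0 ?expR_ge0// mulr_ge0// mulr_ge0 ?sqr_ge0 ?expR_ge0.
  - apply/measurable_EFinP/measurable_funD; first exact: measurable_gauss_line.
    exact: measurable_funM.
  - by apply/measurable_EFinP; exact: measurable_gauss_line.
  move=> t _; rewrite -EFinM -EFinD lee_fin expr1n mul1r.
  rewrite [leLHS](_ : _ = expR (- (t ^+ 2 / 2)) * (1 + (t ^+ 2 / 2 - t ^+ 2 / (s ^+ 2 * 2)))).
    rewrite (le_trans (ler_wpM2l (expR_ge0 _) (expR_ge1Dx _)))//.
    by rewrite -expRD ler_expR; lra.
  by field; rewrite gt_eqF.
(* A single value such as s = 2 shows finiteness: an infinite [I] would make the left side of [H 2]
   infinite. *)
have Ioo : I \is a fin_num.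
  rewrite ge0_fin_numE; last by apply: integral_ge0 => t _; exact: ge.
  rewrite ltNge leye_eq; apply/negP => /eqP IE.
  have := H 2 (ltr1n _ 2); rewrite IE gt0_muley; last first.
    by rewrite lte_fin; lra.
  by rewrite addey// leye_eq.
rewrite -(fineK Ioo) lee_fin; apply/ler_addgt0Pr => e e0.
(* With s = 1 + d the bound is at most (1 + 3 d) a, so 3 a d <= e is what is wanted. *)
pose d := Num.min 1 (e / (3 * a)).
have d0 : 0 < d by rewrite lt_min ltr01 divr_gt0// mulr_gt0.
have d1 : d <= 1 by rewrite ge_min lexx.
have de : 3 * a * d <= e.
  by rewrite mulrC -ler_pdivlMr ?mulr_gt0// ge_min lexx orbT.
have := H (1 + d); rewrite -(fineK Ioo) -EFinM -EFinD lee_fin ltrDl => /(_ d0).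
have s0 : 0 < (1 + d) by lra.
set J := fine I => HJ.
have J0 : 0 <= J by rewrite fine_ge0// integral_ge0// => t _; exact: ge.
have s2 : (1 - ((1 + d) ^+ 2)^-1) / 2 * (2 * (1 + d) ^+ 2) = d * (2 + d).
  by field; rewrite gt_eqF.
have : d * ((2 + d) * J) <= d * (2 * (1 + d) ^+ 2 * a).
  rewrite mulrA -s2 -subr_ge0.
  rewrite (_ : _ - _ = (2 * (1 + d) ^+ 2) * ((1 + d) * a - (a + (1 - ((1 + d) ^+ 2)^-1) / 2 * J))).
    by rewrite mulr_ge0 ?subr_ge0// mulr_ge0// sqr_ge0.
  by field; rewrite gt_eqF.
rewrite ler_pM2l// => {}HJ.
have : 2 * J <= 2 * ((1 + 3 * d) * a).
  rewrite -(ler_pM2l (_ : 0 < 2 + d)); last by lra.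
  rewrite [leLHS](_ : _ = 2 * ((2 + d) * J)); last by ring.
  rewrite (le_trans (ler_wpM2l _ HJ))//.
  rewrite -subr_ge0 (_ : _ - _ = a * (2 * d * (3 + d))); last by ring.
  by apply: mulr_ge0; [exact: ltW|nra].
by rewrite ler_pM2l// => /le_trans; apply; lra.
Qed.

Lemma integral_gauss n : (\int[lebesgue_rV n]_z (gauss z)%:E = (a ^+ n)%:E)%E.
Proof.
elim: n => [|n IH].
  rewrite expr0 integral_dirac//; last first.
    by apply/measurable_EFinP; exact: measurable_gauss.
  rewrite diracE mem_set// mul1e /gauss enorm_sqr big_ord0.
  by rewrite mul0r oppr0 expR0.
rewrite ge0_integral_rV_step; first last.
- by move=> z; rewrite lee_fin gauss_ge0.
- by apply/measurable_EFinP; exact: measurable_gauss.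
under eq_integral => t _.
  under eq_integral do rewrite gauss_cons EFinM.
  rewrite ge0_integralZl//; first last.
  - by move=> x _; rewrite lee_fin gauss_ge0.
  - by apply/measurable_EFinP; exact: measurable_gauss.
  rewrite IH; over.
rewrite ge0_integralZr//; first last.
- by rewrite lee_fin exprn_ge0// ltW.
- by apply/measurable_EFinP; exact: measurable_gauss_line.
have := integral_gauss_line ltr01; rewrite mul1r expr1n => E.
rewrite (_ : (\int[_]_t _)%E = a%:E) ?exprS// -E.
by apply: eq_integral => t _; rewrite mul1r.
Qed.

(** Splitting off one coordinate, the squared norm is additive and the Gaussian multiplicative, so
    the step adds a * a^n to a * (n a^n). Only the upper bound is carried along, as the
    one-dimensional second moment is known only from above. *)
Lemma integral_sqr_gauss n :
  (\int[lebesgue_rV n]_z (enorm z ^+ 2 * gauss z)%:E <= (n%:R * a ^+ n)%:E)%E.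
Proof.
have mg m : measurable_fun setT (fun z : 'rV[R]_m => enorm z ^+ 2 * gauss z).
  by apply: measurable_funM; [exact: measurable_enorm_sqr|exact: measurable_gauss].
have g0 m (z : 'rV[R]_m) : (0 <= (enorm z ^+ 2 * gauss z)%:E)%E.
  by rewrite lee_fin mulr_ge0 ?sqr_ge0 ?gauss_ge0.
elim: n => [|n IH].
  rewrite mul0r integral_dirac; [|exact: measurableT|by apply/measurable_EFinP; exact: mg].
  rewrite diracE mem_set// mul1e enorm_sqr big_ord0.
  by rewrite mul0r.
have mgE : measurable_fun setT (fun z : 'rV[R]_n.+1 => (enorm z ^+ 2 * gauss z)%:E).
  by apply/measurable_EFinP; exact: mg.
rewrite (ge0_integral_rV_step mgE (g0 _)).
pose e (t : R) := expR (- (t ^+ 2 / 2)).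
have e0 t : 0 <= e t by exact: expR_ge0.
have me : measurable_fun [set: R] e by exact: measurable_gauss_line.
have me2 : measurable_fun [set: R] (fun t => t ^+ 2 * e t).
  by apply: measurable_funM => //; exact: measurable_funX.
have an0 : 0 <= a ^+ n by rewrite exprn_ge0// ltW.
have Ee : (\int[lambda]_t (e t)%:E = a%:E)%E.
  have := integral_gauss_line ltr01; rewrite mul1r expr1n => <-.
  by apply: eq_integral => t _; rewrite /e mul1r.
apply: (@le_trans _ _ (\int[lambda]_t ((t ^+ 2 * e t)%:E * (a ^+ n)%:E +
    (e t)%:E * (n%:R * a ^+ n)%:E))%E).
  apply: ge0_le_integral => //.
  - by move=> t _; exact: integral_ge0.
  - apply: (measurable_fun_fubini_tonelli_F
      (fun p : measurableTypeR R * 'rV[R]_n => (enorm (rV_cons p) ^+ 2 * gauss (rV_cons p))%:E)) => //.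
    apply/measurable_EFinP.
    by apply: (measurableT_comp (mg n.+1)); exact: measurable_rV_cons.
  - apply: emeasurable_funD; apply: emeasurable_funM => //; exact/measurable_EFinP.
  move=> t _.
  under eq_integral => x _.
    rewrite enorm_sqr_cons gauss_cons -/(e t).
    rewrite (_ : (_ * _)%:E = (t ^+ 2 * e t)%:E * (gauss x)%:E +
      (e t)%:E * (enorm x ^+ 2 * gauss x)%:E)%E; last first.
      by rewrite -!EFinM -EFinD; congr EFin; ring.
    over.
  have t0 : 0 <= t ^+ 2 * e t by rewrite mulr_ge0// sqr_ge0.
  have mgx : measurable_fun setT (fun x : 'rV[R]_n => (gauss x)%:E).
    by apply/measurable_EFinP; exact: measurable_gauss.
  have mgx2 : measurable_fun setT (fun x : 'rV[R]_n => (enorm x ^+ 2 * gauss x)%:E).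
    by apply/measurable_EFinP; exact: mg.
  have gx0 (x : 'rV[R]_n) : (0 <= (gauss x)%:E)%E by rewrite lee_fin gauss_ge0.
  rewrite ge0_integralD//; last 4 first.
  - by move=> x _; apply: mule_ge0; [rewrite lee_fin|exact: gx0].
  - exact: emeasurable_funM.
  - by move=> x _; apply: mule_ge0; [rewrite lee_fin|exact: g0].
  - exact: emeasurable_funM.
  rewrite (ge0_integralZl _ measurableT mgx (fun x _ => gx0 x)); last by rewrite lee_fin.
  rewrite (ge0_integralZl _ measurableT mgx2 (fun x _ => g0 _ x)); last by rewrite lee_fin.
  by rewrite integral_gauss leeD2l// lee_wpmul2l// lee_fin.
have m1 : measurable_fun [set: measurableTypeR R] (fun t : R => (t ^+ 2 * e t)%:E) by exact/measurable_EFinP.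
have m0 : measurable_fun [set: measurableTypeR R] (fun t : R => (e t)%:E) by exact/measurable_EFinP.
rewrite ge0_integralD//; last 4 first.
- by move=> t _; apply: mule_ge0; rewrite lee_fin// mulr_ge0// sqr_ge0.
- exact: emeasurable_funM.
- by move=> t _; apply: mule_ge0; rewrite lee_fin// mulr_ge0.
- exact: emeasurable_funM.
rewrite (ge0_integralZr _ measurableT m1) ?lee_fin//; last first.
  by move=> t _; rewrite lee_fin mulr_ge0// sqr_ge0.
rewrite (ge0_integralZr _ measurableT m0) ?lee_fin ?mulr_ge0//; last first.
  by move=> t _; rewrite lee_fin.
rewrite Ee (@le_trans _ _ (a%:E * (a ^+ n)%:E + a%:E * (n%:R * a ^+ n)%:E)%E)//.
  by rewrite leeD2r// lee_wpmul2r ?lee_fin// integral_sqr_gauss_line.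
by rewrite -!EFinM -EFinD lee_fin exprS -natr1; lra.
Qed.

(** Concavity: the graph lies below its tangent at 1. With x = exp(y), the bounds [E1] and [E2] are
    two instances of exp(u) >= 1 + u; taken with weights [theta] and [1 - theta], their terms linear
    in [y] cancel. *)
Lemma powR_le_affine (x theta : R) : 0 <= x -> 0 < theta <= 1 ->
  x `^ theta <= 1 - theta + theta * x.
Proof.
move=> x0 /andP[t0 t1]; have [->|xN0] := eqVneq x 0.
  by rewrite powR0 ?gt_eqF// mulr0 addr0 subr_ge0.
have /expR_total[y <-] : 0 < x by rewrite lt_neqAle eq_sym xN0.
rewrite -expRM mulrC.
have E1 : expR (theta * y) * (1 + (1 - theta) * y) <= expR y.
  rewrite (le_trans (ler_wpM2l (expR_ge0 _) (expR_ge1Dx _)))// -expRD ler_expR.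
  by lra.
have E2 : expR (theta * y) * (1 - theta * y) <= 1.
  rewrite (le_trans (ler_wpM2l (expR_ge0 _) (expR_ge1Dx _)))// -expRD.
  by rewrite -expR0 ler_expR; lra.
have t1' : 0 <= 1 - theta by rewrite subr_ge0.
have := lerD (ler_wpM2l (ltW t0) E1) (ler_wpM2l t1' E2); lra.
Qed.

Definition gauss_normalizer n : R := (2 * pi) `^ (- (n%:R / 2)).

Lemma gauss_normalizer_gt0 n : 0 < gauss_normalizer n.
Proof. by rewrite powR_gt0// mulr_gt0// pi_gt0. Qed.

Lemma gauss_normalizerE n : gauss_normalizer n * a ^+ n = 1.
Proof.
have p0 : 0 <= 2 * pi :> R by rewrite mulr_ge0// pi_ge0.
rewrite -powR_mulrn ?ltW// /a -powR12_sqrt// -powRrM -powRD; last first.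
  by apply/implyP => _; rewrite gt_eqF// mulr_gt0// pi_gt0.
by rewrite [2^-1 * _]mulrC addNr powRr0.
Qed.

End gaussian.

(** * Moments of the normal law and the constant C(n, alpha) *)

Section gauss_moments.
Context {R : realType}.

(** The absolute moment of order [b] of the standard normal law. *)
Definition gauss_moment n (b : R) : \bar R :=
  ((gauss_normalizer n)%:E *
   \int[lebesgue_rV n]_z (enorm z `^ b * gauss z)%:E)%E.

Lemma gauss_constE n (alpha : R) :
  gauss_const n alpha = (gauss_moment n alpha + gauss_moment n (1 + alpha))%E.
Proof. by []. Qed.

Lemma measurable_enorm_powR n (b : R) :
  measurable_fun setT (fun z : 'rV[R]_n => enorm z `^ b).
Proof. by apply: (measurableT_comp (measurable_powR b)); exact: measurable_enorm. Qed.

Lemma measurable_gauss_moment n (b : R) :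
  measurable_fun setT (fun z : 'rV[R]_n => enorm z `^ b * gauss z).
Proof.
by apply: measurable_funM; [exact: measurable_enorm_powR|exact: measurable_gauss].
Qed.

Lemma gauss_moment_ge0 n (b : R) : (0 <= gauss_moment n b)%E.
Proof.
rewrite /gauss_moment mule_ge0//; first by rewrite lee_fin ltW// gauss_normalizer_gt0.
by apply: integral_ge0 => z _; rewrite lee_fin mulr_ge0 ?powR_ge0 ?gauss_ge0.
Qed.

(** Jensen's inequality for y^theta applied to y = |z|^2, whose mean is at most [n]: the power is
    replaced by its tangent at y = n, and the remaining integrals are the mass and the second
    moment. *)
Lemma gauss_moment_le n (theta : R) : (0 < n)%N -> 0 < theta <= 1 ->
  (gauss_moment n (2 * theta) <= (n%:R `^ theta)%:E)%E.
Proof.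
move=> n0 t01; have /andP[t0 t1] := t01.
have nR : 0 < n%:R :> R by rewrite ltr0n.
have c0 := gauss_normalizer_gt0 (R := R) n.
(* Constant term and slope of the tangent to y^theta at y = n. *)
pose A := n%:R `^ theta * (1 - theta) : R; pose B := n%:R `^ theta * (theta / n%:R) : R.
have A0 : 0 <= A by rewrite mulr_ge0 ?powR_ge0 ?subr_ge0.
have B0 : 0 <= B by rewrite mulr_ge0 ?powR_ge0// divr_ge0// ltW.
have mg2 : measurable_fun setT (fun z : 'rV[R]_n => enorm z ^+ 2 * gauss z).
  by apply: measurable_funM; [exact: measurable_enorm_sqr|exact: measurable_gauss].
have mgE : measurable_fun setT (fun z : 'rV[R]_n => (gauss z)%:E).
  by apply/measurable_EFinP; exact: measurable_gauss.
apply: (@le_trans _ _ ((gauss_normalizer n)%:E *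
   \int[lebesgue_rV n]_z (A%:E * (gauss z)%:E + B%:E * (enorm z ^+ 2 * gauss z)%:E))%E).
  rewrite lee_wpmul2l//; first by rewrite lee_fin ltW.
  apply: ge0_le_integral => //.
  - by move=> z _; rewrite lee_fin mulr_ge0 ?powR_ge0 ?gauss_ge0.
  - by apply/measurable_EFinP; exact: measurable_gauss_moment.
  - by apply: emeasurable_funD; apply: emeasurable_funM => //; exact/measurable_EFinP.
  move=> z _; rewrite -!EFinM -EFinD lee_fin mulrA -mulrDl ler_wpM2r ?gauss_ge0//.
  rewrite powRrM powR_mulrn ?enorm_ge0//.
  pose y := enorm z ^+ 2 / n%:R.
  have y0 : 0 <= y by rewrite divr_ge0 ?sqr_ge0 ?ler0n.
  have -> : enorm z ^+ 2 = n%:R * y by rewrite mulrC divfK ?gt_eqF.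
  rewrite powRM ?ler0n// (le_trans (ler_wpM2l (powR_ge0 _ _) (powR_le_affine y0 t01)))//.
  by rewrite le_eqVlt; apply/orP; left; apply/eqP; rewrite /A /B; field; rewrite gt_eqF.
have mg2E : measurable_fun setT (fun z : 'rV[R]_n => (enorm z ^+ 2 * gauss z)%:E).
  exact/measurable_EFinP.
have g20 (z : 'rV[R]_n) : (0 <= (enorm z ^+ 2 * gauss z)%:E)%E.
  by rewrite lee_fin mulr_ge0 ?gauss_ge0 ?sqr_ge0.
have g0 (z : 'rV[R]_n) : (0 <= (gauss z)%:E)%E by rewrite lee_fin gauss_ge0.
rewrite ge0_integralD//; last 4 first.
- by move=> z _; apply: mule_ge0; [rewrite lee_fin|exact: g0].
- exact: emeasurable_funM.
- by move=> z _; apply: mule_ge0; [rewrite lee_fin|exact: g20].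
- exact: emeasurable_funM.
rewrite (ge0_integralZl _ measurableT mgE (fun x _ => g0 x)) ?lee_fin//.
rewrite (ge0_integralZl _ measurableT mg2E (fun x _ => g20 x)) ?lee_fin//.
rewrite integral_gauss.
apply: (@le_trans _ _ ((gauss_normalizer n)%:E * (A%:E * (Num.sqrt (2 * pi) ^+ n)%:E +
   B%:E * (n%:R * Num.sqrt (2 * pi) ^+ n)%:E))%E).
  rewrite lee_wpmul2l//; first by rewrite lee_fin ltW.
  by rewrite leeD2l// lee_wpmul2l// integral_sqr_gauss.
rewrite [leLHS](_ : _ =
    (gauss_normalizer n * Num.sqrt (2 * pi) ^+ n * (A + B * n%:R))%:E); last first.
  by rewrite -!EFinM; congr EFin; ring.
rewrite lee_fin.
rewrite gauss_normalizerE mul1r /A /B -mulrA divfK ?gt_eqF// -mulrDr.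
by rewrite subrK mulr1.
Qed.

(** Strict positivity matters in the extended reals: it makes the product of [gauss_const] with an
    infinite seminorm equal to +oo, whereas 0 times +oo would be 0. *)
Lemma gauss_moment_gt0 n (b : R) : (0 < n)%N -> (0 < gauss_moment n b)%E.
Proof.
move=> n0; rewrite lt_neqAle gauss_moment_ge0 andbT eq_sym /gauss_moment.
rewrite mule_eq0 negb_or eqe gt_eqF ?gauss_normalizer_gt0//=.
apply/negP => /eqP I0.
have : {ae lebesgue_rV n, forall z : 'rV[R]_n, setT z -> (enorm z `^ b * gauss z)%:E = 0%E}.
  apply/(ae_eq_integral_abs _ measurableT).
    by apply/measurable_EFinP; exact: measurable_gauss_moment.
  under eq_integral => z _.
    rewrite gee0_abs; last by rewrite lee_fin mulr_ge0 ?powR_ge0 ?gauss_ge0.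
    over.
  exact: I0.
move=> [N [mN N0 HN]].
(* On the cube [1, 2]^n the integrand is positive, so the cube would be contained in the null set
   [N]; but its measure is 1. *)
pose A (i : 'I_n) : set (measurableTypeR R) := `[1, 2]%classic.
have box1 := @lebesgue_rV_box R n A (fun i => measurable_itv _).
have : (lebesgue_rV n [set x : 'rV[R]_n | forall i, A i (x ord0 i)] <= lebesgue_rV n N)%E.
  apply: le_measure => //; rewrite ?inE//.
    rewrite (_ : [set x | _] = \bigcap_(i in [set: 'I_n]) (@rV_coord R n i @^-1` A i)).
      apply: fin_bigcap_measurable => // i _.
      rewrite -[X in measurable X]setTI; apply: measurable_rV_coord => //.
      exact: measurable_itv.
    by apply/seteqP; split => [x Bx i _|x Bx i]; exact: Bx.
  move=> z Az; apply: HN => /= /(_ I) /eqP; rewrite eqe mulf_eq0 (gt_eqF (gauss_gt0 z)) orbF.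
  rewrite gt_eqF// powR_gt0// lt_neqAle enorm_ge0 andbT eq_sym -(sqrf_eq0 (enorm z)).
  rewrite enorm_sqr gt_eqF// (@lt_le_trans _ _ (\sum_(i < n) 1))//.
    by rewrite sumr_const card_ord ltr0n.
  apply: ler_sum => i _; have := Az i; rewrite /A/= in_itv/= => /andP[z1 _].
  by rewrite exprn_ege1.
rewrite N0 box1 (eq_bigr (fun=> 1%E)) ?big1_eq ?lee_fin ?ler10//.
move=> i _; rewrite lebesgue_measure_itv/= lte_fin ltr1n/= -EFinB.
by congr EFin; ring.
Qed.

(** The exponents theta = alpha/2 <= 1/2 and theta = (1 + alpha)/2 <= 1 bound the two moments by
    n^theta, hence, as n >= 1, by the square root of [n] and by [n]. *)
Lemma gauss_const_bounds n (alpha : R) : (0 < n)%N -> 0 < alpha <= 1 ->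
  (0 < gauss_const n alpha <= (Num.sqrt n%:R + n%:R)%:E)%E.
Proof.
move=> n0 /andP[a0 a1]; rewrite gauss_constE; apply/andP; split.
  by rewrite adde_gt0 ?gauss_moment_gt0.
have n1 : 1 <= n%:R :> R by rewrite ler1n.
rewrite EFinD leeD//.
  rewrite (_ : alpha = 2 * (alpha / 2)); last by lra.
  rewrite (le_trans (gauss_moment_le n0 _)) ?lee_fin -?powR12_sqrt//; first by lra.
  by rewrite ler_powR//; lra.
rewrite (_ : 1 + alpha = 2 * ((1 + alpha) / 2)); last by lra.
rewrite (le_trans (gauss_moment_le n0 _)) ?lee_fin//; first by lra.
by rewrite ler1_powR//; lra.
Qed.

End gauss_moments.

(** * Integrals of derivatives; the dual norm *)

Section integral_derivative.
Context {R : realType} {n : nat}.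
Local Notation V := 'rV[R]_n.
Local Notation mu := (lebesgue_rV (R := R) n).

Lemma cvg_harmonic_dnbhs : (k.+1%:R^-1 : R) @[k --> \oo] --> (0 : R)^'.
Proof.
move=> A A0.
have N0 (k : nat) : k.+1%:R^-1 != 0 :> R by rewrite invr_eq0 pnatr_eq0.
exact: (@filterS nat \oo _ _ _ (fun k Hk => Hk (N0 k)) (@cvg_harmonic R _ A0)).
Qed.

Lemma cvg_difference_quotient (w : V -> R) (x e : V) : derivable w x e ->
  k.+1%:R * (w (k.+1%:R^-1 *: e + x) - w x) @[k --> \oo] --> 'D_e w x.
Proof.
move=> /derivableP/is_deriveP H.
have := cvg_comp _ _ cvg_harmonic_dnbhs H.
by apply: cvg_trans; apply: near_eq_cvg; near=> k; rewrite /= invrK.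
Unshelve. all: by end_near. Qed.

Lemma integrable_cst_closed_ball (B M : R) :
  mu.-integrable setT (fun x : V => (B * \1_[set x : V | `|x| <= M] x)%:E).
Proof.
apply: (@integrable_bounded_support _ _ (fun x : V => B * \1_[set x : V | `|x| <= M] x) `|B| M).
- apply: measurable_funM => //; apply: measurable_indic.
  exact: measurable_closed_ball_rV.
- move=> x; rewrite normrM indicE; case: (_ \in _); first by rewrite normr1 mulr1.
  by rewrite normr0 mulr0.
- by move=> x Mx; rewrite indicE memNset ?mulr0//= leNgt Mx.
Qed.

Lemma integrable_continuous_bounded_support (w : V -> R) :
  continuous w -> bounded_support w -> mu.-integrable setT (EFin \o w).
Proof.
move=> cw bw; have [B _ HB] := continuous_bounded cw bw; have [M HM] := bw.
by apply: (integrable_bounded_support _ HB HM); exact: continuous_measurable_rV.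
Qed.

(** By translation invariance every difference quotient of [w] has integral 0, and dominated
    convergence passes this on to the derivative. *)
Lemma integral_derive_eq0 (w : V -> R) (e : V) : (forall x, derivable w x e) ->
  continuous w -> continuous ('D_e w) -> bounded_support w ->
  (\int[mu]_x ('D_e w x)%:E = 0)%E.
Proof.
move=> dw cw cdw bw; have [M HM] := bw.
have bdw : bounded_support ('D_e w) by exists M; exact: bounded_support_derive.
have [B B0 HB] := continuous_bounded cdw bdw.
pose f k x : \bar R := (k.+1%:R * (w (k.+1%:R^-1 *: e + x) - w x))%:E.
have mw : measurable_fun setT w by exact: continuous_measurable_rV.
have msw v : measurable_fun setT (fun x : V => w (v + x)).
  rewrite (_ : (fun x => w (v + x)) = w \o (fun x => x + v)); last first.
    by apply/funext => x /=; rewrite addrC.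
  by apply: measurableT_comp => //; exact: measurable_rV_shift.
have mwE : measurable_fun setT (EFin \o w) by exact/measurable_EFinP.
have iw : mu.-integrable setT (EFin \o w).
  exact: integrable_continuous_bounded_support.
have isw v : mu.-integrable setT (fun x : V => (w (v + x))%:E).
  apply/integrableP; split; first by apply/measurable_EFinP; exact: msw.
  have /integrableP[_] := iw.
  rewrite -(integral_rV_shift v); last by apply: measurableT_comp.
  by under [X in (X < _)%E -> _]eq_integral do rewrite /= addrC.
have f0 k : (\int[mu]_x f k x = 0)%E.
  rewrite /f; under eq_integral do rewrite EFinM EFinB.
  rewrite integralZl//; last exact: integrableB.
  rewrite integralB// -[X in (_ - X)%E](integral_rV_shift (k.+1%:R^-1 *: e))//.
  under [X in (_ - X)%E]eq_integral do rewrite addrC.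
  rewrite subee ?mule0//; apply: integrable_fin_num => //; exact: isw.
(* By the mean value theorem the quotients are bounded by the bound [B] of the derivative; as the
   increments are at most 1, they vanish outside the ball widened by the norm of [e]. *)
have dc := @dominated_convergence _ _ _ mu setT measurableT f
  (EFin \o 'D_e w) (fun x => (B * \1_[set x : V | `|x| <= M + `|e|] x)%:E).
have [] := dc.
- move=> k; apply/measurable_EFinP/measurable_funM => //.
  by apply: measurable_funB => //; exact: msw.
- by apply/measurable_EFinP; exact: continuous_measurable_rV.
- apply/aeW => x _; apply/cvg_EFin; first by near=> k.
  exact: cvg_difference_quotient.
- exact: integrable_cst_closed_ball.
- apply/aeW => x k _; rewrite /f lee_fin indicE.
  have k0 : 0 < k.+1%:R^-1 :> R by rewrite invr_gt0.
  have k1 : k.+1%:R^-1 <= 1 :> R by rewrite invf_le1// ler1n.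
  have [Mx|xM] := ltP (M + `|e|) `|x|.
    rewrite memNset ?mulr0; last by apply/negP; rewrite -ltNge.
    suff [-> ->] : w (k.+1%:R^-1 *: e + x) = 0 /\ w x = 0.
      by rewrite subrr mulr0 normr0.
    split; apply: HM; last by rewrite (le_lt_trans _ Mx)// lerDl.
    have : `|x| <= `|k.+1%:R^-1 *: e + x| + `|k.+1%:R^-1 *: e|.
      by rewrite -{1}[x](addKr (k.+1%:R^-1 *: e)) addrC ler_normB.
    have : `|k.+1%:R^-1 *: e| <= `|e|.
      by rewrite normrZ (gtr0_norm k0) ler_piMl.
    by move: Mx; lra.
  rewrite mem_set//= mulr1.
  have d y : is_derive y (k.+1%:R^-1 *: e) w ('D_e w y * k.+1%:R^-1).
    by apply/is_derive_scale_dir/derivableP.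
  have [|c _ ->] := @derive_MVT _ _ w x (k.+1%:R^-1 *: e).
    by move=> y; case: (d y).
  by rewrite derive_val mulrC divfK.
move=> _ _ H; apply: (cvg_unique _ H); first exact: ereal_hausdorff.
by apply: cvg_near_cst; apply: nearW => k; rewrite /= f0.
Unshelve. all: by end_near. Qed.

End integral_derivative.

(** * Hoelder and Minkowski for the exponents p and q, including q = +oo *)

Section dual_norm.
Context {R : realType} {n : nat}.
Local Notation V := 'rV[R]_n.
Local Notation mu := (lebesgue_rV (R := R) n).
Implicit Types g h : V -> R.

Lemma hoelder_conjugate_cases (p : R) : 1 <= p ->
  p = 1 /\ hoelder_conjugate p%:E = +oo%E \/
  exists2 r : R, hoelder_conjugate p%:E = r%:E & 1 <= r /\ p^-1 + r^-1 = 1.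
Proof.
rewrite le_eqVlt => /orP[/eqP <-|p1]; first by left; rewrite hoelder_conjugate1.
right; exists (p / (p - 1)).
  rewrite /hoelder_conjugate/= eqe gt_eqF ?(lt_trans ltr01)//.
  by rewrite -EFinD inver subr_eq0 gt_eqF.
have p10 : 0 < p - 1 by rewrite subr_gt0.
split; first by rewrite ler_pdivlMr//; lra.
by field; rewrite !gt_eqF// (lt_trans ltr01).
Qed.

Variables (p : R) (p1 : 1 <= p).
Local Notation q := (hoelder_conjugate p%:E).

Lemma qnorm_ge0 g : (0 <= qnorm q g)%E.
Proof.
rewrite /qnorm; case: ifPn => _; last exact: Lnorm_ge0.
by apply: ereal_sup_ge; exists `|g 0|%:E; [exists 0 => //|rewrite lee_fin].
Qed.

Lemma measurable_normr_powR (r : R) g : measurable_fun setT g ->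
  measurable_fun setT (fun x => (`|g x| `^ r)%:E).
Proof.
move=> mg; apply/measurable_EFinP; apply: (measurableT_comp (measurable_powR r)).
exact: measurableT_comp.
Qed.

Lemma Lnorm_le (r : R) g h : 1 <= r -> measurable_fun setT g -> measurable_fun setT h ->
  (forall x, `|g x| <= `|h x|) ->
  ('N[mu]_r%:E[EFin \o g] <= 'N[mu]_r%:E[EFin \o h])%E.
Proof.
move=> r1 mg mh gh; have r0 : 0 < r by rewrite (lt_le_trans ltr01).
rewrite unlock; apply: gt0_ler_poweR.
- by rewrite invr_ge0 ltW.
- by rewrite in_itv/= leey andbT; apply: integral_ge0 => x _; rewrite lee_fin powR_ge0.
- by rewrite in_itv/= leey andbT; apply: integral_ge0 => x _; rewrite lee_fin powR_ge0.
apply: ge0_le_integral => //; [by move=> x _; rewrite lee_fin powR_ge0|exact: measurable_normr_powR|exact: measurable_normr_powR|].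
move=> x _; rewrite /= lee_fin; apply: ge0_ler_powR => //.
exact: ltW.
Qed.

Lemma qnorm_le g h : measurable_fun setT g -> measurable_fun setT h ->
  (forall x, `|g x| <= `|h x|) -> (qnorm q g <= qnorm q h)%E.
Proof.
move=> mg mh gh; rewrite /qnorm.
case: (hoelder_conjugate_cases p1) => [[_ ->]|[r -> [r1 _]]] /=.
  apply: ge_ereal_sup => _ [x _ <-]; apply: ereal_sup_ge.
  by exists `|h x|%:E; [exists x => //|rewrite lee_fin].
exact: Lnorm_le.
Qed.

Lemma qnorm_lt_sup g (c : R) : p = 1 -> qnorm q g = c%:E -> forall x, `|g x| <= c.
Proof.
move=> p1'; rewrite /qnorm p1' hoelder_conjugate1 /= => gc x.
by rewrite -lee_fin -gc; apply: ereal_sup_ubound; exists x.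
Qed.

(** For p > 1 this is Hoelder's inequality. For p = 1 [qnorm] is a supremum, finite by hypothesis,
    and the integrands are compared pointwise. *)
Lemma pairing_le (f g : V -> R) : measurable_fun setT f -> measurable_fun setT g ->
  (qnorm q g < +oo)%E ->
  (\int[mu]_x `|(f x * g x)%:E| <= 'N[mu]_p%:E[EFin \o f] * qnorm q g)%E.
Proof.
move=> mf mg gfin.
have [[pE qE]|[r qE [r1 pr]]] := hoelder_conjugate_cases p1; last first.
  have := hoelder mu mf mg (lt_le_trans ltr01 p1) (lt_le_trans ltr01 r1) pr.
  by rewrite Lnorm1 qE.
have gE : qnorm q g \is a fin_num by rewrite ge0_fin_numE// qnorm_ge0.
have := qnorm_lt_sup pE (esym (fineK gE)).
rewrite -(fineK gE) pE; set c := fine _ => gc.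
have c0 : 0 <= c by rewrite (le_trans (normr_ge0 (g 0))).
rewrite Lnorm1 -ge0_integralZr//; last exact/measurableT_comp/measurable_EFinP.
apply: ge0_le_integral => //.
- by apply: measurableT_comp => //; apply/measurable_EFinP; exact: measurable_funM.
- apply: emeasurable_funM => //; apply: measurableT_comp => //.
  exact/measurable_EFinP.
by move=> x _; rewrite /= lee_fin normrM ler_wpM2l.
Qed.

Lemma pairing_integrable (f g : V -> R) : f \in Lfun mu p%:E ->
  measurable_fun setT g -> (qnorm q g < +oo)%E ->
  mu.-integrable setT (fun x => (f x * g x)%:E).
Proof.
rewrite inE => /andP[/[!inE]/= mf ff] mg gfin; apply/integrableP; split.
  by apply/measurable_EFinP; exact: measurable_funM.
rewrite (le_lt_trans (pairing_le mf mg gfin))//; apply: lte_mul_pinfty => //.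
  exact: Lnorm_ge0.
by rewrite ge0_fin_numE ?Lnorm_ge0.
Qed.

Lemma qnormD g h : measurable_fun setT g -> measurable_fun setT h ->
  (qnorm q (fun x => (g x + h x)%R) <= qnorm q g + qnorm q h)%E.
Proof.
move=> mg mh; rewrite /qnorm.
have [[pE ->]|[r -> [r1 pr]]] /= := hoelder_conjugate_cases p1.
  apply: ge_ereal_sup => _ [x _ <-].
  apply: (@le_trans _ _ (`|g x|%:E + `|h x|%:E)%E).
    by rewrite -EFinD lee_fin ler_normD.
  by apply: leeD; apply: ereal_sup_ubound; exists x.
exact: minkowski_EFin.
Qed.

Lemma qnormZ g (c : R) : measurable_fun setT g ->
  (qnorm q (fun x => (c * g x)%R) <= `|c|%:E * qnorm q g)%E.
Proof.
move=> mg; rewrite /qnorm.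
have [[pE ->]|[r -> [r1 pr]]] /= := hoelder_conjugate_cases p1.
  apply: ge_ereal_sup => _ [x _ <-]; rewrite normrM EFinM lee_wpmul2l//.
  by apply: ereal_sup_ubound; exists x.
have r0 : 0 < r by rewrite (lt_le_trans ltr01).
have mgr := measurable_normr_powR r mg.
rewrite unlock /=; under eq_integral do rewrite /= normrM powRM// EFinM.
rewrite ge0_integralZl// ?lee_fin ?powR_ge0//.
rewrite poweRM ?lee_fin ?powR_ge0 ?integral_ge0//.
by rewrite poweR_EFin -powRrM mulfV ?gt_eqF// powRr1.
Qed.

Lemma qnorm_shift g v : measurable_fun setT g ->
  qnorm q (fun x => g (x + v)) = qnorm q g.
Proof.
move=> mg; rewrite /qnorm.
have [[pE ->]|[r -> [r1 pr]]] /= := hoelder_conjugate_cases p1.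
  congr ereal_sup; apply/seteqP; split=> _ [x _ <-]; first by exists (x + v).
  by exists (x - v) => //; rewrite subrK.
by rewrite unlock -[in RHS](integral_rV_shift v (measurable_normr_powR r mg)).
Qed.

Lemma qnorm_closed_ball (M : R) :
  (qnorm q (fun x : V => \1_[set x : V | (`|x| <= M)%R] x) < +oo)%E.
Proof.
rewrite /qnorm.
have [[pE ->]|[r -> [r1 pr]]] /= := hoelder_conjugate_cases p1.
  apply: (@le_lt_trans _ _ 1%:E); last by rewrite ltry.
  apply: ge_ereal_sup => _ [x _ <-]; rewrite indicE lee_fin.
  by case: (_ \in _); rewrite ?normr1// normr0.
have r0 : 0 < r by rewrite (lt_le_trans ltr01).
rewrite unlock /=; apply: poweR_lty.
under eq_integral => x _.
  rewrite (_ : (_ `^ _)%:E = (\1_[set x : V | (`|x| <= M)%R] x)%:E); last first.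
    rewrite indicE; case: (_ \in _); first by rewrite normr1 powR1.
    by rewrite normr0 powR0// gt_eqF.
  over.
rewrite integral_indic//; last exact: measurable_closed_ball_rV.
by rewrite setIT closed_ball_rV_fin.
Qed.

Lemma qnorm_bounded_support g (B M : R) : measurable_fun setT g ->
  (forall x, `|g x| <= B) -> (forall x, M < `|x| -> g x = 0) ->
  (qnorm q g <= B%:E * qnorm q (fun x : V => \1_[set x : V | (`|x| <= M)%R] x))%E.
Proof.
move=> mg gB gM.
have B0 : 0 <= B by rewrite (le_trans (normr_ge0 (g 0))).
have m1 : measurable_fun setT (fun x : V => \1_[set x : V | `|x| <= M] x : R).
  by apply: measurable_indic; exact: measurable_closed_ball_rV.
rewrite -{1}(ger0_norm B0); apply: le_trans (qnormZ _ m1).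
apply: qnorm_le => //; first exact: measurable_funM.
move=> x; rewrite normrM (ger0_norm B0) indicE.
have [xM|/gM->] := leP `|x| M; last by rewrite normr0 mulr_ge0.
by rewrite mem_set// normr1 mulr1.
Qed.

Lemma qnorm_lty_continuous g : continuous g -> bounded_support g ->
  (qnorm q g < +oo)%E.
Proof.
move=> cg bg; have [B B0 HB] := continuous_bounded cg bg; have [M HM] := bg.
rewrite (le_lt_trans (qnorm_bounded_support (continuous_measurable_rV cg) HB HM))//.
apply: lte_mul_pinfty => //; first by rewrite lee_fin ltW.
exact: qnorm_closed_ball.
Qed.

Lemma qnorm_sum N (g : nat -> V -> R) (B : \bar R) :
  (forall k, measurable_fun setT (g k)) -> (forall k, (qnorm q (g k) <= B)%E) ->
  (qnorm q (fun x => (\sum_(k < N) g k x)%R) <= N%:R%:E * B)%E.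
Proof.
move=> mg gB; elim: N => [|N IH].
  under eq_fun do rewrite big_ord0.
  have := @qnormZ (cst 0) 0 (measurable_cst _).
  rewrite normr0 !mul0e; apply: le_trans.
  by under [X in (_ <= qnorm _ X)%E]eq_fun do rewrite mul0r.
under eq_fun do rewrite big_ord_recr/=.
apply: (le_trans (qnormD _ _)) => //.
  by apply: measurable_sum.
by rewrite -natr1 EFinD ge0_muleDl ?lee_fin// mul1e leeD.
Qed.

End dual_norm.

(** * The upper bound *)

Section continuous_pointwise.
Context {R : realType} {T : topologicalType}.
Implicit Types f g : T -> R.

Lemma continuous_mul f g : continuous f -> continuous g ->
  continuous (fun x => f x * g x).
Proof. by move=> cf cg x; exact: (continuousM (cf x) (cg x)). Qed.

Lemma continuous_sub f g : continuous f -> continuous g ->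
  continuous (fun x => f x - g x).
Proof. by move=> cf cg x; exact: (continuousB (cf x) (cg x)). Qed.

End continuous_pointwise.

(** * Euclidean geometry and the Gaussian divergence identity *)

Section gaussian_divergence.
Context {R : realType} {n : nat}.
Local Notation V := 'rV[R]_n.
Local Notation mu := (lebesgue_rV (R := R) n).
Local Notation ev := (@basis_vec R n).

Definition dotr (u z : V) : R := \sum_(i < n) u ord0 i * z ord0 i.

Lemma enorm0 : enorm (0 : V) = 0.
Proof. by rewrite /enorm big1 ?sqrtr0// => i _; rewrite mxE expr0n. Qed.

Lemma enormZ (c : R) (z : V) : enorm (c *: z) = `|c| * enorm z.
Proof.
rewrite /enorm -(sqrtr_sqr c) -sqrtrM ?sqr_ge0// mulr_sumr.
by under eq_bigr do rewrite mxE exprMn.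
Qed.

Lemma enorm_eq0 (z : V) : enorm z = 0 -> z = 0.
Proof.
move=> z0; have : \sum_(i < n) z ord0 i ^+ 2 = 0 by rewrite -enorm_sqr z0 expr0n.
move=> /eqP; rewrite psumr_eq0; last by move=> i _; exact: sqr_ge0.
move=> /allP H; apply/rowP => i; rewrite mxE.
by have := H i (mem_index_enum i); rewrite /= sqrf_eq0 => /eqP.
Qed.

Lemma dotrNr u z : dotr u (- z) = - dotr u z.
Proof. by rewrite /dotr -sumrN; apply: eq_bigr => i _; rewrite mxE mulrN. Qed.

(** Cauchy-Schwarz, by summing the squares of |z| u_i - |u| z_i. The proof divides by the product of
    the norms, so vanishing norms are removed first. *)
Lemma dotr_le (u z : V) : dotr u z <= enorm u * enorm z.
Proof.
have [u0|u0] := eqVneq (enorm u) 0.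
  by rewrite u0 mul0r (enorm_eq0 u0) /dotr big1// => i _; rewrite mxE mul0r.
have [z0|z0] := eqVneq (enorm z) 0.
  by rewrite z0 mulr0 (enorm_eq0 z0) /dotr big1// => i _; rewrite mxE mulr0.
have uz : 0 < enorm u * enorm z.
  by rewrite mulr_gt0// lt_neqAle enorm_ge0 andbT eq_sym.
rewrite -(ler_pM2l uz) -(ler_pM2l (ltr0n R 2)).
rewrite (_ : 2 * (_ * (enorm u * enorm z)) =
    enorm z ^+ 2 * enorm u ^+ 2 + enorm u ^+ 2 * enorm z ^+ 2); last by ring.
rewrite {1}(enorm_sqr u) {2}(enorm_sqr z) /dotr !mulr_sumr -big_split/=.
apply: ler_sum => i _; rewrite -subr_ge0.
rewrite (_ : _ - _ = (enorm z * u ord0 i - enorm u * z ord0 i) ^+ 2); last by ring.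
exact: sqr_ge0.
Qed.

Lemma normr_dotr_le (u z : V) : `|dotr u z| <= enorm u * enorm z.
Proof.
rewrite ler_norml dotr_le andbT lerNl -dotrNr (le_trans (dotr_le _ _))//.
by rewrite -scaleN1r enormZ normrN1 mul1r.
Qed.

Lemma is_derive_affine (phi : V -> R) (t l : R) (x z v : V) :
  is_derive (t *: z + x) v phi l -> is_derive z v (fun y => phi (t *: y + x)) (l * t).
Proof.
move=> /(is_derive_scale_dir t)/is_deriveP H; apply/is_deriveP.
apply: cvg_trans H; apply: near_eq_cvg; near=> h.
by rewrite /= scalerDr addrA !scalerA [t * h]mulrC.
Unshelve. all: by end_near. Qed.

Lemma bounded_support_affine (phi : V -> R) (t : R) (x : V) (M : R) : 0 < t ->
  (forall y, M < `|y| -> phi y = 0) ->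
  forall z, (M + `|x|) / t < `|z| -> phi (t *: z + x) = 0.
Proof.
move=> t0 HM z; rewrite ltr_pdivrMr// => Mz; apply: HM.
have : `|t *: z| <= `|t *: z + x| + `|x|.
  by rewrite -{1}[t *: z](addrK x) ler_normB.
by rewrite normrZ gtr0_norm//; lra.
Qed.

Lemma continuous_affine (phi : V -> R) (t : R) (x : V) : continuous phi ->
  continuous (fun z : V => phi (t *: z + x)).
Proof.
move=> cphi z; apply: (@continuous_comp _ _ _ (fun z : V => t *: z + x) phi); last exact: cphi.
apply: continuousD; last exact: cst_continuous.
by apply: continuousZr; exact: cvg_id.
Qed.

(* Up to the factor t, the integrand is the divergence of z |-> g(z) Phi(tz + x). *)
Lemma gauss_divergence_eq0 (Phi : V -> V) (x : V) (t : R) : 0 < t -> test_field Phi ->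
  let F z := (gauss z * (divergence Phi (t *: z + x) -
     t^-1 * dotr (Phi (t *: z + x)) z))%:E in
  mu.-integrable setT F /\ (\int[mu]_z F z = 0)%E.
Proof.
move=> t0 /test_fieldP[sP [M HM]].
pose P i y := Phi y ord0 i.
pose W i (z : V) := P i (t *: z + x) * gauss z.
pose dW i (z : V) := gauss z * (t * 'D_(ev i) (P i) (t *: z + x) -
   P i (t *: z + x) * z ord0 i).
have dWE i z : is_derive z (ev i) (W i) (dW i z).
  have d1 : is_derive z (ev i) (fun z => P i (t *: z + x))
      ('D_(ev i) (P i) (t *: z + x) * t).
    by apply/is_derive_affine/derivableP/smooth_derivable; exact: sP.
  have d2 := is_derive_gauss z (ev i).
  apply: (is_derive_eq (is_deriveM d1 d2)).
  rewrite (bigD1 i)//= big1 => [|j ji]; last by rewrite mxE eqxx (negPf ji) mulr0.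
  by rewrite /dW !mxE !eqxx mulr1 addr0 /GRing.scale/=; ring.
have cgauss : continuous (@gauss R n) by exact: continuous_gauss.
have cP i : continuous (fun z : V => P i (t *: z + x)).
  by apply: (continuous_affine (phi := P i)); apply: smooth_continuous; exact: sP.
have cdP i : continuous (fun z : V => 'D_(ev i) (P i) (t *: z + x)).
  by apply: (continuous_affine (phi := 'D_(ev i) (P i))); apply/smooth_continuous/smooth_partial; exact: sP.
have cW i : continuous (W i) by exact: continuous_mul.
have cdW i : continuous (dW i).
  apply: continuous_mul => //; apply: continuous_sub; apply: continuous_mul => //.
    exact: cst_continuous.
  exact: coord_continuous.
have PM i y : M < `|y| -> P i y = 0 by move=> /HM; rewrite /P => ->; rewrite mxE.
have bW i : bounded_support (W i).
  exists ((M + `|x|) / t) => z Mz; rewrite /W.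
  by rewrite (bounded_support_affine t0 (PM i))// mul0r.
have bdW i : bounded_support (dW i).
  exists ((M + `|x|) / t) => z Mz; rewrite /dW.
  rewrite (bounded_support_affine t0 (PM i))//.
  rewrite (bounded_support_affine t0 (bounded_support_derive (ev i) (PM i)))//.
  by rewrite mulr0 mul0r subr0 mulr0.
have DW i : 'D_(ev i) (W i) = dW i by apply/funext => z; rewrite derive_val.
have int0 i : (\int[mu]_z (dW i z)%:E = 0)%E.
  have := @integral_derive_eq0 _ _ (W i) (ev i)
    (fun z => @ex_derive _ _ _ _ _ _ _ (dWE i z)) (cW i).
  rewrite DW => /(_ (cdW i) (bW i)) E; rewrite -[RHS]E.
  by apply: eq_integral => z _; rewrite (@derive_val _ _ _ _ _ _ _ (dWE i z)).
have idW i : mu.-integrable setT (EFin \o dW i).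
  exact: integrable_continuous_bounded_support.
rewrite /=; rewrite (_ : (fun z => _) = fun z => (t^-1%:E * \sum_(i < n) (dW i z)%:E)%E).
  have isW : mu.-integrable setT (fun z => \sum_(i < n) (dW i z)%:E)%E.
    by apply: integrable_sum => // i _; exact: idW.
  split; first exact: integrableZl.
  rewrite integralZl// integral_sum// big1 ?mule0// => i _; exact: int0.
apply/funext => z; rewrite sumEFin -EFinM; congr EFin.
rewrite /divergence /dotr mulr_sumr -sumrB !mulr_sumr; apply: eq_bigr => i _.
by rewrite /dW /P; field; rewrite gt_eqF.
Qed.

End gaussian_divergence.

Section gaussian_integrability.
Context {R : realType} {n : nat}.
Local Notation V := 'rV[R]_n.
Local Notation mu := (lebesgue_rV (R := R) n).

Lemma integrable_gauss : mu.-integrable setT (EFin \o @gauss R n).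
Proof.
apply/integrableP; split; first by apply/measurable_EFinP; exact: measurable_gauss.
rewrite (eq_integral (fun z => (gauss z)%:E)) ?integral_gauss ?ltry// => z _.
by rewrite /= ger0_norm// gauss_ge0.
Qed.

Lemma gauss_moment_fin (b : R) : (0 < n)%N -> 0 < b <= 2 ->
  gauss_moment n b \is a fin_num.
Proof.
move=> n0 /andP[b0 b2]; rewrite ge0_fin_numE; last exact: gauss_moment_ge0.
rewrite (_ : b = 2 * (b / 2)); last by lra.
by rewrite (le_lt_trans (gauss_moment_le n0 _)) ?ltry//; lra.
Qed.

Lemma integral_gauss_momentE (b : R) : (0 < n)%N -> 0 < b <= 2 ->
  (\int[mu]_z (enorm z `^ b * gauss z)%:E =
   ((gauss_normalizer n)^-1 * fine (gauss_moment n b))%:E)%E.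
Proof.
move=> n0 b02; have := fineK (gauss_moment_fin n0 b02); rewrite EFinM => ->.
rewrite /gauss_moment muleA -EFinM mulVf ?mul1e// gt_eqF//.
exact: gauss_normalizer_gt0.
Qed.

Lemma integrable_gauss_moment (b : R) : (0 < n)%N -> 0 < b <= 2 ->
  mu.-integrable setT (fun z : V => (enorm z `^ b * gauss z)%:E).
Proof.
move=> n0 b02; apply/integrableP; split.
  by apply/measurable_EFinP; exact: measurable_gauss_moment.
rewrite (eq_integral (fun z : V => (enorm z `^ b * gauss z)%:E)).
  by rewrite integral_gauss_momentE// ltry.
by move=> z _; rewrite gee0_abs// lee_fin mulr_ge0 ?gauss_ge0 ?powR_ge0.
Qed.

Lemma measurable_dotr (u : V) : measurable_fun setT (dotr u).
Proof.
apply: measurable_sum => i; apply: measurable_funM => //.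
exact: (@measurable_rV_coord R n i).
Qed.

Lemma integrable_gauss_dotr (u : V) : (0 < n)%N ->
  mu.-integrable setT (fun z : V => (gauss z * dotr u z)%:E).
Proof.
move=> n0; apply: (le_integrable measurableT
    (g := fun z : V => ((enorm u)%:E * (enorm z `^ 1 * gauss z)%:E)%E)).
- apply/measurable_EFinP/measurable_funM; first exact: measurable_gauss.
  exact: measurable_dotr.
- move=> z _; rewrite -EFinM /= lee_fin normrM ger0_norm ?gauss_ge0//.
  rewrite powRr1 ?enorm_ge0// [leRHS]ger0_norm; last by rewrite !mulr_ge0 ?enorm_ge0 ?gauss_ge0.
  by rewrite mulrA [leLHS]mulrC ler_wpM2r ?gauss_ge0// normr_dotr_le.
- by apply: integrableZl => //; apply: integrable_gauss_moment => //; lra.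
Qed.

(** The integrand is odd, so the integral equals its own negative; integrability makes it finite,
    and therefore 0. *)
Lemma integral_gauss_dotr (u : V) : (0 < n)%N ->
  (\int[mu]_z (gauss z * dotr u z)%:E = 0)%E.
Proof.
move=> n0; have iu := integrable_gauss_dotr u n0.
have mf := measurable_int _ iu.
have := integral_rV_opp mf.
have := integrable_fin_num measurableT iu.
under [in X in _ -> X = _ -> _]eq_integral do rewrite gaussN dotrNr mulrN EFinN.
rewrite integralN; last exact: integrable_add_def.
case: (integral _ _ _) => //= r _ [] rr; congr EFin; lra.
Qed.

End gaussian_integrability.

(** * The pairing estimate for a fixed scale t, by Fubini *)

Section smoothing_estimate.
Context {R : realType} {n : nat}.
Local Notation V := 'rV[R]_n.
Local Notation mu := (lebesgue_rV (R := R) n).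
Variables (n_gt0 : (0 < n)%N) (p alpha S : R) (p_ge1 : 1 <= p).
Variables (alpha_gt0 : 0 < alpha) (alpha_le1 : alpha <= 1) (S_ge0 : 0 <= S).
Variables (f : V -> R) (fLp : f \in Lfun mu p%:E).
Hypothesis diffS : forall h, (diff_norm p f h <= (S * enorm h `^ alpha)%:E)%E.
Variables (Phi : V -> V) (tPhi : test_field Phi).
Local Notation q := (hoelder_conjugate p%:E).
Local Notation D := (divergence Phi).
Local Notation nPhi := (@enorm R n \o Phi).

Let mf : measurable_fun setT f.
Proof. by move: fLp; rewrite inE => /andP[/[!inE]]. Qed.

Let sPhi i : smooth (fun x => Phi x ord0 i).
Proof. by case: tPhi. Qed.

Lemma smooth_divergence : smooth D.
Proof.
by apply: smooth_sum => i; exact: smooth_partial.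
Qed.

Lemma test_field_support : exists M : R, forall x, M < `|x| -> Phi x = 0.
Proof. by have /test_fieldP[] := tPhi. Qed.

Lemma bounded_support_divergence : bounded_support D.
Proof.
have [M HM] := test_field_support; exists M => x Mx.
rewrite /divergence big1// => i _.
by apply: (bounded_support_derive _ _ Mx) => y /HM ->; rewrite mxE.
Qed.

Lemma qnorm_divergence_lty : (qnorm q D < +oo)%E.
Proof.
apply: qnorm_lty_continuous => //; last exact: bounded_support_divergence.
exact: smooth_continuous smooth_divergence.
Qed.

Lemma measurable_test_field : measurable_fun setT Phi.
Proof. by apply: measurable_fun_rVP => i; exact: smooth_measurable (sPhi i). Qed.

Lemma measurable_enorm_field : measurable_fun setT nPhi.
Proof.
by apply: measurableT_comp; [exact: measurable_enorm|exact: measurable_test_field].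
Qed.

(** The bound is read off the square of the Euclidean norm, which is polynomial in the components of
    [Phi] and therefore smooth, with the same bounded support. *)
Lemma qnorm_field_lty : (qnorm q nPhi < +oo)%E.
Proof.
have [M HM] := test_field_support.
pose N x := \sum_(i < n) Phi x ord0 i * Phi x ord0 i.
have sN : smooth N by apply: smooth_sum => i; exact: smoothM.
have NM x : M < `|x| -> N x = 0.
  by move=> /HM Px; rewrite /N big1// => i _; rewrite Px mxE mulr0.
have [B B0 NB] := continuous_bounded (smooth_continuous sN) (ex_intro _ M NM).
have bP x : `|nPhi x| <= Num.sqrt B.
  rewrite ger0_norm ?enorm_ge0//=; apply: ler_wsqrtr.
  have NE : N x = \sum_(i < n) Phi x ord0 i ^+ 2.
    by apply: eq_bigr => i _; rewrite expr2.
  by rewrite -NE (le_trans (ler_norm _) (NB x)).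
have PM x : M < `|x| -> nPhi x = 0 by move=> /HM /= ->; rewrite enorm0.
apply: le_lt_trans (qnorm_bounded_support p_ge1 measurable_enorm_field bP PM) _.
apply: lte_mul_pinfty => //.
exact: qnorm_closed_ball.
Qed.

Let a := fine (qnorm q nPhi).
Let b := fine (qnorm q D).

Let aE : qnorm q nPhi = a%:E.
Proof. by rewrite fineK// ge0_fin_numE ?qnorm_field_lty// qnorm_ge0. Qed.

Let bE : qnorm q D = b%:E.
Proof. by rewrite fineK// ge0_fin_numE ?qnorm_divergence_lty// qnorm_ge0. Qed.

Let a_ge0 : 0 <= a. Proof. by rewrite -lee_fin -aE qnorm_ge0. Qed.
Let b_ge0 : 0 <= b. Proof. by rewrite -lee_fin -bE qnorm_ge0. Qed.

Variables (t : R) (t_gt0 : 0 < t).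

Let Psi (x z : V) : R := D x - t^-1 * dotr (Phi x) z.

Let mPsi z : measurable_fun setT (Psi ^~ z).
Proof.
apply: measurable_funB; first exact: smooth_measurable smooth_divergence.
apply: measurable_funM => //; apply: measurable_sum => i.
by apply: measurable_funM => //; exact: smooth_measurable (sPhi i).
Qed.

(** Minkowski separates the two terms of [Psi]; Cauchy-Schwarz bounds [dotr (Phi x) z] by
    [enorm (Phi x) * enorm z], which produces [a]. *)
Let qPsi z : (qnorm q (Psi ^~ z) <= (b + t^-1 * enorm z * a)%:E)%E.
Proof.
have mdot : measurable_fun setT (fun x => - (t^-1 * dotr (Phi x) z)).
  apply: measurable_funN; apply: measurable_funM => //; apply: measurable_sum => i.
  by apply: measurable_funM => //; exact: smooth_measurable (sPhi i).
have := qnormD p_ge1 (smooth_measurable smooth_divergence) mdot.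
move=> /le_trans; apply; rewrite EFinD bE leeD2l//.
have c0 : 0 <= t^-1 * enorm z by rewrite mulr_ge0 ?enorm_ge0// invr_ge0 ltW.
rewrite EFinM -aE -[X in (X%:E * _)%E](ger0_norm c0).
apply: le_trans (qnormZ p_ge1 _ measurable_enorm_field).
apply: qnorm_le => //; first by apply: measurable_funM => //; exact: measurable_enorm_field.
move=> x; rewrite normrN !normrM (ger0_norm (enorm_ge0 z)) (ger0_norm (enorm_ge0 (Phi x))).
by rewrite -mulrA ler_wpM2l// mulrC normr_dotr_le.
Qed.

Let G (x z : V) := gauss z * Psi x z.

Let qG v z : (qnorm q (fun x : V => G (x + v)%R z) <= (gauss z * (b + t^-1 * enorm z * a))%:E)%E.
Proof.
have mg : measurable_fun setT (fun x : V => Psi (x + v) z).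
  by apply: (measurableT_comp (mPsi z)); exact: measurable_rV_shift.
have := qnormZ p_ge1 (gauss z) mg => /le_trans; apply.
rewrite ger0_norm ?gauss_ge0// EFinM lee_wpmul2l ?lee_fin ?gauss_ge0//.
by rewrite (qnorm_shift p_ge1 v (mPsi z)).
Qed.

Let mG v z : measurable_fun setT (fun x : V => G (x + v) z).
Proof.
apply: measurable_funM => //.
by apply: (measurableT_comp (mPsi z)); exact: measurable_rV_shift.
Qed.

(* The integral of H t over z vanishes, and that of H 0 is D x f x; integrating
   over x first instead turns the difference into one of translates of f. *)
Let H (s : R) (xz : V * V) : \bar R := (f xz.1 * G (s *: xz.2 + xz.1) xz.2)%:E.

Let mH s : measurable_fun setT (H s).
Proof.
have mc i (g : V * V -> V) : measurable_fun setT g ->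
    measurable_fun setT (fun xz => g xz ord0 i).
  by move=> mg; exact: (measurableT_comp (@measurable_rV_coord R n i) mg).
have mT : measurable_fun setT (fun xz : V * V => s *: xz.2 + xz.1).
  apply: measurable_fun_rVP => i.
  rewrite (_ : _ \o _ = fun xz : V * V => s * xz.2 ord0 i + xz.1 ord0 i).
    apply: measurable_funD; first apply: measurable_funM => //.
      by apply: mc; exact: measurable_snd.
    by apply: mc; exact: measurable_fst.
  by apply/funext => xz; rewrite /= /rV_coord !mxE.
apply/measurable_EFinP/measurable_funM.
  by apply: (measurableT_comp mf); exact: measurable_fst.
apply: measurable_funM.
  by apply: (measurableT_comp (@measurable_gauss R n)); exact: measurable_snd.
apply: measurable_funB.
  exact: (measurableT_comp (smooth_measurable smooth_divergence) mT).
apply: measurable_funM => //; apply: measurable_sum => i; apply: measurable_funM.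
  exact: (measurableT_comp (smooth_measurable (sPhi i)) mT).
by apply: mc; exact: measurable_snd.
Qed.

Let N := fine 'N[mu]_p%:E[EFin \o f]%E.

Let NE : 'N[mu]_p%:E[EFin \o f]%E = N%:E.
Proof.
rewrite fineK// ge0_fin_numE ?Lnorm_ge0//.
by move: fLp; rewrite inE => /andP[_ /[!inE]].
Qed.

Let N_ge0 : 0 <= N. Proof. by rewrite -lee_fin -NE Lnorm_ge0. Qed.

Let weight (z : V) : R := gauss z * (b + t^-1 * enorm z * a).

Let weight_ge0 z : 0 <= weight z.
Proof.
by rewrite mulr_ge0 ?gauss_ge0// addr_ge0// !mulr_ge0// ?enorm_ge0// invr_ge0 ltW.
Qed.

Let integrable_weight : mu.-integrable setT (EFin \o weight).
Proof.
rewrite (_ : _ \o _ = fun z : V => (b%:E * (gauss z)%:E +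
    (t^-1 * a)%:E * (enorm z `^ 1 * gauss z)%:E)%E).
  apply: integrableD => //; apply: integrableZl => //; first exact: integrable_gauss.
  by apply: integrable_gauss_moment => //; lra.
apply/funext => z; rewrite -!EFinM -EFinD /= powRr1 ?enorm_ge0// /weight.
by congr EFin; ring.
Qed.

(** The entry ticket to Fubini. With [x] integrated first, Hoelder bounds the inner integral by
    [N * weight z] whatever the shift [s *: z], since the q-norm is translation invariant, and
    [weight] is integrable because the moments of order 0 and 1 are finite. *)
Let iH s : (mu \x mu)%E.-integrable setT (H s).
Proof.
apply/(integrable21ltyP mu mu (mH s)).
apply: (@le_lt_trans _ _ (\int[mu]_z (N%:E * (weight z)%:E))%E); last first.
  apply: integrable_lty => //; apply: integrableZl => //; exact: integrable_weight.
apply: ge0_le_integral => //.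
- by move=> z _; exact: integral_ge0.
- apply: (measurable_fun_fubini_tonelli_G (abse \o H s)).
    exact: measurableT_comp.
  by move=> xz; exact: abse_ge0.
- apply: emeasurable_funM => //; exact: measurable_int integrable_weight.
move=> z _; have mg := mG (s *: z) z.
have qg : (qnorm q (fun x : V => G (x + s *: z)%R z) < +oo)%E.
  by rewrite (le_lt_trans (qG _ _))// ltry.
under eq_integral do rewrite /H/= addrC.
rewrite (le_trans (pairing_le p_ge1 mf mg qg))// NE lee_wpmul2l ?lee_fin//.
Qed.

Let I := (\int[mu]_x (D x * f x)%:E)%E.

Let iDf : mu.-integrable setT (fun x => (D x * f x)%:E).
Proof.
under eq_fun do rewrite mulrC.
apply: (pairing_integrable p_ge1 fLp); first exact: smooth_measurable smooth_divergence.
exact: qnorm_divergence_lty.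
Qed.

Let F := (H 0 \- H t)%E.

Let iF : (mu \x mu)%E.-integrable setT F.
Proof. by apply: integrableB => //; exact: iH. Qed.

(** The part [H t] contributes 0 by the divergence identity. In [H 0] the argument of [Phi] no
    longer depends on [z], so the scalar product is odd in [z] and drops out, leaving [D x * f x]
    times the mass of the unnormalized [gauss], which is [(gauss_normalizer n)^-1]. *)
Let integral_F_first x :
  (\int[mu]_z F (x, z) = (gauss_normalizer n)^-1%:E * (D x * f x)%:E)%E.
Proof.
have iD : mu.-integrable setT (fun z => (D x * gauss z)%:E).
  by under eq_fun do rewrite EFinM; apply: integrableZl => //; exact: integrable_gauss.
have id : mu.-integrable setT (fun z => (t^-1%:E * (gauss z * dotr (Phi x) z)%:E)%E).
  by apply: integrableZl => //; exact: integrable_gauss_dotr.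
have [it int_t] := gauss_divergence_eq0 x t_gt0 tPhi.
have G0E : (fun z => (G (0 *: z + x) z)%:E) =
    ((fun z => (D x * gauss z)%:E) \- (fun z => t^-1%:E * (gauss z * dotr (Phi x) z)%:E))%E.
  apply/funext => z; rewrite /G /Psi scale0r add0r.
  rewrite -[RHS]/((D x * gauss z - t^-1 * (gauss z * dotr (Phi x) z))%:E).
  by congr EFin; ring.
have i0 : mu.-integrable setT (fun z => (G (0 *: z + x) z)%:E).
  by rewrite G0E; exact: integrableB.
have int0 : (\int[mu]_z (G (0 *: z + x) z)%:E = (gauss_normalizer n)^-1%:E * (D x)%:E)%E.
  rewrite (eq_integral ((fun z => (D x * gauss z)%:E) \- (fun z => t^-1%:E * (gauss z * dotr (Phi x) z)%:E))%E).
    rewrite integralB// integralZl//; last exact: integrable_gauss_dotr.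
    rewrite integral_gauss_dotr// mule0 sube0.
    under eq_integral do rewrite EFinM.
    rewrite integralZl//; last exact: integrable_gauss.
    rewrite integral_gauss muleC; congr (_%:E * _)%E.
    have c0 : gauss_normalizer n != 0 :> R by rewrite gt_eqF// gauss_normalizer_gt0.
    by apply: (mulfI c0); rewrite gauss_normalizerE mulfV.
  by move=> z _; exact: (congr1 (fun g => g z) G0E).
rewrite (eq_integral ((fun z => (f x)%:E * (G (0 *: z + x) z)%:E) \-
  (fun z => (f x)%:E * (G (t *: z + x) z)%:E))%E)//.
rewrite integralB//; [|exact: integrableZl|exact: integrableZl].
rewrite !integralZl// int_t mule0 sube0 int0 -!EFinM; congr EFin; ring.
Qed.

Let bound (z : V) : R := S * (t `^ alpha * enorm z `^ alpha) * weight z.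

(** A change of variables makes [G x z] a common factor of both terms, multiplied by a difference of
    translates of [f] at distance t |z|; Hoelder then combines [diffS] with [qG]. *)
Let integral_F_second z :
  (`| \int[mu]_x F (x, z) | <= (bound z)%:E)%E.
Proof.
have [y yE] : exists y, y = t *: z by exists (t *: z).
have q0 v : (qnorm q (fun x : V => G (x + v)%R z) < +oo)%E.
  by rewrite (le_lt_trans (qG _ _))// ltry.
have iv v : mu.-integrable setT (fun x => (f x * G (x + v) z)%:E).
  by apply: (pairing_integrable p_ge1 fLp); [exact: mG|exact: q0].
have msf : measurable_fun setT (translate y f).
  by apply: (measurableT_comp mf); exact: measurable_rV_shift.
have m0 := mG 0 z; have mt := mG y z.
have E : (\int[mu]_x F (x, z) = \int[mu]_x (- (translate y f \- f) x * G (x + 0)%R z)%:E)%E.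
  rewrite /F /=.
  rewrite (eq_integral ((fun x => (f x * G (x + 0) z)%:E) \- (fun x => (f x * G (x + y) z)%:E))%E); last first.
    by move=> x _; rewrite /= /H /= scale0r add0r addr0 -yE [y + x]addrC.
  rewrite integralB//.
  (* Replacing x by x - y takes f(x) G(x + y) to f(x - y) G(x): the shift passes from the test field
     to [f]. *)
  rewrite -(@integral_rV_shift _ _ (- y) (fun x => (f x * G (x + y) z)%:E)); last first.
    by apply/measurable_EFinP; exact: measurable_funM.
  rewrite -integralB//; last first.
    have := iv y; move=> /integrableP[miv].
    rewrite -(@integral_rV_shift _ _ (- y)); last exact: measurableT_comp.
    move=> fiv; apply/integrableP; split => //.
    exact: (measurableT_comp miv (measurable_rV_shift _)).
  apply: eq_integral => x _; rewrite /= /translate subrK addr0 -EFinB.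
  by congr EFin; ring.
rewrite E.
have md : measurable_fun setT (translate y f \- f) by exact: measurable_funB.
apply: (@le_trans _ _ (\int[mu]_x `|((translate y f \- f) x * G (x + 0)%R z)%:E|)%E).
  apply: le_trans (le_abse_integral _ _ _) _ => //.
    by apply/measurable_EFinP; apply: measurable_funM => //; exact: measurable_funN.
  by under eq_integral do rewrite mulNr EFinN abseN.
rewrite (le_trans (pairing_le p_ge1 md m0 (q0 0)))//.
rewrite /bound EFinM; apply: lee_pmul.
- exact: Lnorm_ge0.
- exact: qnorm_ge0.
- have := diffS y; rewrite /diff_norm => /le_trans; apply.
  by rewrite yE enormZ gtr0_norm// powRM ?enorm_ge0// ltW.
- exact: qG.
Qed.

Lemma smoothing_estimate :
  (\int[mu]_x (divergence Phi x * f x)%:E <=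
   (S * (t `^ alpha * fine (qnorm q (divergence Phi)) * fine (gauss_moment n alpha) +
         t `^ (alpha - 1) * fine (qnorm q (@enorm R n \o Phi)) *
           fine (gauss_moment n (1 + alpha))))%:E)%E.
Proof.
rewrite -/I -/a -/b.
have c0 : 0 < gauss_normalizer n :> R by exact: gauss_normalizer_gt0.
have IE : ((gauss_normalizer n)^-1%:E * I = \int[mu]_z \int[mu]_x F (x, z))%E.
  rewrite -(Fubini iF) -integralZl//.
  by apply: eq_integral => x _; rewrite integral_F_first.
have Ifin : I \is a fin_num by exact: integrable_fin_num.
have w1 : 0 < 1 + alpha <= 2 by move: alpha_gt0 alpha_le1; lra.
have w0 : 0 < alpha <= 2 by move: alpha_gt0 alpha_le1; lra.
(* Expanding [weight] against t^alpha |z|^alpha gives one moment of order alpha and, with t^alpha /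
   t = t^(alpha-1), one of order 1 + alpha. *)
have E : (\int[mu]_z (bound z)%:E = ((gauss_normalizer n)^-1 *
   (S * (t `^ alpha * b * fine (gauss_moment n alpha) +
         t `^ (alpha - 1) * a * fine (gauss_moment n (1 + alpha)))))%:E)%E.
  rewrite (eq_integral (fun z => (S * t `^ alpha * b)%:E * (enorm z `^ alpha * gauss z)%:E
     + (S * t `^ (alpha - 1) * a)%:E * (enorm z `^ (1 + alpha) * gauss z)%:E)%E); last first.
    move=> z _; rewrite -!EFinM -EFinD /bound /weight; congr EFin.
    rewrite [enorm z `^ (1 + alpha)]powRD; last by apply/implyP; rewrite gt_eqF// addr_gt0.
    rewrite powRr1 ?enorm_ge0// powRB; last by rewrite (gt_eqF t_gt0) implybT.
    rewrite powRr1 ?ltW//; field; rewrite gt_eqF//.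
  have i1 := integrable_gauss_moment n_gt0 w0.
  have i2 := integrable_gauss_moment n_gt0 w1.
  rewrite integralD//; [|exact: integrableZl|exact: integrableZl].
  rewrite !integralZl// !integral_gauss_momentE// -!EFinM -EFinD.
  by congr EFin; ring.
have bound_ge0 z : 0 <= bound z by rewrite mulr_ge0// mulr_ge0// mulr_ge0 ?powR_ge0.
have : (`| \int[mu]_z \int[mu]_x F (x, z) | <= \int[mu]_z (bound z)%:E)%E.
  have mk : measurable_fun setT (fun z => \int[mu]_x F (x, z))%E.
    exact: (measurable_fubini_G iF).
  apply: le_trans (le_abse_integral _ _ _) _ => //.
  apply: ge0_le_integral => //; first exact: measurableT_comp.
  apply/measurable_EFinP; apply: measurable_funM; last first.
    by have /measurable_EFinP := measurable_int _ integrable_weight.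
  by apply: measurable_funM => //; apply: measurable_funM => //; exact: measurable_enorm_powR.
have ci : 0 < (gauss_normalizer n)^-1 :> R by rewrite invr_gt0.
rewrite -IE E -(fineK Ifin) -EFinM /= lee_fin normrM (gtr0_norm ci) ler_pM2l//.
by rewrite lee_fin; apply: le_trans; exact: ler_norm.
Qed.

End smoothing_estimate.

(** * The choice of the scale t and its degenerate cases *)

Section upper_bound.
Context {R : realType} {n : nat}.
Local Notation V := 'rV[R]_n.
Local Notation mu := (lebesgue_rV (R := R) n).
Variables (n_gt0 : (0 < n)%N) (p alpha : R) (p_ge1 : 1 <= p).
Variables (alpha_gt0 : 0 < alpha) (alpha_le1 : alpha <= 1).
Variables (f : V -> R) (fLp : f \in Lfun mu p%:E).
Local Notation q := (hoelder_conjugate p%:E).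

Lemma enorm_gt0 (h : V) : h != 0 -> 0 < enorm h.
Proof.
move=> h0; rewrite lt_neqAle enorm_ge0 andbT eq_sym.
by apply: contra h0 => /eqP/enorm_eq0 ->.
Qed.

Lemma diff_norm0 : diff_norm p f 0 = 0%E.
Proof.
rewrite /diff_norm -[RHS](@Lnorm0 _ _ _ mu p%:E) ?eqe ?gt_eqF ?(lt_le_trans ltr01)//.
by apply: eq_Lnorm => x; rewrite /= /translate subr0 subrr.
Qed.

(** A supremum over the empty set would be -oo, so a nonzero [h] has to be exhibited; a basis vector
    exists because the dimension is positive. *)
Lemma holder_seminorm_ge0 : (0 <= holder_seminorm p alpha f)%E.
Proof.
have [i _] : exists i : 'I_n, True by exists (Ordinal n_gt0).
apply: ereal_sup_ge; exists ((enorm (@basis_vec R n i) `^ (- alpha))%:E *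
    diff_norm p f (basis_vec i))%E.
  exists (basis_vec i) => //=; apply/eqP => /rowP/(_ i).
  by rewrite !mxE !eqxx => /eqP; rewrite oner_eq0.
by rewrite mule_ge0 ?lee_fin ?powR_ge0// Lnorm_ge0.
Qed.

Lemma diff_norm_le (S : R) : (holder_seminorm p alpha f <= S%:E)%E ->
  forall h, (diff_norm p f h <= (S * enorm h `^ alpha)%:E)%E.
Proof.
move=> fS h; have [->|h0] := eqVneq h 0.
  by rewrite diff_norm0 enorm0 powR0 ?gt_eqF// mulr0.
have hp := enorm_gt0 h0.
have hpa : 0 < enorm h `^ alpha by exact: powR_gt0.
have : ((enorm h `^ (- alpha))%:E * diff_norm p f h <= S%:E)%E.
  by apply: le_trans fS; apply: ereal_sup_ubound; exists h.
have hE : (0 <= (enorm h `^ alpha)%:E)%E by rewrite lee_fin ltW.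
move=> /(lee_wpmul2l hE); rewrite muleA -EFinM powRN divff ?gt_eqF// mul1e.
by rewrite -EFinM mulrC.
Qed.

Lemma holder_seminorm_le (S : R) :
  (forall h, (diff_norm p f h <= (S * enorm h `^ alpha)%:E)%E) ->
  (holder_seminorm p alpha f <= S%:E)%E.
Proof.
move=> HS; apply: ge_ereal_sup => _ [h h0 <-].
have hp := enorm_gt0 h0.
have hpa : 0 < enorm h `^ alpha by exact: powR_gt0.
rewrite (le_trans (lee_wpmul2l _ (HS h))) ?lee_fin ?powR_ge0//.
by rewrite powRN mulrCA mulVf ?mulr1// gt_eqF.
Qed.

Lemma Vvar_le_gauss :
  (Vvar p alpha f <= gauss_const n alpha * holder_seminorm p alpha f)%E.
Proof.
have a01 : 0 < alpha <= 1 by rewrite alpha_gt0.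
have /andP[c0 cle] := gauss_const_bounds n_gt0 a01.
(* If the seminorm is +oo, so is the right-hand side, because [gauss_const] is positive. *)
have := holder_seminorm_ge0; case E : (holder_seminorm p alpha f) => [S| |] //; last first.
  by move=> _; rewrite gt0_muley// leey.
rewrite lee_fin => S0.
have diffS := diff_norm_le (eq_ind_r (fun x => (x <= S%:E)%E) (lexx S%:E) E).
pose m1 := fine (gauss_moment n alpha); pose m2 := fine (gauss_moment n (1 + alpha)).
have w0 : 0 < alpha <= 2 by rewrite alpha_gt0/=; move: alpha_le1; lra.
have w1 : 0 < 1 + alpha <= 2 by rewrite addr_gt0//=; move: alpha_le1; lra.
have m10 : 0 <= m1 by rewrite fine_ge0// gauss_moment_ge0.
have m20 : 0 <= m2 by rewrite fine_ge0// gauss_moment_ge0.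
have -> : gauss_const n alpha = (m1 + m2)%:E.
  by rewrite gauss_constE EFinD !fineK//; exact: gauss_moment_fin.
apply: ereal_inf_lbound; exists ((m1 + m2) * S) => //.
split; first by rewrite mulr_ge0// addr_ge0.
move=> Phi tPhi.
have qa := qnorm_field_lty p_ge1 tPhi; have qb := qnorm_divergence_lty p_ge1 tPhi.
have sm := smoothing_estimate n_gt0 p_ge1 alpha_gt0 alpha_le1 S0 fLp diffS tPhi.
have mf : measurable_fun setT f by move: fLp; rewrite inE => /andP[/[!inE]].
have pair := pairing_le p_ge1 mf (smooth_measurable (smooth_divergence tPhi)) qb.
have intI := pairing_integrable p_ge1 fLp (smooth_measurable (smooth_divergence tPhi)) qb.
set I := (\int[mu]_x _)%E in sm *.
have IE : I = (\int[mu]_x (f x * divergence Phi x)%:E)%E.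
  by apply: eq_integral => x _; rewrite mulrC.
have Ifin : I \is a fin_num by rewrite IE; exact: integrable_fin_num.
have Ile : (I <= 'N[mu]_p%:E[EFin \o f] * qnorm q (divergence Phi))%E.
  rewrite (le_trans _ pair)// IE (le_trans (lee_abs _))//.
  by apply: le_abse_integral => //; exact: measurable_int intI.
have a0 : (0 <= qnorm q (@enorm R n \o Phi))%E by exact: qnorm_ge0.
have b0 : (0 <= qnorm q (divergence Phi))%E by exact: qnorm_ge0.
have aE : qnorm q (@enorm R n \o Phi) \is a fin_num by rewrite ge0_fin_numE.
have bE : qnorm q (divergence Phi) \is a fin_num by rewrite ge0_fin_numE.
have [a aQ] : exists a : R, qnorm q (@enorm R n \o Phi) = a%:E.
  by exists (fine (qnorm q (@enorm R n \o Phi))); rewrite fineK.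
have [b bQ] : exists b : R, qnorm q (divergence Phi) = b%:E.
  by exists (fine (qnorm q (divergence Phi))); rewrite fineK.
have [J JQ] : exists J : R, I = J%:E by exists (fine I); rewrite fineK.
move: sm Ile a0 b0; rewrite aQ bQ JQ /= => sm Ile; rewrite !lee_fin => a0 b0.
change (J <= (m1 + m2) * S * a `^ alpha * b `^ (1 - alpha)).
(* For a vanishing divergence the quotient a / b makes no sense; here Hoelder's bound [Ile] already
   gives J <= 0. *)
have [b_eq0|bN0] := eqVneq b 0.
  move: Ile; rewrite b_eq0 mule0 lee_fin => /le_trans; apply.
  by rewrite !mulr_ge0 ?powR_ge0// addr_ge0.
have bp : 0 < b by rewrite lt_neqAle eq_sym bN0.
(* With a = 0 the estimate reads J <= S t^alpha b m1 for all t > 0 and forces J <= 0 as t tends to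
   0. Concretely, t^alpha = J / K with K larger than S b m1 contradicts J > 0. *)
have [a_eq0|aN0] := eqVneq a 0.
  rewrite a_eq0 powR0 ?gt_eqF// mulr0 mul0r leNgt; apply/negP => J0.
  pose K := S * b * m1 + 1.
  have K0 : 0 < K by rewrite ltr_wpDl// !mulr_ge0// ltW.
  pose t := (J / K) `^ alpha^-1.
  have t0 : 0 < t by rewrite powR_gt0// divr_gt0.
  have ta : t `^ alpha = J / K.
    by rewrite -powRrM mulVf ?gt_eqF// powRr1// ltW// divr_gt0.
  have := sm t t0; rewrite a_eq0 mulr0 mul0r addr0 ta lee_fin leNgt => /negP; apply.
  rewrite [ltLHS](_ : _ = J * ((S * b * m1) / K)); last by rewrite /m1; ring.
  by rewrite gtr_pMr// ltr_pdivrMr// mul1r ltrDl.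
have ap : 0 < a by rewrite lt_neqAle eq_sym aN0.
(* This scale balances the two terms: t^alpha b = t^(alpha-1) a = a^alpha b^(1-alpha). *)
pose t := a / b; have t0 : 0 < t by rewrite divr_gt0.
have aE' : a = t * b by rewrite divfK.
have X : a `^ alpha * b `^ (1 - alpha) = t `^ alpha * b.
  rewrite {1}aE' powRM ?ltW// -mulrA -powRD; last by rewrite bN0 implybT.
  by rewrite addrC subrK powRr1// ltW.
have Y : t `^ (alpha - 1) * a = t `^ alpha * b.
  by rewrite aE' mulrA [_ * t]mulrC mulr_powRB1// ltW.
have := sm t t0; rewrite lee_fin => /le_trans; apply.
rewrite -[leRHS]mulrA X Y; rewrite -/m1 -/m2 le_eqVlt; apply/orP; left; apply/eqP; ring.
Qed.

End upper_bound.

(** * Directional test functions as special vector fields *)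

Section directional_variation.
Context {R : realType} {n : nat}.
Local Notation V := 'rV[R]_n.

(** The field [phi x *: e] has divergence ['D_e phi] and Euclidean norm |phi|, so every constant
    admissible for [Vvar] is admissible for [Vvar0], and the infimum is over a larger set. *)
Lemma Vvar0_le_Vvar (p alpha : R) (f : V -> R) : 1 <= p ->
  (Vvar0 p alpha f <= Vvar p alpha f)%E.
Proof.
move=> p1; apply: le_ereal_inf => _ [C [C0 HC] <-]; exists C => //; split => // phi e tphi e1.
have [sphi [M phiM]] := (test_functionP phi).1 tphi.
pose Phi (x : V) : V := phi x *: e.
have PhiE i : (fun x => Phi x ord0 i) = fun x => e ord0 i * phi x.
  by apply/funext => x; rewrite mxE mulrC.
have tPhi : test_field Phi.
  apply/test_fieldP; split; first by move=> i; rewrite PhiE; exact: smoothZ.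
  by exists M => x /phiM; rewrite /Phi => ->; rewrite scale0r.
have divE : divergence Phi = 'D_e phi.
  rewrite smooth_deriveE//; apply/funext => x; apply: eq_bigr => i _.
  rewrite PhiE (_ : (fun _ => _) = e ord0 i \*: phi)// deriveZ//.
  exact: smooth_derivable.
have enE x : (enorm \o Phi) x = `|phi x| by rewrite /= enormZ e1 mulr1.
have mphi := smooth_measurable sphi.
have men : measurable_fun setT (@enorm R n \o Phi).
  by rewrite (funext enE); exact: measurableT_comp.
have qE : qnorm (hoelder_conjugate p%:E) (@enorm R n \o Phi) =
    qnorm (hoelder_conjugate p%:E) phi.
  by apply/eqP; rewrite eq_le !qnorm_le// => x; rewrite enE normr_id.
by have := HC Phi tPhi; rewrite divE qE.
Qed.

End directional_variation.

(** * Density of test functions *)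

Section flat_function.
Context {R : realType}.
Implicit Types (p : {poly R}) (t : R).

(* The functions p(1/t) exp(-1/t) form a class stable under derivation, which
   makes their smoothness an instance of smooth_coind. *)
Definition flat p t : R := if 0 < t then p.[t^-1] * expR (- t^-1) else 0.

(** The term u^k / k! of the exponential series bounds exp(u) from below, so C = k! works for k >
    0. *)
Lemma powR_expR_bound (k : nat) : exists2 C : R, 0 <= C &
  forall u : R, 0 < u -> u ^+ k * expR (- u) <= C.
Proof.
case: k => [|k].
  exists 1 => // u u0; rewrite expr0 mul1r -expR0 ler_expR oppr_le0 ltW//.
exists (k.+1)`!%:R => // u u0.
rewrite expRN ler_pdivrMr ?expR_gt0//.
have := expR_ge1Dxn k (ltW u0); set F := k.+1`!%:R.
have F0 : 0 < F :> R by rewrite ltr0n fact_gt0.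
move=> H; rewrite mulrC -ler_pdivrMr//; apply: le_trans H.
by rewrite lerDr.
Qed.

Lemma poly_expR_bound p : exists2 C : R, 0 <= C &
  forall u : R, 0 < u -> `|p.[u]| * expR (- u) <= C.
Proof.
have /choice[C HC] : forall k : nat, exists C : R, 0 <= C /\
    forall u : R, 0 < u -> u ^+ k * expR (- u) <= C.
  by move=> k; have [C C0 HC] := powR_expR_bound k; exists C.
exists (\sum_(i < size p) `|p`_i| * C i).
  by apply: sumr_ge0 => i _; rewrite mulr_ge0//; have [] := HC i.
move=> u u0; rewrite horner_coef.
rewrite (le_trans (ler_wpM2r (expR_ge0 _) (ler_norm_sum _ _ _)))// mulr_suml.
apply: ler_sum => i _; rewrite normrM normrX (gtr0_norm u0) -mulrA ler_wpM2l//.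
by have [_] := HC i; exact.
Qed.

(** The polynomial bound for p X^2 at 1/t. Quadratic decay at 0 is what makes the difference
    quotient at the origin, the delicate case of [is_derive_flat], tend to 0. *)
Lemma flat_le_sqr p : exists2 C : R, 0 <= C & forall t, `|flat p t| <= C * t ^+ 2.
Proof.
have [C C0 HC] := poly_expR_bound (p * 'X^2).
exists C => // t; rewrite /flat; case: ifPn => [t0|_]; last first.
  by rewrite normr0 mulr_ge0 ?sqr_ge0.
have := HC t^-1; rewrite invr_gt0 => /(_ t0).
rewrite hornerM hornerXn normrM [`|t^-1 ^+ 2|]ger0_norm ?sqr_ge0//.
rewrite normrM (ger0_norm (expR_ge0 _)) mulrAC exprVn ler_pdivrMr//.
by rewrite exprn_gt0.
Qed.

(** For t > 0 the factor p(1/t) contributes -p'(1/t) / t^2 and the exponential contributes p(1/t) /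
    t^2; the common factor 1/t^2 is X^2 evaluated at 1/t. *)
Lemma is_derive_flat p t : is_derive t (1 : R) (flat p) (flat ('X^2 * (p - p^`())) t).
Proof.
have [t0|t0|->] := ltgtP t 0.
- rewrite [X in is_derive _ _ _ X](_ : _ = 0); last by rewrite /flat ltNge ltW.
  apply: (near_eq_is_derive (f := cst 0)).
  by near=> s; rewrite /flat ltNge ltW//; near: s; exact: lt_nbhsl.
- have tN0 : t != 0 by rewrite gt_eqF.
  have dV : is_derive t (1 : R) (fun s : R => s^-1) (- t ^- 2).
    by have := is_deriveV tN0 (is_derive_id t (1 : R)); rewrite [_ *: 1]mulr1.
  have dp : is_derive t (1 : R) (fun s => p.[s^-1]) (p^`().[t^-1] * - t ^- 2).
    apply: (@is_derive1_comp _ (horner p) (fun s : R => s^-1)).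
  have dN : is_derive t (1 : R) (fun s : R => - s^-1) (t ^- 2).
    by rewrite -[t ^- 2]opprK; exact: is_deriveN.
  have de : is_derive t (1 : R) (fun s => expR (- s^-1)) (expR (- t^-1) * t ^- 2).
    exact: (@is_derive1_comp _ expR (fun s : R => - s^-1)).
  apply: (near_eq_is_derive (f := (fun s => p.[s^-1]) * (fun s => expR (- s^-1)))).

  + by near=> s; rewrite /flat ifT//; near: s; exact: lt_nbhsr.
  apply: (is_derive_eq (is_deriveM dp de)).
  rewrite /flat t0 hornerM hornerXn hornerD hornerN /GRing.scale/= exprVn.
  by ring.
rewrite [X in is_derive _ _ _ X](_ : _ = 0); last by rewrite /flat ltxx.
have [C C0 HC] := flat_le_sqr p.
apply/is_deriveP; apply/cvgrPdist_le => e e0; near=> h.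
have h0 : h != 0 by near: h; exact: nbhs_dnbhs_neq.
rewrite [h *: 1]mulr1 addr0 [flat p 0](_ : _ = 0) ?subr0; last by rewrite /flat ltxx.
rewrite sub0r normrN normrM normrV ?unitfE// mulrC ler_pdivrMr ?normr_gt0//.
rewrite (le_trans (HC h))// -real_normK ?num_real// expr2 mulrA ler_wpM2r//.
rewrite (@le_trans _ _ ((C + 1) * `|h|))//; first by rewrite ler_wpM2r// lerDl.
rewrite mulrC -ler_pdivlMr ?ltr_wpDl//.
by near: h; apply: dnbhs0_le; rewrite divr_gt0// ltr_wpDl.
Unshelve. all: by end_near. Qed.

Lemma continuous_flat p : continuous (flat p).
Proof.
by move=> t; apply/differentiable_continuous/derivable1_diffP; case: (is_derive_flat p t).
Qed.

(** The classical function exp(-1/t). Its dilations [flat_step (k * t)] tend to the indicator of t >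
    0, so it serves both to approximate half-spaces and to build cutoffs. *)
Definition flat_step (t : R) : R := flat 1 t.

Lemma flat_stepE t : flat_step t = if 0 < t then expR (- t^-1) else 0.
Proof. by rewrite /flat_step /flat hornerC mul1r. Qed.

Lemma flat_step_ge0 t : 0 <= flat_step t.
Proof. by rewrite flat_stepE; case: ifP => // _; exact: expR_ge0. Qed.

Lemma flat_step_le1 t : flat_step t <= 1.
Proof.
rewrite flat_stepE; case: ifP => // t0.
by rewrite expR_le1 oppr_le0 invr_ge0 ltW.
Qed.

Lemma flat_step_le0 t : t <= 0 -> flat_step t = 0.
Proof. by rewrite flat_stepE ltNge => ->. Qed.

Lemma flat_step_cvg t : 0 < t -> flat_step (k.+1%:R * t) @[k --> \oo] --> (1 : R).
Proof.
move=> t0.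
rewrite (_ : (fun k : nat => _) = fun k : nat => expR (- (k.+1%:R^-1 * t^-1))); last first.
  apply/funext => k; rewrite flat_stepE mulr_gt0// invfM//.
have : - (k.+1%:R^-1 * t^-1) @[k --> \oo] --> (0 : R).
  rewrite -[X in _ --> X]oppr0 -[X in _ --> - X](mul0r t^-1).
  by apply: cvgN; apply: cvgMl; exact: cvg_harmonic.
move=> H; rewrite -[X in _ --> X](@expR0 R).
exact: (cvg_comp _ _ H (@continuous_expR R 0)).
Qed.

Lemma smooth_flat_coord n (i : 'I_n) (p : {poly R}) (c b : R) :
  smooth (fun x : 'rV[R]_n => flat p (c * x ord0 i + b)).
Proof.
(* The scalar [d] absorbs the constants produced by the chain rule for the affine inner function;
   the polynomial changes at each derivative, so both are quantified. *)
apply: (smooth_coind (P := fun g => exists p (d : R),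
  g = fun x : 'rV[R]_n => d * flat p (c * x ord0 i + b))); last first.
  by exists p, 1; apply/funext => x; rewrite mul1r.
move=> _ [{}p [d ->]].
have dc (x v : 'rV[R]_n) : is_derive x v (fun x : 'rV[R]_n => c * x ord0 i + b) (c * v ord0 i).
  apply/is_derive_line0P.
  rewrite (_ : (fun t : R => _) =
      (c * v ord0 i) \*: (id : R -> R) + cst (c * x ord0 i + b)); last first.
    apply/funext => t; rewrite -[RHS]/(c * v ord0 i * t + (c * x ord0 i + b)) !mxE.
    by ring.
  by apply: is_derive_eq; rewrite addr0 [_ *: 1]mulr1.
have df (x v : 'rV[R]_n) :
    is_derive x v (fun x : 'rV[R]_n => d * flat p (c * x ord0 i + b))
      (d * (flat ('X^2 * (p - p^`())) (c * x ord0 i + b) * (c * v ord0 i))).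
  have := @is_derive_comp _ _ (fun x : 'rV[R]_n => c * x ord0 i + b) _ _ _ _ _
    (is_derive_flat p (c * x ord0 i + b)) (dc x v).
  exact: is_deriveZ.
split.
  move=> x; apply: (@continuousM _ _ (cst d) (fun x : 'rV[R]_n => flat p (c * x ord0 i + b))).
    exact: cst_continuous.
  apply: (@continuous_comp _ _ _ (fun x : 'rV[R]_n => c * x ord0 i + b) (flat p)).
    apply: continuousD; last exact: cst_continuous.
    by apply: continuousM; [exact: cst_continuous|exact: coord_continuous].
  exact: continuous_flat.
move=> j; split => [x|]; first by case: (df x (basis_vec j)).
exists ('X^2 * (p - p^`())), (d * (c * @basis_vec R n j ord0 i)).
by apply/funext => x; rewrite (@derive_val _ _ _ _ _ _ _ (df x (basis_vec j))); ring.
Qed.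

End flat_function.

(** * Approximation of measurable functions in a weighted L^1 space *)

Section weighted_density.
Context {R : realType} {n : nat}.
Local Notation V := 'rV[R]_n.
Local Notation mu := (lebesgue_rV (R := R) n).
Variable w : V -> R.
Hypotheses (w_ge0 : forall x, 0 <= w x) (iw : mu.-integrable setT (EFin \o w)).
Implicit Types (u v h : V -> R).

Let mw : measurable_fun setT w.
Proof. by have /measurable_EFinP := measurable_int _ iw. Qed.

(** The L^1 seminorm for the finite measure [w] d[mu]: finiteness lets bounded pointwise convergence
    imply convergence here. *)
Definition wnorm h : \bar R := (\int[mu]_x (`|h x| * w x)%:E)%E.

Let wnorm_integrand h : measurable_fun setT h ->
  measurable_fun setT (fun x => (`|h x| * w x)%:E).
Proof.
by move=> mh; apply/measurable_EFinP/measurable_funM => //; exact: measurableT_comp.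
Qed.

Lemma wnorm_le_add h h1 h2 : measurable_fun setT h -> measurable_fun setT h1 ->
  measurable_fun setT h2 -> (forall x, `|h x| <= `|h1 x| + `|h2 x|) ->
  (wnorm h <= wnorm h1 + wnorm h2)%E.
Proof.
move=> mh mh1 mh2 hh; rewrite /wnorm -ge0_integralD//; last 4 first.
- by move=> x _; rewrite lee_fin mulr_ge0.
- exact: wnorm_integrand.
- by move=> x _; rewrite lee_fin mulr_ge0.
- exact: wnorm_integrand.
apply: ge0_le_integral => //.
- by move=> x _; rewrite lee_fin mulr_ge0.
- exact: wnorm_integrand.
- by apply: emeasurable_funD; exact: wnorm_integrand.
by move=> x _; rewrite -EFinD lee_fin -mulrDl ler_wpM2r.
Qed.

Lemma eq_wnorm h1 h2 : (forall x, `|h1 x| = `|h2 x|) -> wnorm h1 = wnorm h2.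
Proof. by move=> hh; apply: eq_integral => x _; rewrite hh. Qed.

Lemma wnorm_cvg0 (h : nat -> V -> R) : (forall k, measurable_fun setT (h k)) ->
  (forall k x, `|h k x| <= 1) -> (forall x, h k x @[k --> \oo] --> (0 : R)) ->
  forall e : R, 0 < e -> exists k, (wnorm (h k) <= e%:E)%E.
Proof.
move=> mh h1 h0 e e0.
have := @dominated_convergence _ _ _ mu setT measurableT
  (fun k x => (`|h k x| * w x)%:E) (cst 0%E) (EFin \o w).
case.
- by move=> k; exact: wnorm_integrand.
- exact: measurable_cst.
- apply/aeW => x _; apply/cvg_EFin; first by near=> k.
  rewrite -[X in _ --> X](mul0r (w x)); apply: cvgMl; apply/norm_cvg0P.
  exact: h0.
- exact: iw.
- apply/aeW => x k _; rewrite lee_fin ger0_norm ?mulr_ge0//.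
  by rewrite -[leRHS]mul1r ler_wpM2r.
move=> _ _; rewrite integral0 => H.
have : \forall k \near \oo, (wnorm (h k) < e%:E)%E.
  by apply: (H [set x : \bar R | (x < e%:E)%E]); apply: open_ereal_lt'; rewrite lte_fin.
by case=> k _ /(_ k (leqnn k)) /ltW; exists k.
Unshelve. all: by end_near. Qed.

(** The range [0, 1] is part of the definition: it keeps products of approximants under control and,
    later, their supremum norm bounded by 1, as the case p = 1 demands. *)
Definition smooth_approx u : Prop := forall e : R, 0 < e ->
  exists phi, [/\ smooth phi, forall x, 0 <= phi x <= 1 &
                  (wnorm (fun x => phi x - u x)%R <= e%:E)%E].

Lemma smooth_approx_smooth phi : smooth phi -> (forall x, 0 <= phi x <= 1) ->
  smooth_approx phi.
Proof.
move=> sphi phi01 e e0; exists phi; split => //.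
rewrite (eq_wnorm (h2 := cst 0)) /wnorm; last by move=> x; rewrite subrr.
by under eq_integral do rewrite normr0 mul0r; rewrite integral0 lee_fin ltW.
Qed.

Lemma smooth_approx_compl u : smooth_approx u -> smooth_approx (fun x => 1 - u x).
Proof.
move=> Hu e e0; have [phi [sphi phi01 phiu]] := Hu e e0.
exists (fun x => 1 - phi x); split.
- rewrite (_ : (fun x => _) = fun x => 1 * 1 + (-1) * phi x).
    by apply: (smooth_linear 1 (-1)) sphi; exact: (smooth_cst 1).
  by apply/funext => x; rewrite mulr1 mulN1r.
- by move=> x; have := phi01 x; lra.
- rewrite (eq_wnorm (h2 := fun x => phi x - u x))// => x.
  by rewrite -normrN; congr (`| _ |); ring.
Qed.

Lemma smooth_approx_mul u v : measurable_fun setT u -> measurable_fun setT v ->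
  (forall x, 0 <= u x <= 1) -> (forall x, 0 <= v x <= 1) ->
  smooth_approx u -> smooth_approx v -> smooth_approx (fun x => u x * v x).
Proof.
move=> mu_ mv u01 v01 Hu Hv e e0; have e20 : 0 < e / 2 by rewrite divr_gt0.
have [phi [sphi phi01 phiu]] := Hu _ e20; have [psi [spsi psi01 psiv]] := Hv _ e20.
have mphi := smooth_measurable sphi; have mpsi := smooth_measurable spsi.
exists (fun x => phi x * psi x); split; first exact: smoothM.
  by move=> x; have := phi01 x; have := psi01 x; nra.
rewrite [e]splitr EFinD (le_trans _ (leeD phiu psiv))//; apply: wnorm_le_add.
- by apply: measurable_funB; exact: measurable_funM.
- exact: measurable_funB.
- exact: measurable_funB.
move=> x; rewrite (_ : _ - _ = (phi x - u x) * psi x + u x * (psi x - v x)); last by ring.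
rewrite (le_trans (ler_normD _ _))// !normrM lerD//.
  by rewrite ler_piMr// ler_norml; have := psi01 x; lra.
by rewrite ler_piMl// ler_norml; have := u01 x; lra.
Qed.

Lemma smooth_approx_lim (u_ : nat -> V -> R) u :
  (forall k, measurable_fun setT (u_ k)) -> measurable_fun setT u ->
  (forall k x, 0 <= u_ k x <= 1) -> (forall x, 0 <= u x <= 1) ->
  (forall x, u_ k x @[k --> \oo] --> u x) ->
  (forall k, smooth_approx (u_ k)) -> smooth_approx u.
Proof.
move=> mu_ m u_01 u01 cu Hu e e0; have e20 : 0 < e / 2 by rewrite divr_gt0.
have [k Hk] : exists k, (wnorm (fun x => (u_ k x - u x)%R)%R <= (e / 2)%:E)%E.
  apply: (wnorm_cvg0 (h := fun k x => u_ k x - u x)) => //.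
  - by move=> k; exact: measurable_funB.
  - by move=> k x; rewrite ler_norml; have := u_01 k x; have := u01 x; lra.
  - by move=> x; rewrite -(subrr (u x)); apply: cvgB; [exact: cu|exact: cvg_cst].
have [phi [sphi phi01 phiu]] := Hu k _ e20; exists phi; split => //.
rewrite [e]splitr EFinD (le_trans _ (leeD phiu Hk))//; apply: wnorm_le_add.
- by apply: measurable_funB => //; exact: smooth_measurable.
- by apply: measurable_funB => //; exact: smooth_measurable.
- exact: measurable_funB.
move=> x; rewrite (_ : _ - _ = (phi x - u_ k x) + (u_ k x - u x)); last by ring.
exact: ler_normD.
Qed.

Lemma smooth_approx_avg (N : nat) (u_ : nat -> V -> R) :
  (forall k, measurable_fun setT (u_ k)) ->
  (forall k, smooth_approx (u_ k)) ->
  smooth_approx (fun x => N.+1%:R^-1 * \sum_(j < N.+1) u_ j x).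
Proof.
move=> mu_ Hu e e0; have /choice[phi Hphi] := fun k => Hu k e e0.
have N0 : 0 < N.+1%:R :> R by rewrite ltr0n.
have Ni0 : 0 <= N.+1%:R^-1 :> R by rewrite invr_ge0 ltW.
exists (fun x => N.+1%:R^-1 * \sum_(j < N.+1) phi j x); split.
- apply: smoothZ; apply: smooth_sum => j; by have [] := Hphi j.
- move=> x; apply/andP; split.
    apply: mulr_ge0 => //; apply: sumr_ge0 => j _.
    by have [_ /(_ x)/andP[]] := Hphi j.
  rewrite mulrC ler_pdivrMr// mul1r.
  rewrite -[leRHS](_ : \sum_(j < N.+1) 1 = _); last by rewrite sumr_const card_ord.
  by apply: ler_sum => j _; have [_ /(_ x)/andP[]] := Hphi j.
have mphi k : measurable_fun setT (phi k).
  by have [s _ _] := Hphi k; exact: smooth_measurable.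
have H m : (wnorm (fun x => (\sum_(j < m) (phi j x - u_ j x))%R)%R <= (m%:R * e)%:E)%E.
  elim: m => [|m IH].
    rewrite mul0r (eq_wnorm (h2 := cst 0)); last by move=> x; rewrite big_ord0.
    by rewrite /wnorm; under eq_integral do rewrite normr0 mul0r; rewrite integral0.
  rewrite -natr1 mulrDl mul1r EFinD.
  have [_ _ Hm] := Hphi m.
  rewrite (le_trans _ (leeD IH Hm))//; apply: wnorm_le_add.
  + by apply: measurable_sum => j; exact: measurable_funB.
  + by apply: measurable_sum => j; exact: measurable_funB.
  + exact: measurable_funB.
  + by move=> x; rewrite big_ord_recr ler_normD.
have -> : wnorm (fun x => N.+1%:R^-1 * \sum_(j < N.+1) phi j x -
    N.+1%:R^-1 * \sum_(j < N.+1) u_ j x) =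
    (N.+1%:R^-1%:E * wnorm (fun x => (\sum_(j < N.+1) (phi j x - u_ j x))%R))%E.
  rewrite /wnorm -ge0_integralZl//.
  - apply: eq_integral => x _; rewrite -EFinM -mulrBr -sumrB normrM.
    by rewrite (ger0_norm Ni0) mulrA.
  - apply: wnorm_integrand; apply: measurable_sum => j; exact: measurable_funB.
  - by move=> x _; rewrite lee_fin mulr_ge0.
rewrite (le_trans (lee_wpmul2l _ (H N.+1))) ?lee_fin//.
by rewrite mulrA mulVf ?mul1r// gt_eqF.
Qed.

(* These sets form a sigma-algebra containing the half-spaces x_i > a. *)
Definition approx_set (A : set V) := measurable A /\ smooth_approx (\1_A : V -> R).

Lemma indic01 (A : set V) x : 0 <= (\1_A x : R) <= 1.
Proof. by rewrite indicE; case: (x \in A); rewrite /= ?lexx ler01. Qed.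

Lemma smooth_approx1 : smooth_approx (cst 1).
Proof.
by apply: smooth_approx_smooth => [|x]; [exact: (smooth_cst 1)|rewrite /= lexx ler01].
Qed.

Lemma approx_setC A : approx_set A -> approx_set (~` A).
Proof.
move=> [mA sA]; split; first exact: measurableC.
rewrite (_ : \1_(~` A) = fun x => 1 - \1_A x); first exact: smooth_approx_compl.
by apply/funext => x; rewrite !indicE in_setC; case: (x \in A); rewrite /= ?subrr ?subr0.
Qed.

Lemma approx_set0 : approx_set set0.
Proof.
rewrite -setCT; apply: approx_setC; split; first exact: measurableT.
by rewrite indicT; exact: smooth_approx1.
Qed.

Lemma approx_set_bigsetU (F : nat -> set V) k : (forall i, approx_set (F i)) ->
  approx_set (\big[setU/set0]_(i < k) F i).
Proof.
move=> HF; elim: k => [|k [mk sk]]; first by rewrite big_ord0; exact: approx_set0.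
have [mF sF] := HF k.
rewrite big_ord_recr /= -[X in approx_set X]setCK setCU; apply: approx_setC.
have [mk' sk'] := approx_setC (conj mk sk); have [mF' sF'] := approx_setC (conj mF sF).
split; first exact: measurableI.
rewrite (_ : \1_(_ `&` _) = fun x => \1_(~` \big[setU/set0]_(i < k) F i) x * \1_(~` F k) x).
  by apply: smooth_approx_mul => // x; exact: indic01.
by apply/funext => x; rewrite !indicE in_setI -natrM mulnb.
Qed.

Lemma approx_set_bigcup (F : nat -> set V) : (forall i, approx_set (F i)) ->
  approx_set (\bigcup_i F i).
Proof.
move=> HF; have mF i : measurable (F i) by have [] := HF i.
split; first exact: bigcup_measurable.
apply: (smooth_approx_lim (u_ := fun k => \1_(\big[setU/set0]_(i < k) F i))).
- move=> k; apply: measurable_indic; exact: bigsetU_measurable.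
- by apply: measurable_indic; exact: bigcup_measurable.
- by move=> k x; exact: indic01.
- by move=> x; exact: indic01.
- move=> x; apply: cvg_near_cst.
  have [[i _ Fi]|nF] := pselect ((\bigcup_i F i) x).
    exists i.+1 => // k /= ik; rewrite !indicE !mem_set//; first by exists i.
    by rewrite -bigcup_mkord; exists i.
  apply: nearW => k; rewrite !indicE !memNset// -bigcup_mkord => -[i _ Fi].
  by apply: nF; exists i.
by move=> k; have [] := approx_set_bigsetU k HF.
Qed.

(** The indicator is the pointwise limit of steeper and steeper [flat_step]; on the boundary all of
    them vanish, in agreement with the strict inequality. *)
Lemma approx_set_ray i (a : R) : approx_set [set x : V | a < x ord0 i].
Proof.
have E (k : nat) (x : V) : flat_step (k.+1%:R * (x ord0 i - a)) =
    flat 1 (k.+1%:R * x ord0 i + - (k.+1%:R * a)) by rewrite mulrBr.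
have sb (k : nat) : smooth (fun x : V => flat_step (k.+1%:R * (x ord0 i - a))).
  by under eq_fun do rewrite E; exact: smooth_flat_coord.
have mA : measurable [set x : V | a < x ord0 i].
  rewrite (_ : mkset _ = @rV_coord R n i @^-1` `]a, +oo[%classic); last first.
    by apply/seteqP; split => x /=; rewrite in_itv/= andbT.
  by rewrite -[X in measurable X]setTI; apply: measurable_rV_coord.
split => //; apply: (smooth_approx_lim (u_ := fun k x => flat_step (k.+1%:R * (x ord0 i - a)))).
- by move=> k; exact: smooth_measurable.
- by apply: measurable_indic.
- by move=> k x; rewrite flat_step_ge0 flat_step_le1.
- by move=> x; exact: indic01.
- move=> x; rewrite indicE; have [ax|xa] := ltP a (x ord0 i).
    by rewrite mem_set//; apply: flat_step_cvg; rewrite subr_gt0.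
  rewrite memNset /=; last by rewrite ltNge xa.
  apply: cvg_near_cst; apply: nearW => k; apply: flat_step_le0.
  by rewrite mulr_ge0_le0// subr_le0.
by move=> k; apply: smooth_approx_smooth => // x; rewrite flat_step_ge0 flat_step_le1.
Qed.

(** Two nested generation arguments: measurable sets of R^n are generated by coordinate preimages of
    Borel sets of R, and these in turn by open rays. *)
Lemma approx_set_measurable (A : set V) : measurable A -> approx_set A.
Proof.
move: A; apply: smallest_sub.
  split => /=; first exact: approx_set0.
  - by move=> A /approx_setC; rewrite setTD.
  - exact: approx_set_bigcup.
rewrite -bigcup_seq => B [i _ [C mC <-]] /=; rewrite setTI.
suff H : measurable `<=` [set D : set (measurableTypeR R) | approx_set (rV_coord i @^-1` D)].
  exact: H.
rewrite RGenOInfty.measurableE; apply: smallest_sub.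
  split => /=; first by rewrite preimage_set0; exact: approx_set0.
  - by move=> D /approx_setC; rewrite setTD preimage_setC.
  - by move=> F HF; rewrite preimage_bigcup; exact: approx_set_bigcup.
move=> _ [a ->] /=; rewrite (_ : _ @^-1` _ = [set x : V | a < x ord0 i]).
  exact: approx_set_ray.
by apply/seteqP; split => x /=; rewrite in_itv/= andbT.
Qed.

(* With y = N u(x) this makes u a uniform limit of averages of indicators of
   its superlevel sets. *)
Lemma count_below N (y : R) : 0 <= y -> y <= N%:R ->
  `|\sum_(j < N) (j%:R < y)%R%:R - y| <= 1.
Proof.
move=> y0 yN.
(* The bound y <= N is lost at smaller [N], so the induction runs on a version with [Num.min y N%:R]
   that holds for every [N]. *)
suff [/= H1 H2 _] : [/\ Num.min y N%:R <= \sum_(j < N) (j%:R < y)%R%:R,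
    \sum_(j < N) (j%:R < y)%R%:R <= y + 1 &
    \sum_(j < N) (j%:R < y)%R%:R <= N%:R :> R].
  by move: H1; rewrite min_l// ler_norml => H1; lra.
elim: N {yN} => [|N [IH1 IH2 IH3]].
  by rewrite big_ord0; split => //; [rewrite ge_min lexx orbT|rewrite addr_ge0].
rewrite !big_ord_recr /=; have [Ny|yN] := ltP N%:R y.
  move: IH1; rewrite min_r ?(ltW Ny)// mulr1n => IH1.
  split; first by rewrite ge_min -natr1 lerD2r IH1 orbT.
  - by rewrite lerD2r (le_trans IH3)// ltW.
  - by rewrite -natr1 lerD2r.
move: IH1; rewrite min_l// addr0 => IH1; split => //; first by rewrite ge_min IH1.
by rewrite (le_trans IH3)// ler_nat.
Qed.

Lemma smooth_approx_measurable u : measurable_fun setT u ->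
  (forall x, 0 <= u x <= 1) -> smooth_approx u.
Proof.
move=> mu_ u01.
pose A k j := [set x | j%:R < k.+1%:R * u x].
have mA k j : measurable (A k j).
  rewrite (_ : A k j = (fun x => k.+1%:R * u x) @^-1` `]j%:R, +oo[%classic); last first.
    by apply/seteqP; split => x /=; rewrite in_itv/= andbT.
  rewrite -[X in measurable X]setTI; apply: measurable_funM => //.
apply: (smooth_approx_lim (u_ := fun k x => k.+1%:R^-1 * \sum_(j < k.+1) \1_(A k j) x)) => //.
- move=> k; apply: measurable_funM => //; apply: measurable_sum => j.
  exact: measurable_indic.
- move=> k x; apply/andP; split.
    apply: mulr_ge0; first by rewrite invr_ge0.
    by apply: sumr_ge0 => j _; have /andP[] := indic01 (A k j) x.
  rewrite mulrC ler_pdivrMr ?ltr0n// mul1r.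
  rewrite -[leRHS](_ : \sum_(j < k.+1) 1 = _); last by rewrite sumr_const card_ord.
  by apply: ler_sum => j _; have /andP[] := indic01 (A k j) x.
- move=> x; apply/cvgrPdist_le => e e0; near=> k.
  have k0 : 0 < k.+1%:R :> R by rewrite ltr0n.
  have -> : u x = k.+1%:R^-1 * (k.+1%:R * u x) by rewrite mulrA mulVf ?mul1r// gt_eqF.
  rewrite -mulrBr normrM distrC ger0_norm ?invr_ge0 ?(ltW k0)//.
  have /andP[ux0 ux1] := u01 x.
  have H : `|\sum_(j < k.+1) (j%:R < k.+1%:R * u x)%R%:R - k.+1%:R * u x| <= 1.
    by apply: count_below; rewrite ?ler_piMr// mulr_ge0// ltW.
  rewrite (eq_bigr (fun j : 'I_k.+1 => (j%:R < k.+1%:R * u x)%R%:R)); last first.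
    by move=> j _; rewrite indicE /A mem_setE.
  rewrite (le_trans (ler_wpM2l _ H)) ?invr_ge0 ?(ltW k0)// mulr1.
  by apply: ltW; near: k; exact: near_infty_natSinv_lt (PosNum e0).
move=> k; apply: (@smooth_approx_avg k (fun j => \1_(A k j))) => j; first by apply: measurable_indic.
by have [] := approx_set_measurable (mA k j).
Unshelve. all: by end_near. Qed.

(** A product of one-dimensional bumps. It never equals 1 for finite [k], but tends to 1 on the open
    ball, which is enough for dominated convergence. *)
Definition cutoff (M : R) (k : nat) (x : V) : R :=
  \prod_(i < n) (flat_step (k.+1%:R * (x ord0 i + M)) * flat_step (k.+1%:R * (M - x ord0 i))).

Lemma smooth_cutoff M k : smooth (cutoff M k).
Proof.
apply: smooth_prod => i; apply: smoothM.
- rewrite (_ : (fun x => _) = fun x : V => flat 1 (k.+1%:R * x ord0 i + k.+1%:R * M)).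
    exact: smooth_flat_coord.
  by apply/funext => x; rewrite mulrDr.
- rewrite (_ : (fun x => _) = fun x : V => flat 1 (- k.+1%:R * x ord0 i + k.+1%:R * M)).
    exact: smooth_flat_coord.
  by apply/funext => x; rewrite mulrBr addrC mulNr.
Qed.

Lemma cutoff01 M k x : 0 <= cutoff M k x <= 1.
Proof.
rewrite prodr_ge0 => [|i _]; last by rewrite mulr_ge0// flat_step_ge0.
by apply: Num.Theory.prodr_ile1 => i _; rewrite mulr_ge0 ?mulr_ile1 ?flat_step_ge0 ?flat_step_le1.
Qed.

Lemma cutoff_out M k x : 0 <= M -> M < `|x| -> cutoff M k x = 0.
Proof.
move=> M0; rewrite ltNge => /normr_rV_leP => /(_ M0)/existsNP[i /negP].
rewrite -ltNge lter_normr => xi; rewrite /cutoff (bigD1 i)//=.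
suff -> : flat_step (k.+1%:R * (x ord0 i + M)) * flat_step (k.+1%:R * (M - x ord0 i)) = 0.
  by rewrite mul0r.
case/orP : xi => xi.
- by rewrite [X in _ * X]flat_step_le0 ?mulr0// mulr_ge0_le0//; lra.
- by rewrite flat_step_le0 ?mul0r// mulr_ge0_le0//; lra.
Qed.

Lemma cutoff_cvg M x : `|x| < M -> cutoff M k x @[k --> \oo] --> (1 : R).
Proof.
move=> xM; rewrite /cutoff; elim: (index_enum _) => [|i r IH].
  rewrite (_ : (fun k => _) = cst 1); first exact: cvg_cst.
  by apply/funext => k; rewrite big_nil.
rewrite (_ : (fun k => _) = fun k => flat_step (k.+1%:R * (x ord0 i + M)) *
  flat_step (k.+1%:R * (M - x ord0 i)) * \prod_(j <- r)
  (flat_step (k.+1%:R * (x ord0 j + M)) * flat_step (k.+1%:R * (M - x ord0 j)))); last first.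
  by apply/funext => k; rewrite big_cons.
have := le_lt_trans (normr_coord_le x i) xM; rewrite ltr_norml => /andP[x1 x2].
rewrite -[X in _ --> X]mulr1; apply: cvgM; last exact: IH.
by rewrite -[X in _ --> X]mulr1; apply: cvgM; apply: flat_step_cvg; lra.
Qed.

(** The affine map (1 + u)/2 brings [u] into the range [0, 1], where [smooth_approx_measurable]
    applies; mapping back and multiplying by a cutoff restores sign and support. The bound 1 and the
    radius M + 1 do not depend on [e]. *)
Lemma weighted_density u (M : R) : 0 <= M -> measurable_fun setT u ->
  (forall x, `|u x| <= 1) -> (forall x, M < `|x| -> u x = 0) ->
  forall e : R, 0 < e -> exists psi, [/\ smooth psi, forall x, `|psi x| <= 1,
    forall x, M + 1 < `|x| -> psi x = 0 &
    (wnorm (fun x => psi x - u x)%R <= e%:E)%E].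
Proof.
move=> M0 mu_ u1 u0 e e0; have e20 : 0 < e / 2 by rewrite divr_gt0.
(* Mapping back from [0, 1] to [-1, 1] doubles the error; the other half of [e] is spent on the
   cutoff. *)
have e40 : 0 < e / 4 by rewrite divr_gt0.
have mv : measurable_fun setT (fun x => 2^-1 * (1 + u x)).
  by apply: measurable_funM => //; exact: measurable_funD.
have v01 x : 0 <= 2^-1 * (1 + u x) <= 1.
  by have := u1 x; rewrite ler_norml; lra.
have [phi [sphi phi01 phiv]] := smooth_approx_measurable mv v01 e40.
have mphi := smooth_measurable sphi.
have mcut k := smooth_measurable (smooth_cutoff (M + 1) k).
have [k Hk] : exists k, (wnorm (fun x => u x * (1 - cutoff (M + 1) k x))%R <= (e / 2)%:E)%E.
  apply: (wnorm_cvg0 (h := fun k x => u x * (1 - cutoff (M + 1) k x))) => //.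
  - by move=> k; apply: measurable_funM => //; exact: measurable_funB.
  - move=> k x; rewrite normrM mulr_ile1// ler_norml.
    by have := cutoff01 (M + 1) k x; lra.
  - move=> x; have [Mx|xM] := ltP M `|x|.
      by apply: cvg_near_cst; apply: nearW => k; rewrite u0// mul0r.
    rewrite -[X in _ --> X](mulr0 (u x)); apply: cvgMr.
    rewrite -(subrr 1); apply: cvgB; first exact: cvg_cst.
    by apply: cutoff_cvg; rewrite (le_lt_trans xM)// ltrDl.
have s2 : smooth (fun x => 2 * phi x + (-1) * 1).
  by apply: (smooth_linear 2 (-1)) => //; exact: (smooth_cst 1).
exists (fun x => (2 * phi x + (-1) * 1) * cutoff (M + 1) k x); split.
- by apply: smoothM => //; exact: smooth_cutoff.
- move=> x; rewrite normrM mulr_ile1// ler_norml.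
    by have := phi01 x; lra.
  by have := cutoff01 (M + 1) k x; lra.
- by move=> x Mx; rewrite cutoff_out ?mulr0// addr_ge0.
have H2 : (wnorm (fun x => 2 * (phi x - 2^-1 * (1 + u x)))%R <= (e / 2)%:E)%E.
  have -> : wnorm (fun x => 2 * (phi x - 2^-1 * (1 + u x))) =
      (2%R%:E * wnorm (fun x => phi x - 2^-1 * (1 + u x))%R)%E.
    have mg : measurable_fun setT (fun x => phi x - 2^-1 * (1 + u x)) by exact: measurable_funB.
    rewrite /wnorm -(ge0_integralZl _ measurableT (wnorm_integrand mg)) ?lee_fin//.
      by apply: eq_integral => x _; rewrite normrM (ger0_norm (ler0n _ 2)) -mulrA EFinM.
    by move=> x _; rewrite lee_fin mulr_ge0.
  rewrite (le_trans (lee_wpmul2l _ phiv)) ?lee_fin//.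
  by lra.
rewrite [e]splitr EFinD (le_trans _ (leeD H2 Hk))//; apply: wnorm_le_add.
- by apply: measurable_funB => //; apply: measurable_funM => //; exact: smooth_measurable.
- by apply: measurable_funM => //; exact: measurable_funB.
- by apply: measurable_funM => //; exact: measurable_funB.
move=> x; have /andP[c0 c1] := cutoff01 (M + 1) k x.
rewrite (_ : _ - u x = 2 * (phi x - 2^-1 * (1 + u x)) * cutoff (M + 1) k x -
  u x * (1 - cutoff (M + 1) k x)); last by field.
rewrite (le_trans (ler_normB _ _))// lerD// normrM.
by rewrite ler_piMr// ger0_norm.
Qed.

End weighted_density.

(** * Duality *)

Section duality.
Context {R : realType} {n : nat}.
Local Notation V := 'rV[R]_n.
Local Notation mu := (lebesgue_rV (R := R) n).

Lemma powR_le_id (a r : R) : 0 <= a <= 1 -> 1 <= r -> a `^ r <= a.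
Proof.
move=> /andP[a0 a1] r1; have [->|an0] := eqVneq a 0.
  by rewrite powR0// gt_eqF// (lt_le_trans ltr01).
by rewrite -[leRHS]powRr1// ger_powR// a1 lt_neqAle eq_sym an0 a0.
Qed.

Lemma powR_le1 (a r : R) : 0 <= a <= 1 -> 0 <= r -> a `^ r <= 1.
Proof.
by move=> /andP[a0 a1] r0; have := ge0_ler_powR r0 a0 ler01 a1; rewrite powR1.
Qed.

Variables (p : R) (p1 : 1 <= p) (g : V -> R) (gL : g \in Lfun mu p%:E).
Variables (K : R) (K0 : 0 <= K).
Local Notation q := (hoelder_conjugate p%:E).
Hypothesis gK : forall psi : V -> R, smooth psi -> bounded_support psi ->
  (\int[mu]_x (psi x * g x)%:E <= K%:E * qnorm q psi)%E.

Let mg : measurable_fun setT g.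
Proof. by move: gL; rewrite inE => /andP[/[!inE]]. Qed.

Section bounded_multiplier.
Variables (u : V -> R) (M : R) (M0 : 0 <= M) (mu_ : measurable_fun setT u).
Hypotheses (u1 : forall x, `|u x| <= 1) (u0 : forall x, M < `|x| -> u x = 0).

Let B : set V := [set x | `|x| <= M + 1].
Let mB : measurable B. Proof. exact: measurable_closed_ball_rV. Qed.
(** The first term makes the weighted norm dominate the L^1 distance to [u], the second makes it
    dominate the error of the pairing with [g]; one approximation serves both. *)
Let w (x : V) : R := \1_B x + `|g x * \1_B x|.

Let w_ge0 x : 0 <= w x.
Proof. by rewrite addr_ge0// indicE. Qed.

Let iw : mu.-integrable setT (EFin \o w).
Proof.
rewrite (_ : EFin \o w = (EFin \o \1_B) \+ (fun x => `|(g x * \1_B x)%:E|)%E) //.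
apply: integrableD => //.
  rewrite (_ : _ \o _ = (fun x : V => (1 * \1_B x)%:E)); first exact: integrable_cst_closed_ball.
  by apply/funext => x; rewrite mul1r.
apply: integrable_abse; apply: (pairing_integrable p1 gL).
  exact: measurable_indic.
exact: qnorm_closed_ball.
Qed.

Let w_out (psi : V -> R) : (forall x, M + 1 < `|x| -> psi x = 0) ->
  forall x, `|psi x - u x| * `|g x| <= `|psi x - u x| * w x /\
            `|psi x - u x| <= `|psi x - u x| * w x.
Proof.
move=> psi0 x; have [xB|Bx] := leP `|x| (M + 1).
  have E : (\1_B x : R) = 1 by rewrite indicE mem_set.
  rewrite /w E mulr1; split; first by rewrite ler_wpM2l// lerDr.
  by rewrite ler_peMr// lerDl.
by rewrite psi0// u0 ?subrr ?normr0 ?mul0r// (lt_trans _ Bx)// ltrDl.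
Qed.

Let approx e psi : smooth psi -> (forall x, `|psi x| <= 1) ->
  (forall x, M + 1 < `|x| -> psi x = 0) ->
  (wnorm w (fun x => (psi x - u x)%R) <= e%:E)%E ->
  (\int[mu]_x (u x * g x)%:E <= \int[mu]_x (psi x * g x)%:E + e%:E)%E.
Proof.
move=> spsi psi1 psi0 psiu.
have mpsi := smooth_measurable spsi.
have qfin (h : V -> R) (C : R) : measurable_fun setT h -> (forall x, `|h x| <= 1) ->
    (forall x, C < `|x| -> h x = 0) -> mu.-integrable setT (fun x => (h x * g x)%:E).
  move=> mh h1 h0; under eq_fun do rewrite mulrC.
  apply: (pairing_integrable p1 gL) => //.
  apply: (le_lt_trans (qnorm_bounded_support p1 mh h1 h0)).
  by rewrite mul1e; exact: qnorm_closed_ball.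
have ipsi := qfin _ _ mpsi psi1 psi0; have iu := qfin _ _ mu_ u1 u0.
have md : measurable_fun setT (fun x => (`|psi x - u x| * w x)%:E).
  apply/measurable_EFinP; apply: measurable_funM.
    by apply: measurableT_comp => //; exact: measurable_funB.
  by have /measurable_EFinP := measurable_int _ iw.
have id : mu.-integrable setT (fun x => (`|psi x - u x| * w x)%:E).
  apply/integrableP; split => //; under eq_integral.
    move=> x _; rewrite gee0_abs; last by rewrite lee_fin mulr_ge0.
    over.
  by apply: le_lt_trans psiu _; rewrite ltry.
apply: (@le_trans _ _ (\int[mu]_x ((psi x * g x)%:E + (`|psi x - u x| * w x)%:E))%E).
  apply: le_integral => //; first exact: integrableD.
  move=> x _; rewrite -EFinD lee_fin.
  have [wg _] := w_out psi0 x; rewrite -lerBlDl (le_trans _ wg)//.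
  by rewrite -mulrBl -normrM -normrN (le_trans (ler_norm _))// -mulNr opprB.
by rewrite integralD// leeD2l.
Qed.

(** Here [b] bounds the q-norm of the multiplier. For p = 1 it must be at least 1, because the
    supremum of the approximants is only known to be at most 1. *)
Lemma dual_bounded (b : R) : 0 <= b -> (p = 1 -> 1 <= b) ->
  (forall r, q = r%:E -> ('N[mu]_r%:E[EFin \o u] <= b%:E)%E) ->
  (\int[mu]_x (u x * g x)%:E <= (K * b)%:E)%E.
Proof.
move=> b0 bp br; apply/lee_addgt0Pr => eps eps0.
have [[pE qE]|[r qE [r1 pr]]] := hoelder_conjugate_cases p1.
  have [psi [spsi psi1 psi0 psiu]] := weighted_density w_ge0 iw M0 mu_ u1 u0 eps0.
  have bpsi : bounded_support psi by exists (M + 1).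
  apply: (le_trans (approx spsi psi1 psi0 psiu)); rewrite leeD2r//.
  apply: (le_trans (gK spsi bpsi)); rewrite EFinM lee_wpmul2l ?lee_fin//.
  rewrite /qnorm qE /=; apply: ge_ereal_sup => _ [x _ <-].
  by rewrite lee_fin (le_trans (psi1 x))// bp.
have r0 : 0 < r by rewrite (lt_le_trans ltr01).
have c0 : 0 < 2 * K + 1 by rewrite ltr_wpDl// mulr_ge0.
(* The excess of the r-norm costs 2 K d and the pairing costs d^r <= d, in total (2 K + 1) d. *)
pose d := Num.min 1 (eps / (2 * K + 1)).
have d0 : 0 < d by rewrite lt_min ltr01 divr_gt0.
have d1 : d <= 1 by rewrite ge_min lexx.
have de : (2 * K + 1) * d <= eps.
  by rewrite mulrC -ler_pdivlMr// ge_min lexx orbT.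
have dr : d `^ r <= d by rewrite powR_le_id// ltW.
have [psi [spsi psi1 psi0 psiu]] :=
  weighted_density w_ge0 iw M0 mu_ u1 u0 (powR_gt0 r d0).
have mpsi := smooth_measurable spsi.
have mdiff : measurable_fun setT (fun x => psi x - u x) by exact: measurable_funB.
(* As |psi - u| <= 2 and r >= 1, the power |psi - u|^r is at most 2^r |psi - u|: closeness in L^1
   gives closeness in L^r. *)
have Ndiff : ('N[mu]_r%:E[EFin \o (fun x => (psi x - u x)%R)] <= (2 * d)%:E)%E.
  have -> : ((2 * d)%:E = (((2 `^ r) * d `^ r)%:E `^ r^-1)%E).
    rewrite poweR_EFin -powRM// ?(ltW d0)// -powRrM mulfV ?gt_eqF// powRr1//.
    by rewrite mulr_ge0// ltW.
  rewrite unlock; apply: gt0_ler_poweR.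
  - by rewrite invr_ge0 ltW.
  - by rewrite in_itv/= leey andbT; apply: integral_ge0 => x _; rewrite lee_fin powR_ge0.
  - by rewrite in_itv/= leey andbT lee_fin mulr_ge0// powR_ge0.
  rewrite EFinM (le_trans _ (lee_wpmul2l _ psiu)) ?lee_fin ?powR_ge0//.
  have m1 : measurable_fun setT (fun x => (`|psi x - u x| * w x)%:E).
    apply/measurable_EFinP; apply: measurable_funM.
      exact: measurableT_comp.
    by have /measurable_EFinP := measurable_int _ iw.
  rewrite /wnorm -(ge0_integralZl _ measurableT m1 (fun x _ => _)) ?lee_fin ?powR_ge0//.
    apply: ge0_le_integral => //.
    - by move=> x _; rewrite lee_fin powR_ge0.
    - exact: (measurable_normr_powR r mdiff).
    - exact: emeasurable_funM.
    move=> x _; rewrite /= -EFinM lee_fin.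
    have [_ wd] := w_out psi0 x; apply: (@le_trans _ _ (2 `^ r * `|psi x - u x|)); last first.
      by rewrite ler_wpM2l// powR_ge0.
    have dx : 0 <= `|psi x - u x| / 2 <= 1.
      rewrite divr_ge0//= ler_pdivrMr// mul1r (le_trans (ler_normB _ _))//.
      by have := psi1 x; have := u1 x; lra.
    have -> : `|psi x - u x| `^ r = 2 `^ r * (`|psi x - u x| / 2) `^ r.
      by rewrite -powRM// mulrC divfK.
    rewrite ler_wpM2l ?powR_ge0// (le_trans (powR_le_id dx r1))//.
    by rewrite ler_pdivrMr// ler_peMr// ler1n.
  by move=> x _; rewrite lee_fin mulr_ge0.
have bpsi : bounded_support psi by exists (M + 1).
apply: (le_trans (approx spsi psi1 psi0 psiu)).
apply: (@le_trans _ _ ((K * (b + 2 * d))%:E + (d `^ r)%:E)%E).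
  rewrite leeD2r//; apply: (le_trans (gK spsi bpsi)).
  rewrite EFinM lee_wpmul2l ?lee_fin//.
  rewrite (_ : psi = fun x => u x + (psi x - u x)); last by apply/funext => x; rewrite addrC subrK.
  apply: (le_trans (qnormD p1 mu_ mdiff)); rewrite EFinD /qnorm qE /=.
  by apply: leeD => //; exact: br.
by rewrite -!EFinD lee_fin; nra.
Qed.

End bounded_multiplier.

(** Bounding both [g] and [x] gives the multiplier a bound and a bounded support, and makes the
    truncated p-th moment finite in advance, so that one may divide by a power of it. *)
Let trunc (c : R) : set V := [set x | `|g x| <= c /\ `|x| <= c].

Let mtrunc c : measurable (trunc c).
Proof.
rewrite (_ : trunc c = ((fun x => `|g x|) @^-1` `]-oo, c]%classic) `&`
    [set x : V | `|x| <= c]); last first.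
  by apply/seteqP; split => x /=; rewrite in_itv.
apply: measurableI; last exact: measurable_closed_ball_rV.
have mabs : measurable_fun setT (fun x => `|g x|) by exact: measurableT_comp.
by rewrite -[X in measurable X]setTI; apply: mabs.
Qed.

(** With J the integral of (|g|/c)^p over [trunc c], the multiplier [u] pairs with [g] to c J and,
    for p > 1, has r-norm J^(1/r). Then c J <= K J^(1/r), hence c J^(1/p) <= K; the p-th power is
    the claim. *)
Lemma dual_truncated (c : R) : 0 < c ->
  (\int[mu]_x (`|g x| `^ p * \1_(trunc c) x)%:E <= (K `^ p)%:E)%E.
Proof.
move=> c0; have p0 : 0 < p by rewrite (lt_le_trans ltr01).
pose k (x : V) := `|g x| / c.
have k0 x : 0 <= k x by rewrite divr_ge0// ltW.
have ck x : c * k x = `|g x| by rewrite /k mulrC divfK ?gt_eqF.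
have mk : measurable_fun setT k.
  by apply: measurable_funM => //; exact: measurableT_comp.
have mI : measurable_fun setT (fun x : V => \1_(trunc c) x : R) by exact: measurable_indic.
(* The sign of [g], with value 1 where [g] vanishes so that its modulus is 1 everywhere. *)
pose s (x : V) : R := 2 * \1_[set x | 0 <= g x] x - 1.
have s1 x : `|s x| = 1 /\ s x * g x = `|g x|.
  rewrite /s indicE; have [g0|g0] := leP 0 (g x).
    by rewrite mem_set//= mulr1 addrK normr1 mul1r ger0_norm.
  rewrite memNset /=; last by rewrite leNgt g0.
  by rewrite mulr0 sub0r normrN1 mulN1r ltr0_norm.
have ms : measurable_fun setT s.
  apply: measurable_funB => //; apply: measurable_funM => //; apply: measurable_indic.
  rewrite (_ : mkset _ = g @^-1` `[0, +oo[%classic).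
    by rewrite -[X in measurable X]setTI; apply: mg.
  by apply/seteqP; split => x /=; rewrite in_itv/= andbT.
(* The extremal function of Hoelder's inequality, scaled so that |u| <= 1. *)
pose u (x : V) := s x * (k x `^ (p - 1) * \1_(trunc c) x).
have mu_ : measurable_fun setT u.
  apply: measurable_funM => //; apply: measurable_funM => //.
  exact: (measurableT_comp (measurable_powR (p - 1)) mk).
have absu x : `|u x| = k x `^ (p - 1) * \1_(trunc c) x.
  by rewrite /u normrM (s1 x).1 mul1r ger0_norm// mulr_ge0 ?powR_ge0// indicE.
have u1 x : `|u x| <= 1.
  rewrite absu indicE; have [[gc xc]|nt] := pselect (trunc c x).
    rewrite mem_set//= mulr1 powR_le1//; last by rewrite subr_ge0.
    by rewrite k0 /k ler_pdivrMr// mul1r.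
  by rewrite memNset// mulr0.
have u0 x : c < `|x| -> u x = 0.
  move=> cx; rewrite /u indicE memNset ?mulr0// => -[_].
  by rewrite leNgt cx.
pose J := (\int[mu]_x (k x `^ p * \1_(trunc c) x)%:E)%E.
have mJ : measurable_fun setT (fun x => (k x `^ p * \1_(trunc c) x)%:E).
  apply/measurable_EFinP; apply: measurable_funM => //.
  exact: (measurableT_comp (measurable_powR p) mk).
have J0 x : (0 <= (k x `^ p * \1_(trunc c) x)%:E)%E.
  by rewrite lee_fin mulr_ge0 ?powR_ge0// indicE.
have IE : (\int[mu]_x (`|g x| `^ p * \1_(trunc c) x)%:E = (c `^ p)%:E * J)%E.
  rewrite -(ge0_integralZl _ measurableT mJ (fun x _ => J0 x)) ?lee_fin ?powR_ge0//.
  apply: eq_integral => x _; rewrite -EFinM mulrA -powRM ?(ltW c0)//.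
  by rewrite ck.
have ugE : (\int[mu]_x (u x * g x)%:E = c%:E * J)%E.
  rewrite -(ge0_integralZl _ measurableT mJ (fun x _ => J0 x)) ?lee_fin ?(ltW c0)//.
  apply: eq_integral => x _; rewrite -EFinM; congr EFin.
  rewrite /u mulrAC (s1 x).2 -ck -mulrA; congr (_ * _); rewrite mulrA; congr (_ * _).
  have [->|kn0] := eqVneq (k x) 0; first by rewrite mul0r powR0// gt_eqF.
  rewrite -{1}[k x]powRr1// -powRD; first by rewrite addrC subrK.
  by rewrite kn0 implybT.
have Jfin : J \is a fin_num.
  apply: integrable_fin_num => //; apply: (@integrable_bounded_support _ _ _ 1 c).
  - exact/measurable_EFinP.
  - move=> x; rewrite ger0_norm; last by have := J0 x; rewrite lee_fin.
    rewrite indicE; have [[gc xc]|nt] := pselect (trunc c x).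
      rewrite mem_set//= mulr1 powR_le1//; last exact: ltW.
      by rewrite k0 /k ler_pdivrMr// mul1r.
    by rewrite memNset// mulr0.
  - by move=> x cx; rewrite indicE memNset ?mulr0// => -[_]; rewrite leNgt cx.
rewrite IE; move: ugE; rewrite -(fineK Jfin).
have j0 : 0 <= fine J by rewrite fine_ge0// integral_ge0.
move jE : (fine J) => j; rewrite jE in j0; rewrite -!EFinM => ugE; rewrite lee_fin.
have [[pE qE]|[r qE [r1 pr]]] := hoelder_conjugate_cases p1.
  have := @dual_bounded u c (ltW c0) mu_ u1 u0 1 ler01 (fun _ => lexx 1).
  rewrite ugE lee_fin mulr1 => H; rewrite pE !powRr1 ?(ltW c0)//.
  by apply: H => r; rewrite qE.
have r0 : 0 < r by rewrite (lt_le_trans ltr01).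
have rpE : (p - 1) * r = p.
  have : (p^-1 + r^-1) * (p * r) = p * r by rewrite pr mul1r.
  rewrite (_ : _ * (p * r) = r + p); last by field; rewrite !gt_eqF.
  by rewrite mulrBl mul1r => <-; rewrite addrAC subrr add0r.
have Nu : ('N[mu]_r%:E[EFin \o u] = (j `^ r^-1)%:E)%E.
  rewrite unlock -poweR_EFin -jE (fineK Jfin); congr poweR.
  apply: eq_integral => x _ /=; rewrite absu; congr EFin.
  rewrite powRM ?powR_ge0//.
  rewrite -powRrM rpE indicE; case: (_ \in _); first by rewrite powR1.
  by rewrite powR0// gt_eqF.
have := @dual_bounded u c (ltW c0) mu_ u1 u0 (j `^ r^-1) (powR_ge0 _ _) _ _.
rewrite ugE lee_fin => H.
have {}H : c * j <= K * j `^ r^-1.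
  apply: H.
    by move=> pE; exfalso; move: pr; rewrite pE invr1 -{2}[1]addr0 => /addrI/eqP; rewrite invr_eq0 gt_eqF.
  by move=> r'; rewrite qE => -[<-]; rewrite Nu.
have [j00|jn0] := eqVneq j 0; first by rewrite j00 mulr0 powR_ge0.
have jp : 0 < j by rewrite lt_neqAle eq_sym jn0.
have jr : 0 < j `^ r^-1 by rewrite powR_gt0.
have {}H : c * j `^ p^-1 <= K.
  rewrite -(ler_pM2r jr) -mulrA -powRD ?jn0 ?implybT// pr powRr1 ?(ltW jp)//.
have : (c * j `^ p^-1) `^ p <= K `^ p.
  by apply: ge0_ler_powR; rewrite ?nnegrE ?mulr_ge0 ?powR_ge0 ?(ltW c0) ?(ltW p0).
by rewrite powRM ?powR_ge0 ?(ltW c0)// -powRrM mulVf ?gt_eqF// powRr1 ?(ltW jp).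
Qed.

(** The bound for [trunc c] does not depend on [c]; monotone convergence along c = m + 1 removes the
    truncation. *)
Lemma dual_Lnorm_le : ('N[mu]_p%:E[EFin \o g] <= K%:E)%E.
Proof.
have p0 : 0 < p by rewrite (lt_le_trans ltr01).
have mgp := measurable_normr_powR p mg.
have -> : K%:E = ((K `^ p)%:E `^ p^-1)%E.
  by rewrite poweR_EFin -powRrM mulfV ?gt_eqF// powRr1.
rewrite unlock; apply: gt0_ler_poweR.
- by rewrite invr_ge0 ltW.
- by rewrite in_itv/= leey andbT; apply: integral_ge0 => x _; rewrite lee_fin powR_ge0.
- by rewrite in_itv/= leey andbT lee_fin powR_ge0.
pose F m (x : V) : \bar R := (`|g x| `^ p * \1_(trunc m.+1%:R) x)%:E.
have mF m : measurable_fun setT (F m).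
  apply/measurable_EFinP; apply: measurable_funM; first exact/measurable_EFinP.
  by apply: measurable_indic; exact: mtrunc.
have F0 m x : setT x -> (0 <= F m x)%E.
  by move=> _; rewrite lee_fin mulr_ge0 ?powR_ge0// indicE.
have ndF x : setT x -> nondecreasing_seq (F ^~ x).
  move=> _; apply/nondecreasing_seqP => m; rewrite lee_fin ler_wpM2l ?powR_ge0//.
  rewrite !indicE ler_nat; have [[gx xm]|nt] := pselect (trunc m.+1%:R x).
    have mm : m.+1%:R <= m.+2%:R :> R by rewrite ler_nat.
    by rewrite !mem_set//; split; apply: le_trans mm.
  by rewrite memNset.
have cvgF x : limn (F ^~ x) = (`|g x| `^ p)%:E.
  apply/cvg_lim => //; apply: cvg_near_cst.
  have [N _ HN] : \forall m \near \oo, Num.max `|g x| `|x| <= m%:R.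
    exact: nbhs_infty_ger.
  exists N => // m /= Nm; rewrite /F indicE mem_set ?mulr1//.
  have : Num.max `|g x| `|x| <= m.+1%:R by apply: HN; exact: leqW.
  by rewrite ge_max => /andP.
have cF := @cvg_monotone_convergence _ _ _ mu setT measurableT F mF F0 ndF.
rewrite [leLHS](_ : _ = limn (fun m => \int[mu]_x F m x)%E); last first.
  rewrite (cvg_lim _ cF)//; apply: eq_integral => x _.
  by rewrite cvgF.
apply: lime_le; first by apply/cvg_ex; eexists; exact: cF.
by apply: nearW => m; exact: dual_truncated.
Qed.

End duality.

(** * The lower bound *)

Section directional_test.
Context {R : realType} {n : nat}.
Local Notation V := 'rV[R]_n.
Local Notation mu := (lebesgue_rV (R := R) n).

(** The mean value theorem twice, for [psi] and then for its derivative. The constant is not the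
    sharp B/2; only the order t^2 matters. *)
Lemma taylor1_bound (psi : V -> R) (h y : V) (B t : R) : smooth psi ->
  (forall x, `|'D_h ('D_h psi) x| <= B) -> 0 <= t ->
  `|psi (t *: h + y) - psi y - t * 'D_h psi y| <= B * t ^+ 2.
Proof.
move=> spsi HB t0; have B0 : 0 <= B by rewrite (le_trans _ (HB 0)).
have DZ phi (s : R) x : smooth phi -> 'D_(s *: h) phi x = s * 'D_h phi x.
  move=> sphi.
  have dx : is_derive x h phi ('D_h phi x) by apply/derivableP; exact: smooth_derivable_dir.
  by rewrite (@derive_val _ _ _ _ _ _ _ (is_derive_scale_dir s dx)) mulrC.
have [c /andP[c0 c1] ->] := derive_MVT y (fun x => @smooth_derivable_dir _ _ psi x (t *: h) spsi).
rewrite DZ// -mulrBr scalerA.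
have [d /andP[d0 d1] ->] :=
  derive_MVT y (fun x => @smooth_derivable_dir _ _ _ x ((c * t) *: h) (smooth_dir h spsi)).
rewrite DZ; last exact: smooth_dir.
rewrite !normrM (ger0_norm t0) (ger0_norm c0).
have := HB (d *: ((c * t) *: h) + y); set z := `| _ |%R => zB.
have z0 : 0 <= z by rewrite /z.
rewrite (_ : t * _ = (c * z) * t ^+ 2); last by ring.
by rewrite ler_wpM2r ?sqr_ge0// (le_trans _ zB)// ler_piMl.
Qed.

(** The base 1 + d/a is at least 1 and s <= 1. The perturbation [d], later the Riemann-sum error,
    thus enters linearly. *)
Lemma powR_addr_le (a d s : R) : 0 < a -> 0 <= d -> 0 <= s <= 1 ->
  (a + d) `^ s <= a `^ s * (1 + d / a).
Proof.
move=> a0 d0 /andP[s0 s1]; have da0 : 0 <= d / a by rewrite divr_ge0// ltW.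
rewrite (_ : a + d = a * (1 + d / a)); last first.
  by rewrite mulrDr mulr1 mulrC divfK ?gt_eqF.
rewrite powRM ?(ltW a0) ?addr_ge0// ler_wpM2l ?powR_ge0//.
by rewrite -[leRHS]powRr1 ?addr_ge0// ler_powR// lerDl.
Qed.

Variables (psi : V -> R) (spsi : smooth psi).
Variables (h : V) (h0 : h != 0).
Let L : R := enorm h.
Let e : V := L^-1 *: h.
Let L0 : 0 < L. Proof. exact: enorm_gt0. Qed.

Let node (N k : nat) (x : V) : V := x + (k%:R / N.+1%:R) *: h.

(* A Riemann sum of the primitive of psi(. + h) - psi along h: with finite sums
   Minkowski's inequality is the triangle inequality. *)
Definition steps (N : nat) (x : V) : R :=
  L / N.+1%:R * \sum_(k < N.+1) psi (node N k x).

Lemma smooth_steps N : smooth (steps N).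
Proof. by apply: smoothZ; apply: smooth_sum => k; exact: smooth_shift. Qed.

Lemma derive_steps N :
  'D_e (steps N) = fun x => N.+1%:R^-1 * \sum_(k < N.+1) 'D_h psi (node N k x).
Proof.
apply/funext => x.
have dk k : is_derive x e (fun x => psi (node N k x)) ('D_h psi (node N k x) * L^-1).
  have dpsi : is_derive (node N k x) h psi ('D_h psi (node N k x)).
    by apply/derivableP; exact: smooth_derivable_dir.
  have {}dpsi := is_derive_scale_dir L^-1 dpsi.
  apply: DeriveDef; last by rewrite derive_shift_fun; exact: derive_val.
  by apply: derivable_shift_fun; exact: ex_derive.
have dS m : is_derive x e (fun x => \sum_(k < m) psi (node N k x))
    (\sum_(k < m) 'D_h psi (node N k x) * L^-1).
  elim: m => [|m IH].
    rewrite big_ord0 (_ : (fun x => _) = cst 0); first exact: is_derive_cst.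
    by apply/funext => y; rewrite big_ord0.
  rewrite big_ord_recr (_ : (fun x => _) =
    (fun x => \sum_(k < m) psi (node N k x)) + (fun x => psi (node N m x))).
    exact: is_deriveD.
  by apply/funext => y; rewrite big_ord_recr.
have := is_deriveZ (L / N.+1%:R) (dS N.+1).
move=> /(@derive_val _ _ _ _ _ _ _) E; rewrite /steps [LHS]E.
rewrite -mulr_suml [LHS]/GRing.scale /=.
by field; rewrite nat1r pnatr_eq0 (gt_eqF L0).
Qed.

Lemma node_out N k (M : R) x : (k <= N.+1)%N -> M + `|h| < `|x| -> M < `|node N k x|.
Proof.
move=> kN Mx; rewrite -(ltrD2r `|h|) (lt_le_trans Mx)//.
rewrite -{1}[x](addrK ((k%:R / N.+1%:R) *: h)) (le_trans (ler_normB _ _))// lerD2l.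
rewrite normrZ ger0_norm; last by rewrite divr_ge0.
by rewrite ler_piMl// ler_pdivrMr ?ltr0n// mul1r ler_nat.
Qed.

Lemma steps_out N (M : R) : (forall x, M < `|x| -> psi x = 0) ->
  forall x, M + `|h| < `|x| -> steps N x = 0.
Proof.
move=> HM x Mx; rewrite /steps big1 ?mulr0// => k _.
by apply: HM; apply: (node_out _ Mx); exact: ltnW.
Qed.

Definition steps_error N (x : V) : R := 'D_e (steps N) x - (psi (x + h) - psi x).

Lemma steps_error_out N (M : R) : (forall x, M < `|x| -> psi x = 0) ->
  forall x, M + `|h| < `|x| -> steps_error N x = 0.
Proof.
move=> HM x Mx; rewrite /steps_error (bounded_support_derive e (@steps_out N M HM))//.
have Mx0 := node_out (leq0n N.+1) Mx; have Mx1 := node_out (leqnn N.+1) Mx.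
rewrite /node mul0r scale0r addr0 in Mx0.
rewrite /node divff ?pnatr_eq0// scale1r in Mx1.
by rewrite !HM// !subrr.
Qed.

(** The increment of [psi] telescopes over the nodes; a Taylor step of length 1/(N+1) leaves
    B/(N+1)^2 on each of the N+1 pieces. *)
Lemma steps_error_le N (B : R) : (forall x, `|'D_h ('D_h psi) x| <= B) ->
  forall x, `|steps_error N x| <= B / N.+1%:R.
Proof.
move=> HB x; have N0 : N.+1%:R != 0 :> R by rewrite pnatr_eq0.
have tel : psi (x + h) - psi x =
    \sum_(k < N.+1) (psi (node N k.+1 x) - psi (node N k x)).
  rewrite -(big_mkord xpredT (fun k => psi (node N k.+1 x) - psi (node N k x))).
  rewrite telescope_sumr// /node mul0r scale0r addr0 divff// scale1r.
  by [].
have B0 : 0 <= B by rewrite (le_trans _ (HB 0)).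
rewrite /steps_error (congr1 (fun F => F x) (derive_steps N) : 'D_e (steps N) x = _) tel mulr_sumr -sumrB (le_trans (ler_norm_sum _ _ _))//.
apply: (@le_trans _ _ (\sum_(k < N.+1) B / N.+1%:R ^+ 2)); last first.
  rewrite sumr_const card_ord -mulr_natl expr2 le_eqVlt; apply/orP; left; apply/eqP.
  by field; rewrite nat1r pnatr_eq0.
apply: ler_sum => k _.
have t0 : 0 <= N.+1%:R^-1 :> R by rewrite invr_ge0.
have := taylor1_bound (node N k x) spsi HB t0.
have -> : N.+1%:R^-1 *: h + node N k x = node N k.+1 x.
  by rewrite /node addrCA -scalerDl -[k.+1%:R]natr1 mulrDl mul1r (addrC N.+1%:R^-1).
by rewrite exprVn distrC.
Qed.

End directional_test.

(** * The limit of the Riemann sums and the bound on translates *)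

Section lower_bound.
Context {R : realType} {n : nat}.
Local Notation V := 'rV[R]_n.
Local Notation mu := (lebesgue_rV (R := R) n).
Variables (p alpha : R) (p1 : 1 <= p) (alpha_gt0 : 0 < alpha) (alpha_le1 : alpha <= 1).
Variables (f : V -> R) (fLp : f \in Lfun mu p%:E).
Local Notation q := (hoelder_conjugate p%:E).

Let mf : measurable_fun setT f.
Proof. by move: fLp; rewrite inE => /andP[/[!inE]]. Qed.

Let Nf : ('N[mu]_p%:E[EFin \o f] < +oo)%E.
Proof. by move: fLp; rewrite inE => /andP[_ /[!inE]]. Qed.

Lemma measurable_translate (h : V) : measurable_fun setT (translate h f).
Proof. exact: (measurableT_comp mf (measurable_rV_shift (- h))). Qed.

Lemma translate_diff_Lfun (h : V) : translate h f \- f \in Lfun mu p%:E.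
Proof.
have mt := measurable_translate h.
rewrite inE; apply/andP; split; rewrite inE /=; first exact: measurable_funB.
rewrite /finite_norm.
have -> : EFin \o (translate h f \- f) = (EFin \o (translate h f \+ (fun x => - f x)%R)).
  by [].
have mNf : measurable_fun setT (fun x => - f x) by exact: measurableT_comp.
apply: (le_lt_trans (minkowski_EFin _ mt mNf p1)); apply: lte_add_pinfty.
  rewrite (_ : Lnorm _ _ _ = 'N[mu]_p%:E[EFin \o f]%E)//.
  by rewrite unlock -[in RHS](integral_rV_shift (- h) (measurable_normr_powR p mf)).
rewrite (_ : EFin \o _ = \- (EFin \o f))%E//.
by rewrite oppe_Lnorm.
Qed.

Lemma integral_translate_diff (h : V) (psi : V -> R) : smooth psi -> bounded_support psi ->
  (\int[mu]_x (psi x * (translate h f \- f) x)%:E =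
   \int[mu]_x (f x * (psi (x + h) - psi x))%:E)%E.
Proof.
move=> spsi bpsi.
have mpsi := smooth_measurable spsi; have mt := measurable_translate h.
have fin_psi : (qnorm q psi < +oo)%E.
  by apply: qnorm_lty_continuous => //; exact: smooth_continuous.
have spsih := smooth_shift h spsi; have mpsih := smooth_measurable spsih.
have i0 : mu.-integrable setT (fun x => (f x * psi x)%:E) by exact: (pairing_integrable p1).
have i1 : mu.-integrable setT (fun x => (f x * psi (x + h))%:E).
  by apply: (pairing_integrable p1) => //; rewrite qnorm_shift.
have m2 : measurable_fun setT (fun x => (psi x * translate h f x)%:E).
  by apply/measurable_EFinP; exact: measurable_funM.
have shiftE : (fun x => (psi (x + h) * translate h f (x + h))%:E) =
    (fun x => (f x * psi (x + h))%:E).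
  by apply/funext => x; rewrite /translate addrK mulrC.
have i2 : mu.-integrable setT (fun x => (psi x * translate h f x)%:E).
  apply/integrableP; split => //.
  have ma : measurable_fun setT (fun x => `|(psi x * translate h f x)%:E|%E).
    exact: measurableT_comp.
  rewrite -(integral_rV_shift h ma) /=.
  have /integrableP[_] := i1; apply: le_lt_trans.
  rewrite le_eqVlt; apply/orP; left; apply/eqP; apply: eq_integral => x _.
  by rewrite /translate addrK mulrC.
have i3 : mu.-integrable setT (fun x => (psi x * f x)%:E).
  by under eq_fun do rewrite mulrC.
transitivity (\int[mu]_x ((psi x * translate h f x)%:E - (psi x * f x)%:E))%E.
  by apply: eq_integral => x _; rewrite /= mulrBr EFinB.
rewrite integralB// -(integral_rV_shift h m2) shiftE.
transitivity (\int[mu]_x ((f x * psi (x + h))%:E - (f x * psi x)%:E))%E; last first.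
  by apply: eq_integral => x _; rewrite mulrBr EFinB.
by rewrite integralB//; congr (_ - _)%E; apply: eq_integral => x _; rewrite mulrC.
Qed.

Variables (C : R) (C0 : 0 <= C).
Hypothesis fC : forall phi e, test_function phi -> enorm e = 1 ->
  (\int[mu]_x ('D_e phi x * f x)%:E <=
   C%:E * qnorm q phi `^ alpha * qnorm q ('D_e phi) `^ (1 - alpha))%E.

Section one_test.
Variables (psi : V -> R) (spsi : smooth psi) (h : V) (h0 : h != 0).
Variables (M B : R) (HM : forall x, M < `|x| -> psi x = 0).
Hypothesis HB : forall x, `|'D_h ('D_h psi) x| <= B.
Let L : R := enorm h.
Let a : R := fine (qnorm q psi).
Let Q : R := fine (qnorm q (fun x : V => \1_[set x : V | (`|x| <= M + `|h|)%R] x)).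
Let F : R := fine ('N[mu]_p%:E[EFin \o f])%E.

Let L0 : 0 < L. Proof. exact: enorm_gt0. Qed.

Let bpsi : bounded_support psi. Proof. by exists M. Qed.

Let aE : qnorm q psi = a%:E.
Proof.
rewrite fineK// ge0_fin_numE ?qnorm_ge0//; apply: qnorm_lty_continuous => //.
exact: smooth_continuous.
Qed.

Let a0 : 0 <= a. Proof. by rewrite fine_ge0// qnorm_ge0. Qed.

Let QE : qnorm q (fun x : V => \1_[set x : V | (`|x| <= M + `|h|)%R] x) = Q%:E.
Proof. by rewrite fineK// ge0_fin_numE ?qnorm_ge0// qnorm_closed_ball. Qed.

Let Q0 : 0 <= Q. Proof. by rewrite fine_ge0// qnorm_ge0. Qed.

Let FE : ('N[mu]_p%:E[EFin \o f])%E = F%:E.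
Proof. by rewrite fineK// ge0_fin_numE// Lnorm_ge0. Qed.

Let F0 : 0 <= F. Proof. by rewrite fine_ge0// Lnorm_ge0. Qed.

Let B0 : 0 <= B. Proof. by rewrite (le_trans _ (HB 0)). Qed.

Let phi N := steps psi h N.
Let e : V := L^-1 *: h.

Let sphi N : smooth (phi N). Proof. exact: smooth_steps. Qed.

Let sdiff : smooth (fun x => psi (x + h) - psi x).
Proof.
rewrite (_ : (fun x => _) = fun x => 1 * psi (x + h) + (-1) * psi x).
  by apply: smooth_linear => //; exact: smooth_shift.
by apply/funext => x; rewrite mul1r mulN1r.
Qed.

Let merr N : measurable_fun setT (steps_error psi h N).
Proof.
apply: measurable_funB; apply: smooth_measurable; last exact: sdiff.
exact: smooth_dir.
Qed.

Let qerr N : (qnorm q (steps_error psi h N) <= (B * Q / N.+1%:R)%:E)%E.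
Proof.
apply: (le_trans (qnorm_bounded_support p1 (merr N) (steps_error_le spsi h0 N HB)
  (steps_error_out N HM))).
by rewrite QE -EFinM mulrAC.
Qed.

Let qdiff : (qnorm q (fun x => psi (x + h) - psi x)%R <= (2 * a)%:E)%E.
Proof.
have mpsi := smooth_measurable spsi.
have mpsih := smooth_measurable (smooth_shift h spsi).
rewrite (_ : (fun x => _) = fun x => psi (x + h) + (-1) * psi x); last first.
  by apply/funext => x; rewrite mulN1r.
have mN : measurable_fun setT (fun x => -1 * psi x) by exact: measurable_funM.
apply: (le_trans (qnormD p1 mpsih mN)); rewrite (qnorm_shift p1)// aE.
rewrite mulr2n mulrDl mul1r EFinD leeD2l// (le_trans (qnormZ p1 (-1) mpsi))//.
by rewrite normrN1 mul1e aE.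
Qed.

Let qphi N : (qnorm q (phi N) <= (L * a)%:E)%E.
Proof.
have mk k : measurable_fun setT (fun x : V => psi (x + (k%:R / N.+1%:R) *: h)).
  exact: smooth_measurable (smooth_shift _ spsi).
have ms : measurable_fun setT (fun x : V => \sum_(k < N.+1) psi (x + (k%:R / N.+1%:R) *: h)).
  exact: measurable_sum.
have c0 : 0 <= L / N.+1%:R by rewrite divr_ge0// ltW.
apply: (le_trans (qnormZ p1 _ ms)); rewrite (ger0_norm c0).
rewrite (_ : L * a = L / N.+1%:R * (N.+1%:R * a)); last first.
  by field; rewrite nat1r pnatr_eq0.
rewrite [leRHS]EFinM lee_wpmul2l ?lee_fin// [leRHS]EFinM.
apply: (@qnorm_sum _ _ _ p1 N.+1 (fun k x => psi (x + (k%:R / N.+1%:R) *: h)) _) => // k.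
by rewrite (qnorm_shift p1) ?aE//; exact: smooth_measurable.
Qed.

Let qDphi N : (qnorm q ('D_e (phi N)) <= (2 * a + B * Q / N.+1%:R)%:E)%E.
Proof.
rewrite (_ : 'D_e (phi N) = fun x => psi (x + h) - psi x + steps_error psi h N x); last first.
  by apply/funext => x; rewrite /steps_error addrC subrK.
apply: (le_trans (qnormD p1 (smooth_measurable sdiff) (merr N))).
by rewrite EFinD leeD.
Qed.

Let e1 : enorm e = 1.
Proof. by rewrite enormZ ger0_norm ?invr_ge0 ?(ltW L0)// mulVf// gt_eqF. Qed.

Let tphi N : test_function (phi N).
Proof. by apply/test_functionP; split => //; exists (M + `|h|); exact: steps_out. Qed.

(** The first summand is [fC] for the test function [phi N] with the bounds [qphi] and [qDphi]; the
    second is Hoelder for the error, paired with [f]. *)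
Let step_bound N : (\int[mu]_x (f x * (psi (x + h) - psi x))%:E <=
  (C * (L * a) `^ alpha * (2 * a + B * Q / N.+1%:R) `^ (1 - alpha) +
   F * (B * Q / N.+1%:R))%:E)%E.
Proof.
have mD : measurable_fun setT ('D_e (phi N)) := smooth_measurable (smooth_dir e (sphi N)).
have iD : mu.-integrable setT (fun x => ('D_e (phi N) x * f x)%:E).
  under eq_fun do rewrite mulrC.
  by apply: (pairing_integrable p1 fLp mD); rewrite (le_lt_trans (qDphi N))// ltry.
have qR : (qnorm q (steps_error psi h N) < +oo)%E by rewrite (le_lt_trans (qerr N))// ltry.
have iR := pairing_integrable p1 fLp (merr N) qR.
rewrite (_ : (fun x => _) = fun x => ('D_e (phi N) x * f x)%:E - (f x * steps_error psi h N x)%:E)%E; last first.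
  apply/funext => x; rewrite -EFinB; congr EFin.
  by rewrite /steps_error -/e (_ : derive _ _ _ = 'D_e (phi N) x)//; ring.
rewrite integralB// EFinD; apply: leeD.
  apply: (le_trans (fC (tphi N) e1)).
  have s0 : 0 <= 1 - alpha by rewrite subr_ge0.
  have d0 : 0 <= 2 * a + B * Q / N.+1%:R.
    by rewrite addr_ge0 ?mulr_ge0// invr_ge0.
  rewrite !EFinM -!poweR_EFin; apply: lee_pmul => //.
  - by rewrite mule_ge0// poweR_ge0.
  - exact: poweR_ge0.
  - rewrite lee_wpmul2l//; apply: gt0_ler_poweR => //; first exact: ltW.
    + by rewrite in_itv/= leey andbT qnorm_ge0.
    + by rewrite in_itv/= leey andbT lee_fin mulr_ge0// ltW.
  - apply: gt0_ler_poweR => //.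
    + by rewrite in_itv/= leey andbT qnorm_ge0.
    + by rewrite in_itv/= leey andbT lee_fin.
apply: (le_trans (lee_abs _)); rewrite abseN.
apply: (le_trans (le_abse_integral _ measurableT (measurable_int _ iR))).
apply: (le_trans (pairing_le p1 mf (merr N) qR)).
by rewrite FE [leRHS]EFinM lee_wpmul2l// lee_fin.
Qed.

Lemma difference_pairing_bound :
  (\int[mu]_x (f x * (psi (x + h) - psi x))%:E <=
   (C * enorm h `^ alpha * 2 `^ (1 - alpha))%:E * qnorm q psi)%E.
Proof.
rewrite -/L aE -EFinM.
(* The coefficient of 1/(N+1) in the error. The linearization divides by 2 a, hence the separate
   case a = 0, where the main term vanishes because alpha > 0. *)
pose Z : R := if a == 0 then F * (B * Q) else
  C * (L * a) `^ alpha * (2 * a) `^ (1 - alpha) * (B * Q / (2 * a)) + F * (B * Q).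
have Z0 : 0 <= Z.
  have D0 : 0 <= B * Q by rewrite mulr_ge0.
  rewrite /Z; case: ifP => _; first by rewrite mulr_ge0.
  by rewrite addr_ge0 ?mulr_ge0 ?powR_ge0 ?invr_ge0 ?mulr_ge0.
have step N : (\int[mu]_x (f x * (psi (x + h) - psi x))%:E <=
    (C * L `^ alpha * 2 `^ (1 - alpha) * a + Z / N.+1%:R)%:E)%E.
  apply: (le_trans (step_bound N)); rewrite lee_fin.
  have d0 : 0 <= B * Q / N.+1%:R by rewrite divr_ge0 ?mulr_ge0.
  have [aE0|an0] := eqVneq a 0.
    rewrite /Z aE0 eqxx !mulr0 powR0 ?(gt_eqF alpha_gt0)// mulr0 mul0r !add0r.
    by rewrite mulrA.
  have ap : 0 < a by rewrite lt_neqAle eq_sym an0.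
  have s01 : 0 <= 1 - alpha <= 1 by rewrite subr_ge0 alpha_le1 gerBl ltW.
  have a2 : 0 < 2 * a by rewrite mulr_gt0.
  have Ca : 0 <= C * (L * a) `^ alpha by rewrite mulr_ge0// powR_ge0.
  have := ler_wpM2l Ca (powR_addr_le a2 d0 s01).
  have -> : C * (L * a) `^ alpha * ((2 * a) `^ (1 - alpha) * (1 + B * Q / N.+1%:R / (2 * a)))
    = C * L `^ alpha * 2 `^ (1 - alpha) * a +
      C * (L * a) `^ alpha * (2 * a) `^ (1 - alpha) * (B * Q / (2 * a)) / N.+1%:R.
    rewrite mulrDr mulr1 mulrDr; congr (_ + _).
      rewrite !powRM ?(ltW L0)//.
      have {3}-> : a = a `^ alpha * a `^ (1 - alpha).
        by rewrite -powRD ?an0 ?implybT// addrC subrK powRr1.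
      by ring.
    by ring.
  rewrite /Z (negbTE an0) => H; rewrite (le_trans (lerD H (lexx _)))//.
  by rewrite le_eqVlt; apply/orP; left; apply/eqP; ring.
apply/lee_addgt0Pr => eps eps0.
have [N HN] : exists N : nat, Z / N.+1%:R <= eps.
  exists (Num.truncn (Z / eps)); rewrite ler_pdivrMr ?ltr0n// mulrC -ler_pdivrMr//.
  by rewrite ltW// truncnS_gt.
by rewrite (le_trans (step N))// EFinD leeD2l// lee_fin.
Qed.

End one_test.

Lemma diff_norm_le_of_Vvar0 (h : V) : h != 0 ->
  (diff_norm p f h <= (C * enorm h `^ alpha * 2 `^ (1 - alpha))%:E)%E.
Proof.
move=> h0; apply: (dual_Lnorm_le p1 (translate_diff_Lfun h)).
  by rewrite !mulr_ge0// powR_ge0.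
move=> psi spsi bpsi; rewrite integral_translate_diff//.
have [M HM] := bpsi.
have [B _ HB] : exists2 B : R, 0 < B & forall x, `|'D_h ('D_h psi) x| <= B.
  apply: continuous_bounded; first by apply: smooth_continuous; do 2 apply: smooth_dir.
  exists M => x Mx; apply: bounded_support_derive Mx => y.
  exact: bounded_support_derive.
exact: (difference_pairing_bound spsi h0 HM HB).
Qed.

End lower_bound.

Section lower_bound_Vvar0.
Context {R : realType} {n : nat}.
Variables (p alpha : R) (f : 'rV[R]_n -> R).
Hypotheses (p1 : 1 <= p) (alpha_gt0 : 0 < alpha) (alpha_le1 : alpha <= 1).
Hypothesis fLp : f \in Lfun (lebesgue_rV n) p%:E.

Lemma holder_seminorm_le_Vvar0 :
  ((2 `^ (alpha - 1))%:E * holder_seminorm p alpha f <= Vvar0 p alpha f)%E.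
Proof.
have t0 : 0 < 2 `^ (alpha - 1) :> R by rewrite powR_gt0.
rewrite muleC -lee_pdivlMr//; apply: ge_ereal_sup => _ [h h0 <-].
rewrite lee_pdivlMr//; apply: le_ereal_inf_tmp => _ [C [C0 HC] <-].
have e0 : 0 < enorm h by exact: enorm_gt0.
have := diff_norm_le_of_Vvar0 p1 alpha_gt0 alpha_le1 fLp C0 HC h0.
move=> /(lee_wpmul2l (x := (enorm h `^ (- alpha))%:E)).
rewrite lee_fin powR_ge0 => /(_ isT).
move=> /(lee_wpmul2r (x := (2 `^ (alpha - 1))%:E)).
rewrite lee_fin powR_ge0 => /(_ isT) /le_trans; apply.
rewrite -!EFinM lee_fin le_eqVlt; apply/orP; left; apply/eqP.
rewrite [LHS](_ : _ = C * (enorm h `^ (- alpha) * enorm h `^ alpha) *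
  (2 `^ (1 - alpha) * 2 `^ (alpha - 1))); last by ring.
rewrite -!powRD ?(gt_eqF e0) ?implybT ?pnatr_eq0 ?implybT// addNr powRr0.
by rewrite addrA subrK subrr powRr0 !mulr1.
Qed.

End lower_bound_Vvar0.

Theorem theorem3p4 (R : realType) (n : nat) (n_gt0 : (0 < n)%N)
    (p alpha : R) (p_ge1 : 1 <= p) (alpha_gt0 : 0 < alpha) (alpha_le1 : alpha <= 1)
    (f : 'rV[R]_n -> R) (fLp : f \in Lfun (lebesgue_rV n) p%:E) :
  [/\ besov p alpha f <-> (Vvar p alpha f < +oo)%E,
      (Vvar p alpha f < +oo)%E <-> (Vvar0 p alpha f < +oo)%E,
      [/\ ((2 `^ (alpha - 1))%:E * holder_seminorm p alpha f <= Vvar0 p alpha f)%E,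
          (Vvar0 p alpha f <= Vvar p alpha f)%E
        & (Vvar p alpha f <= gauss_const n alpha * holder_seminorm p alpha f)%E]
    & (gauss_const n alpha <= (Num.sqrt n%:R + n%:R)%:E)%E].
Proof.
have a01 : 0 < alpha <= 1 by rewrite alpha_gt0.
have /andP[c0 cle] := gauss_const_bounds n_gt0 a01.
have lo := holder_seminorm_le_Vvar0 p_ge1 alpha_gt0 alpha_le1 fLp.
have mid := Vvar0_le_Vvar alpha f p_ge1.
have up := Vvar_le_gauss n_gt0 p_ge1 alpha_gt0 alpha_le1 fLp.
have s0 := holder_seminorm_ge0 n_gt0 p alpha f.
have t0 : 0 < 2 `^ (alpha - 1) :> R by rewrite powR_gt0.
(* An infinite seminorm would make the left side of [lo] infinite, since its factor is positive. *)
have Vs : (Vvar0 p alpha f < +oo -> holder_seminorm p alpha f < +oo)%E.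
  move=> /(le_lt_trans lo); rewrite !ltey; apply: contra => /eqP ->.
  by rewrite gt0_muley ?lte_fin.
have sV : (holder_seminorm p alpha f < +oo -> Vvar p alpha f < +oo)%E.
  move=> sfin; apply: (le_lt_trans up); apply: lte_mul_pinfty => //; first exact: ltW.
  by rewrite ge0_fin_numE ?(ltW c0)// (le_lt_trans cle)// ltry.
have V10 : (Vvar p alpha f < +oo -> Vvar0 p alpha f < +oo)%E by exact: le_lt_trans.
split => //; last by split => // /Vs/sV.
split => [[_ [C HC]]|Vfin].
  by apply: sV; rewrite (le_lt_trans (holder_seminorm_le HC))// ltry.
have sfin : holder_seminorm p alpha f \is a fin_num by rewrite ge0_fin_numE//; exact/Vs/V10.
split => //; exists (fine (holder_seminorm p alpha f)).
by apply: diff_norm_le => //; rewrite fineK.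
Qed.
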